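(* Let $d \geq 1$ be an integer. Let $X_1, X_2, \ldots$ be independent rotationally invariant random vectors in $\mathbb{R}^d$, each taking values almost surely in the closed unit Euclidean ball of $\mathbb{R}^d$. Let $G_1, G_2, \ldots$ be independent standard Gaussian random vectors in $\mathbb{R}^d$ (mean zero, identity covariance matrix). Then for every $m \geq 1$, all real numbers $a_1, \ldots, a_m$ and every $t > 0$, \[ \mathbb{P}\left(\left\|\sum_{i=1}^m a_i X_i\right\| > t\right) \leq 397 \cdot \mathbb{P}\left(\left\|\sum_{i=1}^m a_i \frac{G_i}{\sqrt{d}}\right\| > t\right). \]
   Context: $\|\cdot\|$ denotes the standard Euclidean norm on $\mathbb{R}^d$. A random vector $X$ in $\mathbb{R}^d$ is rotationally invariant if $UX$ has the same distribution as $X$ for every orthogonal $d\times d$ matrix $U$. *)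

(* Defs.v *)
From HB Require Import structures.
From mathcomp Require Import all_boot all_order all_algebra.
From mathcomp Require Import all_classical all_reals all_analysis.
Set Implicit Arguments. Unset Strict Implicit. Unset Printing Implicit Defensive.
Import Order.TTheory GRing.Theory Num.Theory.
Import numFieldNormedType.Exports.
Local Open Scope classical_set_scope.
Local Open Scope ring_scope.

Definition eucl_norm {R : realType} {d : nat} (v : 'cV[R]_d) : R :=
  Num.sqrt (\sum_(k < d) v k 0 ^+ 2).

Definition orthogonal_mx {R : realType} {d : nat} (U : 'M[R]_d) : Prop :=
  U *m U^T = 1%:M.

Definition borel_vec {R : realType} {d : nat} : set (set 'cV[R]_d) :=
  <<s [set A : set 'cV[R]_d | open A] >>.

Definition random_vec {dT} {T : measurableType dT} {R : realType} {d : nat}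
  (X : T -> 'cV[R]_d) : Prop :=
  forall B, borel_vec B -> measurable (X @^-1` B).

Definition mutually_independent {dT} {T : measurableType dT} {R : realType}
  (P : probability T R) {I : eqType} {V : Type} (mV : set (set V))
  (X : I -> T -> V) : Prop :=
  forall (s : seq I), uniq s -> forall B : I -> set V, (forall i, mV (B i)) ->
    P (\bigcap_(i in [set` s]) (X i @^-1` B i)) =
    (\prod_(i <- s) P (X i @^-1` B i))%E.

Definition rot_invariant {dT} {T : measurableType dT} {R : realType} {d : nat}
  (P : probability T R) (X : T -> 'cV[R]_d) : Prop :=
  forall U : 'M[R]_d, orthogonal_mx U ->
    forall B, borel_vec B ->
      P ((fun w => U *m X w) @^-1` B) = P (X @^-1` B).

Definition std_gaussian_vec {dT} {T : measurableType dT} {R : realType} {d : nat}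
  (P : probability T R) (G : T -> 'cV[R]_d) : Prop :=
  random_vec G /\
  mutually_independent P (@measurable _ R) (fun (k : 'I_d) w => G w k 0) /\
  forall k : 'I_d, forall A : set R, measurable A ->
    P ((fun w => G w k 0) @^-1` A) = normal_prob 0 1 A.

(* Main.v *)
Require Import Defs.
From HB Require Import structures.
From mathcomp Require Import all_boot all_order all_algebra.
From mathcomp Require Import all_classical all_reals all_analysis.
From mathcomp Require Import measurable_realfun ring lra.
Import Order.TTheory GRing.Theory Num.Theory.
Import numFieldNormedType.Exports.
Local Open Scope classical_set_scope.
Local Open Scope ring_scope.
Set Implicit Arguments.
Unset Strict Implicit.

(** The tails are compared through the functions [F_u (v) = (|v|^2 - u)_+^3].  Replacing
    one summand [a X] by [a G / sqrt d] does not decrease [E F_u (x + a X)]: by rotation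
    invariance the direction of [X] can be averaged out, and for a fixed angle the
    average of [F_u] over the two points [x + rho theta] and [x - rho theta] is nondecreasing
    in [rho] and has supporting lines as a function of [rho^2], while [|X| <= 1 <= E |G|^2 / d].
    Independence and induction extend this to the sums, so Markov's inequality bounds
    the tail of [sum a_i X_i] at [t] by [E F_u (sum a_i G_i / sqrt d) / (t^2 - u)^3].

    The squared norm of the Gaussian sum is a multiple of a chi-squared variable with [d]
    degrees of freedom; its density gives tail ratios that allow a choice of [u] for which
    the last quotient is at most [397] times the Gaussian tail at [t]. *)

(** * Cubes of positive parts, summed over two antipodal points *)

Section pos3.
Context {R : realFieldType}.
Implicit Types x y z p r B : R.

(** The exponent is dictated by the supporting lines. Let [s] be the squared radius, [x] its square
    root and [r >= 0] the coefficient of the linear term. Only one of the two antipodal points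
    contributes while [e = B + s + r x] lies between [0] and [2 r x], and there the power [e ^ p] is
    convex in [s] if and only if [e r <= (p - 1) x (2 x + r) ^ 2]. Up to [e = 2 r x] this holds for
    [p = 3]; for any smaller [p] it fails once [r] is large against [x].

    The choice of [u] meets an obstacle in dimension one: the chi-squared density, proportional to
    [z ^ (d / 2 - 1) * exp (- z / 2)], is log-concave only for [d >= 2], so the case [d = 1] rests
    on direct estimates of the tail.

    In [397 = 347 + 50], the [50] bounds what the levels from the threshold upwards contribute to
    the cubic moment, and [347] is the growth of the tail that is tolerated between the threshold
    and [u]. In dimension one the tightest estimate is a tail of at least [1 / 384] at level [4]. *)

Definition pos3 x : R := Num.max x 0 ^+ 3.

Lemma pos3_ge0 x : 0 <= pos3 x.
Proof. by rewrite exprn_ge0// le_max lexx orbT. Qed.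

Lemma pos3E x : 0 <= x -> pos3 x = x ^+ 3.
Proof. by move=> x0; rewrite /pos3 max_l. Qed.

Lemma pos3_eq0 x : x <= 0 -> pos3 x = 0.
Proof. by move=> x0; rewrite /pos3 max_r// expr0n. Qed.

Lemma le_pos3 : {homo pos3 : x y / x <= y}.
Proof.
move=> x y xy; have [y0|/ltW y0] := leP y 0.
  by rewrite !pos3_eq0//; exact: le_trans xy y0.
have [x0|/ltW x0] := leP x 0; first by rewrite [pos3 x]pos3_eq0// pos3_ge0.
by rewrite !pos3E// lerXn2r.
Qed.

Lemma pos3M k x : 0 <= k -> pos3 (k * x) = k ^+ 3 * pos3 x.
Proof.
by move=> k0; rewrite /pos3 -exprMn maxr_pMr// mulr0.
Qed.

Definition sym3 p z : R := pos3 (p + z) + pos3 (p - z).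

Lemma sym3_ge0 p z : 0 <= sym3 p z.
Proof. by rewrite addr_ge0// pos3_ge0. Qed.

Lemma sym3N p z : sym3 p (- z) = sym3 p z.
Proof. by rewrite /sym3 opprK addrC. Qed.

Lemma sym3_norm p z : sym3 p `|z| = sym3 p z.
Proof. by case: (ger0P z) => // _; rewrite sym3N. Qed.

Lemma sym3_mid p z : `|p| <= z -> sym3 p z = (p + z) ^+ 3.
Proof.
by rewrite ler_norml => /andP[h1 h2]; rewrite /sym3 pos3E ?pos3_eq0 ?addr0//; lra.
Qed.

Lemma sym3_right p z : `|z| <= p -> sym3 p z = p ^+ 3 *+ 2 + p * z ^+ 2 *+ 6.
Proof.
by rewrite ler_norml => /andP[h1 h2]; rewrite /sym3 !pos3E; [ring|lra|lra].
Qed.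

Lemma sym3_left p z : `|z| <= - p -> sym3 p z = 0.
Proof.
by rewrite ler_norml => /andP[h1 h2]; rewrite /sym3 !pos3_eq0 ?addr0//; lra.
Qed.

(** Spreading two antipodal points apart raises the sum of a convex function. The cases record
    whether none, one or both of the cubes are active. *)
Lemma le_sym3 p p' z z' : p <= p' -> `|z| <= z' -> sym3 p z <= sym3 p' z'.
Proof.
move=> pp'; rewrite -sym3_norm; have := normr_ge0 z; move: `|z| => {z} z z0 zz'.
apply: (@le_trans _ _ (sym3 p' z)).
  by rewrite lerD// le_pos3// ?lerD2l ?lerD2r.
have [pl|pl] := leP p' (- z).
  rewrite (@sym3_left p' z) ?sym3_ge0// ger0_norm//; lra.
have [h|h] := leP p' z.
  rewrite sym3_mid; last by rewrite ler_norml; apply/andP; split; lra.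
  rewrite sym3_mid; last by rewrite ler_norml; apply/andP; split; lra.
  by rewrite lerXn2r ?nnegrE//; lra.
have zz2 : z ^+ 2 <= z' ^+ 2 by rewrite lerXn2r ?nnegrE//; lra.
have [h'|h'] := leP p' z'.
  rewrite sym3_right ?ger0_norm//; last lra.
  rewrite sym3_mid; last by rewrite ler_norml; apply/andP; split; lra.
  (* The formula for one active cube exceeds the formula for two by [(z' - p') ^+ 3], which bridges
     the two regimes. *)
  have e : (p' + z') ^+ 3 = p' ^+ 3 *+ 2 + p' * z' ^+ 2 *+ 6 + (z' - p') ^+ 3.
    by ring.
  rewrite e; have : 0 <= (z' - p') ^+ 3 by rewrite exprn_ge0// subr_ge0.
  have : 0 <= p' * (z' ^+ 2 - z ^+ 2) by rewrite mulr_ge0 ?subr_ge0//; lra.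
  lra.
rewrite !sym3_right ?ger0_norm//; [|lra..].
have : 0 <= p' * (z' ^+ 2 - z ^+ 2) by rewrite mulr_ge0 ?subr_ge0//; lra.
lra.
Qed.

(** The formula for two active cubes stays a lower bound elsewhere: for [0 < p < |z|] it falls short
    by the cube of [|z| - p], and for [p <= 0] it is nonpositive. Tangent bounds in that regime thus
    become polynomial inequalities. *)
Lemma sym3_ge_poly p z : p ^+ 3 *+ 2 + p * z ^+ 2 *+ 6 <= sym3 p z.
Proof.
rewrite -sym3_norm -[z ^+ 2]real_normK ?num_real//.
have := normr_ge0 z; move: `|z| => {z} z z0.
have [h|h] := leP z p; first by rewrite sym3_right// ger0_norm.
have [h'|h'] := leP p 0.
  apply: (@le_trans _ _ 0); last exact: sym3_ge0.
  rewrite (_ : _ + _ = p * (p ^+ 2 *+ 2 + z ^+ 2 *+ 6)); last by ring.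
  by rewrite mulr_le0_ge0 ?addr_ge0 ?mulrn_wge0 ?sqr_ge0.
rewrite sym3_mid; last by rewrite ler_norml; apply/andP; split; lra.
rewrite -subr_ge0 (_ : _ - _ = (z - p) ^+ 3); last by ring.
by rewrite exprn_ge0//; lra.
Qed.

Lemma sym3_ge_mid p z : 0 <= p + z -> (p + z) ^+ 3 + pos3 (p - z) <= sym3 p z.
Proof. by move=> pz; rewrite /sym3 (@pos3E (p + z)). Qed.

Let pos3_lip a k l : a <= k -> 0 <= k -> 0 <= l ->
  pos3 a <= pos3 (a - l) + k ^+ 2 * l *+ 3.
Proof.
move=> ak k0 l0.
have kl : 0 <= k ^+ 2 * l by rewrite mulr_ge0// sqr_ge0.
have [a0|/ltW a0] := leP a 0.
  by rewrite [pos3 a]pos3_eq0// addr_ge0 ?pos3_ge0// mulrn_wge0.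
have a2 : a ^+ 2 <= k ^+ 2 by rewrite lerXn2r.
have a2l : a ^+ 2 * l <= k ^+ 2 * l by rewrite ler_wpM2r.
rewrite pos3E//; have [al|/ltW al] := leP a l.
  rewrite pos3_eq0; last lra.
  have : a ^+ 2 * a <= a ^+ 2 * l by rewrite ler_wpM2l// sqr_ge0.
  by rewrite -exprSr; lra.
rewrite pos3E; last lra.
rewrite (_ : (a - l) ^+ 3 = a ^+ 3 - a ^+ 2 * l *+ 3 + l * (l * (a *+ 3 - l))); last by ring.
have : 0 <= l * (l * (a *+ 3 - l)) by rewrite !mulr_ge0//; lra.
lra.
Qed.

(** The tangent inequality to the left of [x0] when one cube is active at [x0]: [e] and [f] are
    [z + p] and [z - p] at [x0], while [k] and [l] are the decreases of the linear and the quadratic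
    term. The core is [l = 0]; as [l] grows, the polynomial gains at least [3 k ^ 2 l], which covers
    the loss in the last cube. *)
Let sym3_mid_gap e f k l : 0 <= f -> 0 <= k -> 0 <= l -> k + l <= e ->
    k *+ 2 <= e + f -> 0 < e + f ->
  e ^+ 2 * k ^+ 2 / (e + f) *+ 3 <=
    (k + l) ^+ 2 * (e *+ 3 - k - l) + pos3 (k - l - f).
Proof.
move=> f0 k0 l0 kle kD D0.
apply: (@le_trans _ _ (k ^+ 2 * (e *+ 3 - k) + pos3 (k - f))); last first.
  have : pos3 (k - f) <= pos3 (k - l - f) + k ^+ 2 * l *+ 3.
    by rewrite -(addrAC k (- f)); apply: pos3_lip => //; lra.
  suff : k ^+ 2 * l *+ 3 <= (k + l) ^+ 2 * (e *+ 3 - k - l) - k ^+ 2 * (e *+ 3 - k) by lra.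
  rewrite -subr_ge0 (_ : _ - _ = (e - k - l) * (l * (k *+ 2 + l)) *+ 3 +
    l * (k * l *+ 6 + l ^+ 2 *+ 2)); last by ring.
  have kl0 : 0 <= k * l by rewrite mulr_ge0.
  have ll0 : 0 <= l ^+ 2 by rewrite sqr_ge0.
  by rewrite addr_ge0 ?mulrn_wge0// !mulr_ge0//; lra.
rewrite -mulrnAl ler_pdivrMr// -subr_ge0.
have [fk|/ltW fk] := leP k f.
  rewrite pos3_eq0; last lra.
  rewrite (_ : _ - _ = k ^+ 2 * (e * (f - k) + f * (e - k) + e * f)); last by ring.
  by rewrite mulr_ge0 ?sqr_ge0// !addr_ge0// mulr_ge0//; lra.
rewrite pos3E; last lra.
rewrite (_ : _ - _ = f ^+ 2 * ((e - k) * (k *+ 3 - f) + f * (k *+ 2 - f))); last by ring.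
by rewrite mulr_ge0 ?sqr_ge0// addr_ge0// mulr_ge0//; lra.
Qed.

(** The slope is the derivative in [s = x ^+ 2] at [x0], computed in the regime of [x0]; the work
    lies in keeping the bound when [x] is in another regime. *)
Let sym3_tangent_nneg B r x0 : 0 <= r -> 0 < x0 ->
  exists2 m, 0 <= m & forall x, 0 <= x ->
    sym3 (B + x0 ^+ 2) (r * x0) + m * (x ^+ 2 - x0 ^+ 2) <=
    sym3 (B + x ^+ 2) (r * x).
Proof.
move=> r0 x00; pose p0 := B + x0 ^+ 2; pose z0 := r * x0.
have z00 : 0 <= z0 by rewrite mulr_ge0// ltW.
have [h|h] := leP p0 (- z0).
  exists 0 => // x _; rewrite mul0r addr0 sym3_left ?sym3_ge0// -/p0 -/z0.
  by rewrite ger0_norm//; lra.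
have r20 : 0 <= r ^+ 2 by rewrite sqr_ge0.
have x20 : 0 <= x0 ^+ 2 by rewrite sqr_ge0.
have [h'|h'] := leP z0 p0.
  have p00 : 0 <= p0 by lra.
  have p0r : 0 <= p0 * r ^+ 2 by rewrite mulr_ge0.
  have rx0 : 0 <= r ^+ 2 * x0 ^+ 2 by rewrite mulr_ge0.
  have p02 : 0 <= p0 ^+ 2 by rewrite sqr_ge0.
  exists (p0 ^+ 2 *+ 6 + p0 * r ^+ 2 *+ 6 + r ^+ 2 * x0 ^+ 2 *+ 6); first lra.
  move=> x x0'; rewrite sym3_right ?ger0_norm// -/p0 -/z0.
  set m := (_ + _ *+ 6 + _ *+ 6).
  have xx0 : 0 <= x ^+ 2 by rewrite sqr_ge0.
  (* With [D] the increment of [x ^+ 2], the cubic minus its tangent is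
     [D ^ 2 * (6 p0 + 6 r ^ 2 + 2 D)], nonnegative down to this threshold; below it the tangent line
     is already nonpositive. *)
  have [D|D] := leP (- (p0 *+ 3 + r ^+ 2 *+ 3)) (x ^+ 2 - x0 ^+ 2).
    apply: le_trans (sym3_ge_poly _ _).
    rewrite -subr_ge0 /m /z0 (_ : _ - _ = (x ^+ 2 - x0 ^+ 2) ^+ 2 *
      (p0 *+ 6 + r ^+ 2 *+ 6 + (x ^+ 2 - x0 ^+ 2) *+ 2)); last by rewrite /p0; ring.
    by rewrite mulr_ge0 ?sqr_ge0//; lra.
  apply: (@le_trans _ _ 0); last exact: sym3_ge0.
  apply: (@le_trans _ _ (p0 ^+ 3 *+ 2 + p0 * z0 ^+ 2 *+ 6 - m * (p0 *+ 3))).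
    rewrite lerD2l -(mulrN m) ler_wpM2l//; last lra.
    by rewrite /m; lra.
  rewrite -oppr_ge0 [X in 0 <= X](_ : _ = p0 * (p0 ^+ 2 *+ 16 + (p0 * r ^+ 2) *+ 18 + (r ^+ 2 * x0 ^+ 2) *+ 12)).
    by rewrite mulr_ge0//; lra.
  by rewrite /m /z0; ring.
pose e := p0 + z0; pose f := z0 - p0.
have e0 : 0 < e by rewrite /e; lra.
have f0 : 0 < f by rewrite /f; lra.
have ef : e + f = r * x0 *+ 2 by rewrite /e /f /z0; ring.
have rp : 0 < r.
  by rewrite lt0r r0 andbT; apply/eqP => r_0; move: ef; rewrite r_0 mul0r mul0rn; lra.
exists (e ^+ 2 * (x0 *+ 2 + r) / (x0 *+ 2) *+ 3).
  rewrite mulrn_wge0// !mulr_ge0 ?invr_ge0 ?sqr_ge0//; lra.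
move=> x x_ge0; rewrite sym3_mid -/p0 -/z0; last first.
  by rewrite ler_norml; apply/andP; split; lra.
rewrite -/e; set m := (X in _ + X * _).
(* [Y] is the increment of [e]. As the square root is concave, the tangent in [x ^+ 2] exceeds
   [3 e ^ 2 Y] by the quadratic term of [mE], where [e + f = 2 r x0]. *)
pose Y := (x - x0) * (x + x0 + r).
have pzE : B + x ^+ 2 + r * x = e + Y by rewrite /Y /e /p0 /z0; ring.
have mE : m * (x ^+ 2 - x0 ^+ 2) =
    e ^+ 2 * Y *+ 3 + e ^+ 2 * ((x - x0) * r) ^+ 2 / (e + f) *+ 3.
  by rewrite ef /m /Y; field; rewrite !gt_eqF.
rewrite mE {mE m}.
have [xx|/ltW xx] := leP x0 x.
  have Y0 : 0 <= Y by rewrite mulr_ge0//; lra.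
  apply: le_trans (@sym3_ge_mid _ _ _); last by rewrite pzE; lra.
  rewrite pzE.
  suff : e ^+ 2 * ((x - x0) * r) ^+ 2 / (e + f) *+ 3 <= e * Y ^+ 2 *+ 3.
    have := pos3_ge0 (B + x ^+ 2 - r * x).
    have : 0 <= Y ^+ 3 by rewrite exprn_ge0.
    rewrite (_ : (e + Y) ^+ 3 = e ^+ 3 + e ^+ 2 * Y *+ 3 + e * Y ^+ 2 *+ 3 + Y ^+ 3); last by ring.
    lra.
  rewrite lerMn2r/= ler_pdivrMr; last lra.
  rewrite -subr_ge0 (_ : _ - _ = e * (e * (Y ^+ 2 - ((x - x0) * r) ^+ 2) + f * Y ^+ 2)); last by ring.
  rewrite mulr_ge0//; first lra.
  apply: addr_ge0; last by rewrite mulr_ge0 ?sqr_ge0//; lra.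
  apply: mulr_ge0; first lra.
  have xr0 : 0 <= (x - x0) * r by rewrite mulr_ge0//; lra.
  by rewrite subr_ge0 lerXn2r// /Y ler_wpM2l//; lra.
pose k := (x0 - x) * r; pose l := x0 ^+ 2 - x ^+ 2.
have k0 : 0 <= k by rewrite mulr_ge0//; lra.
have l0 : 0 <= l by rewrite subr_ge0 lerXn2r// nnegrE ltW.
have YE : Y = - (k + l) by rewrite /Y /k /l; ring.
have kD : k *+ 2 <= e + f.
  by rewrite ef lerMn2r/= /k mulrC ler_wpM2l//; lra.
rewrite (_ : ((x - x0) * r) ^+ 2 = k ^+ 2); last by rewrite /k; ring.
(* Either the base of the cube is still nonnegative at [x], or the tangent line has become
   nonpositive there, by [kk]. *)
have [kle|kle] := leP (k + l) e.
  apply: le_trans (@sym3_ge_mid _ _ _); last by rewrite pzE YE; lra.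
  rewrite pzE (_ : B + x ^+ 2 - r * x = k - l - f); last first.
    by rewrite /k /l /f /p0 /z0; ring.
  have := @sym3_mid_gap e f k l (ltW f0) k0 l0 kle kD.
  rewrite addr_gt0// => /(_ isT).
  rewrite YE (_ : (e - (k + l)) ^+ 3 = e ^+ 3 - e ^+ 2 * (k + l) *+ 3
     + (k + l) ^+ 2 * (e *+ 3 - k - l)); last by ring.
  lra.
apply: (@le_trans _ _ 0); last exact: sym3_ge0.
have kk : k ^+ 2 / (e + f) <= k / 2.
  by rewrite ler_pdivrMr; [rewrite expr2 -(mulrA k) ler_wpM2l//; lra|lra].
rewrite YE (_ : _ + _ = e ^+ 2 * (e - (k + l) *+ 3 + k ^+ 2 / (e + f) *+ 3)); last first.
  by rewrite -[e ^+ 2 * k ^+ 2 / _]mulrA; ring.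
rewrite mulr_ge0_le0 ?sqr_ge0//; lra.
Qed.

(* [s |-> sym3 (B + s) (r * sqrt s)] has a supporting line at [s = x0 ^+ 2]. *)
Lemma sym3_tangent B r x0 : 0 < x0 ->
  exists2 m, 0 <= m & forall x, 0 <= x ->
    sym3 (B + x0 ^+ 2) (r * x0) + m * (x ^+ 2 - x0 ^+ 2) <=
    sym3 (B + x ^+ 2) (r * x).
Proof.
move=> x00; have [m m0 mP] := @sym3_tangent_nneg B `|r| _ (normr_ge0 r) x00.
exists m => // x x_ge0; have := mP x x_ge0.
by rewrite -(sym3_norm _ (r * x0)) -(sym3_norm _ (r * x)) !normrM (gtr0_norm x00) (ger0_norm x_ge0).
Qed.

End pos3.

(** * Affine substitution for Lebesgue measure *)

Section affine.
Context {R : realType}.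
Local Notation mu := (@lebesgue_measure R).
Local Open Scope ereal_scope.

Let aff (a b : R) : R -> measurableTypeR R := fun x => (a * x + b)%R.

Let maff a b : measurable_fun setT (aff a b).
Proof.
by apply: measurable_funD => //; apply: measurable_funM.
Qed.

Let affine_measure (a b : R) : {measure set (measurableTypeR R) -> \bar R}.
Proof.
by refine (mscale (NngNum (normr_ge0 a)) (pushforward mu (aff a b))); exact: maff.
Defined.

(** Agreement on half-open intervals is enough, by uniqueness of Lebesgue measure. A negative [a]
    swaps the closed and the open end, which does not change the length. *)
Lemma lebesgue_measure_affine (a b : R) (A : set R) : a != 0%R -> measurable A ->
  mu A = `|a|%:E * mu (aff a b @^-1` A).
Proof.
move=> a0 mA; rewrite (_ : _ * _ = affine_measure a b A)//.
apply: lebesgue_measure_unique => //= _ [[p q]] _ <-.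
rewrite /mscale/= /pushforward.
have a00 : (0 < `|a|)%R by rewrite normr_gt0.
have [an|ap|/eqP] := ltgtP a 0%R; last by rewrite (negbTE a0).
- rewrite (_ : _ @^-1` _ = `[((q - b) / a)%R, ((p - b) / a)%R[%classic).
    rewrite !lebesgue_measure_itv/= !lte_fin ltr_ndivrMr// divfK ?lt_eqF// ltrD2r.
    case: ifPn => pq; last by rewrite mule0.
    rewrite -!EFinD -EFinM; congr EFin; rewrite ltr0_norm//.
    by field; rewrite lt_eqF.
  apply/seteqP; split => x /=; rewrite !in_itv/= /aff => /andP[h1 h2]; apply/andP; split.
  + by rewrite ler_ndivrMr//; lra.
  + by rewrite ltr_ndivlMr//; lra.
  + by move: h2; rewrite ltr_ndivlMr//; lra.
  + by move: h1; rewrite ler_ndivrMr//; lra.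
- rewrite (_ : _ @^-1` _ = `]((p - b) / a)%R, ((q - b) / a)%R]%classic).
    rewrite !lebesgue_measure_itv/= !lte_fin ltr_pdivrMr// divfK ?gt_eqF// ltrD2r.
    case: ifPn => pq; last by rewrite mule0.
    rewrite -!EFinD -EFinM; congr EFin; rewrite gtr0_norm//.
    by field; rewrite gt_eqF.
  apply/seteqP; split => x /=; rewrite !in_itv/= /aff => /andP[h1 h2]; apply/andP; split.
  + by rewrite ltr_pdivrMr//; lra.
  + by rewrite ler_pdivlMr//; lra.
  + by move: h1; rewrite ltr_pdivrMr//; lra.
  + by move: h2; rewrite ler_pdivlMr//; lra.
Qed.

Lemma ge0_integral_affine (a b : R) (f : R -> \bar R) : a != 0%R ->
  measurable_fun setT f -> (forall x, 0 <= f x) ->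
  \int[mu]_x f x = `|a|%:E * \int[mu]_x f (a * x + b)%R.
Proof.
move=> a0 mf f0.
transitivity (\int[affine_measure a b]_x f x).
  by apply: eq_measure_integral => A mA _; exact: lebesgue_measure_affine.
rewrite /affine_measure ge0_integral_mscale//.
by rewrite ge0_integral_pushforward//; exact: maff.
Qed.

End affine.

(** * Densities, laws and the standard normal law *)

Section density.
Local Open Scope ereal_scope.
Context d (T : measurableType d) (R : realType).
Variables (mu nu : {measure set T -> \bar R}) (p : T -> R).
Hypothesis p0 : forall x, (0 <= p x)%R.
Hypothesis mp : measurable_fun setT p.
Hypothesis nuE : forall A, measurable A -> nu A = \int[mu]_(x in A) (p x)%:E.
Import HBNNSimple.

(** [nuE] summed over the level sets of simple functions, followed by monotone convergence. *)
Lemma ge0_integral_density (f : T -> \bar R) :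
  measurable_fun setT f -> (forall x, 0 <= f x) ->
  \int[nu]_x f x = \int[mu]_x (f x * (p x)%:E).
Proof.
move=> mf f0; pose f_ := nnsfun_approx measurableT mf.
transitivity (limn (fun n => \int[nu]_x (f_ n x)%:E)).
  rewrite -monotone_convergence//.
  - by apply: eq_integral => x _; apply/esym/cvg_lim => //; exact: cvg_nnsfun_approx.
  - by move=> n; apply/measurable_EFinP.
  - by move=> *; rewrite lee_fin.
  - by move=> x _ m n mn; rewrite lee_fin; exact/lefP/nd_nnsfun_approx.
transitivity (limn (fun n => \int[mu]_x ((f_ n x)%:E * (p x)%:E))); last first.
  rewrite -monotone_convergence//.
  - apply: eq_integral => x _; apply/cvg_lim => //.
    by apply: cvgeZr => //; exact: cvg_nnsfun_approx.
  - by move=> n; apply/measurable_EFinP; exact: measurable_funM.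
  - by move=> n x _; rewrite mule_ge0 ?lee_fin.
  - move=> x _ m n mn; apply: lee_wpmul2r; first by rewrite lee_fin.
    by rewrite lee_fin; exact/lefP/nd_nnsfun_approx.
congr (limn _); apply/funext => n.
have mpre r : measurable (f_ n @^-1` [set r]).
  by rewrite -[X in measurable X]setTI; exact: measurable_funPT.
transitivity (\sum_(r \in range (f_ n)) r%:E * nu (f_ n @^-1` [set r])).
  under eq_integral do rewrite fimfunE -fsumEFin//.
  rewrite ge0_integral_fsum//; last 2 first.
  - by move=> r; exact/measurable_EFinP/measurable_funM.
  - by move=> r x _; rewrite nnfun_muleindic_ge0.
  apply: eq_fsbigr => r _.
  by rewrite integralZl_indic_nnsfun// integral_indic//= setIT.
transitivity (\int[mu]_x (\sum_(r \in range (f_ n)) (r * \1_(f_ n @^-1` [set r]) x)%:E * (p x)%:E)).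
  rewrite ge0_integral_fsum//; last 2 first.
  - move=> r; apply/measurable_EFinP/measurable_funM => //.
    exact: measurable_funM.
  - by move=> r x _; rewrite mule_ge0 ?nnfun_muleindic_ge0// lee_fin.
  apply: eq_fsbigr => r /[!inE] -[x _ <-{r}].
  under [RHS]eq_integral do rewrite EFinM -muleA.
  rewrite ge0_integralZl//; last 3 first.
  - by apply: emeasurable_funM; exact/measurable_EFinP.
  - by move=> y _; rewrite -EFinM lee_fin mulr_ge0.
  - by rewrite lee_fin.
  congr (_ * _); rewrite nuE// integral_mkcond/=.
  apply: eq_integral => y _; rewrite patchE indicE.
  by case: ifPn => _; rewrite ?mul1e ?mul0e.
apply: eq_integral => x _; rewrite fimfunE -fsumEFin// ge0_mule_fsuml//.
by move=> r; rewrite nnfun_muleindic_ge0.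
Qed.

End density.

Section law.
Local Open Scope ereal_scope.
Context d d' (T : measurableType d) (E : measurableType d') (R : realType).
Variables (P : probability T R) (X : T -> E).
Hypothesis mX : measurable_fun setT X.

Let Xm : {mfun T >-> E} := HB.pack X (isMeasurableFun.Build _ _ _ _ _ mX).

Definition law : probability E R := distribution P Xm.

Lemma ge0_integral_law (f : E -> \bar R) : measurable_fun setT f ->
  (forall x, 0 <= f x) -> \int[law]_x f x = \int[P]_w f (X w).
Proof. by move=> mf f0; rewrite ge0_integral_distribution. Qed.

End law.

Section normal.
Context {R : realType}.
Local Notation mu := (@lebesgue_measure R).
Local Open Scope ereal_scope.

Definition gpdf (x : R) : R := normal_pdf 0 1 x.

Lemma gpdfE x : gpdf x = (normal_peak 1 * expR (- x ^+ 2 / 2))%R.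
Proof.
by rewrite /gpdf normal_pdfE ?oner_eq0// /normal_fun subr0 expr1n.
Qed.

Lemma gpdf_ge0 x : (0 <= gpdf x)%R.
Proof. exact: normal_pdf_ge0. Qed.

Lemma measurable_gpdf : measurable_fun setT gpdf.
Proof. exact: measurable_normal_pdf. Qed.

Let measurable_idR : measurable_fun setT (idfun : measurableTypeR R -> R).
Proof. by move=> _ A mA; rewrite setTI preimage_id. Qed.

(* [normal_prob] lives on the alias [measurableTypeR R] of [R], whose measurable
   structure is not unifiable with the canonical one. *)
Definition std_gauss : probability R R := law (normal_prob 0 1) measurable_idR.

Lemma std_gaussE A : std_gauss A = normal_prob 0 1 A.
Proof. by []. Qed.

Lemma ge0_integral_std_gauss (f : R -> \bar R) :
  measurable_fun setT f -> (forall x, 0 <= f x) ->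
  \int[std_gauss]_x f x = \int[mu]_x (f x * (gpdf x)%:E).
Proof.
move=> mf f0; transitivity (\int[normal_prob 0 1]_x f x).
  exact: ge0_integral_law.
apply: ge0_integral_density => //.
- exact: gpdf_ge0.
- exact: measurable_gpdf.
Qed.

End normal.
Arguments std_gauss {R}.

(** * Tonelli's theorem for curried functions *)

Section tonelli.
Local Open Scope ereal_scope.
Context d1 d2 (T1 : measurableType d1) (T2 : measurableType d2) (R : realType).
Variable m1 : {sigma_finite_measure set T1 -> \bar R}.
Variable m2 : {sigma_finite_measure set T2 -> \bar R}.
Variable f : T1 -> T2 -> \bar R.
Hypothesis mf : measurable_fun [set: T1 * T2] (fun p => f p.1 p.2).
Hypothesis f0 : forall x y, 0 <= f x y.

Lemma tonelli_swap :
  \int[m1]_x \int[m2]_y f x y = \int[m2]_y \int[m1]_x f x y.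
Proof.
exact: (@fubini_tonelli _ _ _ _ _ m1 m2 (fun p => f p.1 p.2) mf).
Qed.

Lemma measurable_integral_snd : measurable_fun setT (fun x => \int[m2]_y f x y).
Proof.
exact: (@measurable_fun_fubini_tonelli_F _ _ _ _ _ m2 (fun p => f p.1 p.2)).
Qed.

Lemma measurable_integral_fst : measurable_fun setT (fun y => \int[m1]_x f x y).
Proof.
exact: (@measurable_fun_fubini_tonelli_G _ _ _ _ _ m1 (fun p => f p.1 p.2)).
Qed.

End tonelli.

(** * Rotation invariance of the planar Gaussian law *)

Section rotation.
Context {R : realType}.
Local Notation mu := (@lebesgue_measure R).
Local Notation gauss := (@std_gauss R).
Local Open Scope ereal_scope.

Let swapR (f : R -> R -> \bar R) :
  measurable_fun setT (fun p : R * R => f p.1 p.2) -> (forall x y, 0 <= f x y) ->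
  \int[mu]_x \int[mu]_y f x y = \int[mu]_y \int[mu]_x f x y.
Proof. exact: (@tonelli_swap _ _ (measurableTypeR R) (measurableTypeR R) R mu mu f). Qed.

Let mfstR (f : R -> R -> \bar R) :
  measurable_fun setT (fun p : R * R => f p.1 p.2) -> (forall x y, 0 <= f x y) ->
  measurable_fun setT (fun y => \int[mu]_x f x y).
Proof. exact: (@measurable_integral_fst _ _ (measurableTypeR R) (measurableTypeR R) R mu f). Qed.

Let msndR (f : R -> R -> \bar R) :
  measurable_fun setT (fun p : R * R => f p.1 p.2) -> (forall x y, 0 <= f x y) ->
  measurable_fun setT (fun x => \int[mu]_y f x y).
Proof. exact: (@measurable_integral_snd _ _ (measurableTypeR R) (measurableTypeR R) R mu f). Qed.

Let meas2 (f : R -> R -> \bar R) (a b : R * R -> R) :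
  measurable_fun setT (fun p : R * R => f p.1 p.2) ->
  measurable_fun setT a -> measurable_fun setT b ->
  measurable_fun setT (fun p : R * R => f (a p) (b p)).
Proof.
move=> mf ma mb.
exact: (@measurableT_comp _ _ _ _ _ _ _ _ (fun p => (a p, b p)) mf (measurable_fun_pair ma mb)).
Qed.

Let meas_pair1 (f : R -> R -> \bar R) x :
  measurable_fun setT (fun p : R * R => f p.1 p.2) ->
  measurable_fun setT (f x).
Proof.
move=> mf.
exact: (@measurableT_comp _ _ _ _ _ _ _ _ (fun y => (x, y)) mf (measurable_fun_pair _ _)).
Qed.

Let meas_pair2 (f : R -> R -> \bar R) y :
  measurable_fun setT (fun p : R * R => f p.1 p.2) ->
  measurable_fun setT (f^~ y).
Proof.
move=> mf.
exact: (@measurableT_comp _ _ _ _ _ _ _ _ (fun x => (x, y)) mf (measurable_fun_pair _ _)).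
Qed.

Lemma ge0_integral_gauss2 (f : R -> R -> \bar R) :
  measurable_fun setT (fun p : R * R => f p.1 p.2) -> (forall x y, 0 <= f x y) ->
  \int[gauss]_x \int[gauss]_y f x y =
  \int[mu]_x \int[mu]_y (f x y * (gpdf x * gpdf y)%:E).
Proof.
move=> mf f0.
rewrite ge0_integral_std_gauss; last 2 first.
- exact: measurable_integral_snd.
- by move=> x; exact: integral_ge0.
apply: eq_integral => x _.
have mfx : measurable_fun setT (f x) by exact: meas_pair1.
rewrite ge0_integral_std_gauss//.
rewrite -ge0_integralZr//; last 3 first.
- by apply: emeasurable_funM => //; apply/measurable_EFinP; exact: measurable_gpdf.
- by move=> y _; rewrite mule_ge0// lee_fin gpdf_ge0.
- by rewrite lee_fin gpdf_ge0.
by apply: eq_integral => y _; rewrite -muleA EFinM [_%:E * _%:E]muleC.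
Qed.

Lemma gpdf_rot (c s u v : R) : (c ^+ 2 + s ^+ 2 = 1)%R ->
  (gpdf (c * u - s * v) * gpdf (c * v + s * u) = gpdf u * gpdf v)%R.
Proof.
move=> cs; rewrite !gpdfE mulrACA [RHS]mulrACA -!expRD; congr (_ * expR _)%R.
have e : ((c * u - s * v) ^+ 2 + (c * v + s * u) ^+ 2 = u ^+ 2 + v ^+ 2)%R.
  rewrite (_ : _ + _ = (c ^+ 2 + s ^+ 2) * (u ^+ 2 + v ^+ 2))%R; last by ring.
  by rewrite cs mul1r.
lra.
Qed.

(** For [c != 0] a rotation is a composition of two affine substitutions, each in one variable with
    the other fixed. Their Jacobians [1 / c] and [c] cancel, and the density is unchanged by
    [gpdf_rot]. *)
Let gauss_rotation_neq0 (c s : R) (f : R -> R -> \bar R) :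
  c != 0%R -> (c ^+ 2 + s ^+ 2 = 1)%R ->
  measurable_fun setT (fun p : R * R => f p.1 p.2) -> (forall x y, 0 <= f x y) ->
  \int[gauss]_x \int[gauss]_y f (c * x + s * y)%R (c * y - s * x)%R =
  \int[gauss]_x \int[gauss]_y f x y.
Proof.
move=> c0 cs mf f0.
have mpdf2 (a b : R * R -> R) : measurable_fun setT a -> measurable_fun setT b ->
    measurable_fun setT (fun p => (gpdf (a p) * gpdf (b p))%:E).
  move=> ma mb; apply/measurable_EFinP; apply: measurable_funM.
    by apply: (measurableT_comp measurable_gpdf).
  by apply: (measurableT_comp measurable_gpdf).
have mlin (a b : R) : measurable_fun setT (fun p : R * R => a * p.1 + b * p.2)%R.
  by apply: measurable_funD; apply: measurable_funM.
have mlin' (a b : R) : measurable_fun setT (fun p : R * R => a * p.2 - b * p.1)%R.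
  by apply: measurable_funB; apply: measurable_funM.
pose g (x y : R) := f (c * x + s * y)%R (c * y - s * x)%R * (gpdf x * gpdf y)%:E.
have g0 x y : 0 <= g x y by rewrite mule_ge0// lee_fin mulr_ge0// gpdf_ge0.
have mg : measurable_fun setT (fun p : R * R => g p.1 p.2).
  by apply: emeasurable_funM; [exact: meas2|exact: mpdf2].
(* First substitution, at fixed [y]: [u = c x + s y]. *)
pose h (u y : R) := g ((u - s * y) / c)%R y.
have h0 u y : 0 <= h u y by exact: g0.
have mh : measurable_fun setT (fun p : R * R => h p.1 p.2).
  apply: (@meas2 g (fun p => (p.1 - s * p.2) / c)%R snd mg) => //.
  apply: measurable_funM => //; apply: measurable_funB => //.
  exact: measurable_funM.
have mk : measurable_fun setT (fun p : R * R => h p.1 (c * p.2 + s * p.1)%R).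
  apply: (@meas2 h fst (fun p => c * p.2 + s * p.1)%R mh) => //.
  by apply: measurable_funD; apply: measurable_funM.
transitivity (\int[mu]_x \int[mu]_y g x y).
  apply: (@ge0_integral_gauss2 (fun x y => f (c * x + s * y)%R (c * y - s * x)%R)) => //.
  exact: (@meas2 f _ _ mf (mlin c s) (mlin' c s)).
transitivity (\int[mu]_u \int[mu]_v (f u v * (gpdf u * gpdf v)%:E)); last first.
  exact/esym/ge0_integral_gauss2.
transitivity (\int[mu]_y \int[mu]_x g x y); first exact: swapR.
transitivity (`|c^-1|%:E * \int[mu]_y \int[mu]_u h u y).
  rewrite -ge0_integralZl//; last 2 first.
  - exact: (@mfstR h).
  - by move=> y _; exact: integral_ge0.
  apply: eq_integral => y _.
  transitivity (`|c^-1|%:E * \int[mu]_u g (c^-1 * u + - (s * y / c))%R y).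
    apply: (@ge0_integral_affine _ _ _ (fun x => g x y)) => //.
      by rewrite invr_eq0.
    exact: meas_pair2.
  apply: (congr1 (mule `|c^-1|%:E)); apply: eq_integral => u _.
  by rewrite /h; congr (g _ _); field.
transitivity (`|c^-1|%:E * \int[mu]_u \int[mu]_y h u y).
  by apply: (congr1 (mule `|c^-1|%:E)); exact/esym/swapR.
(* Second substitution, at fixed [u]: [y = c v + s u]. *)
transitivity (`|c^-1|%:E * (`|c|%:E * \int[mu]_u \int[mu]_v h u (c * v + s * u)%R)).
  apply: (congr1 (mule `|c^-1|%:E)); rewrite -ge0_integralZl//; last 2 first.
  - exact: (@msndR (fun u v => h u (c * v + s * u)%R)).
  - by move=> y _; exact: integral_ge0.
  apply: eq_integral => u _.
  by apply: (@ge0_integral_affine _ c (s * u)%R (h u)) => //; exact: meas_pair1.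
rewrite muleA -EFinM -normrM mulVf// normr1 mul1e.
apply: eq_integral => u _; apply: eq_integral => v _; rewrite /h /g.
have e1 : ((u - s * (c * v + s * u)) / c = c * u - s * v)%R.
  rewrite (_ : u - _ = (c ^+ 2 + s ^+ 2) * u - s * (c * v + s * u))%R.
    by field.
  by rewrite cs mul1r.
rewrite e1 gpdf_rot//; congr (f _ _ * _).
- by rewrite -[RHS]mul1r -cs; ring.
- by rewrite -[RHS]mul1r -cs; ring.
Qed.

Lemma gauss_rotation (c s : R) (f : R -> R -> \bar R) :
  (c ^+ 2 + s ^+ 2 = 1)%R ->
  measurable_fun setT (fun p : R * R => f p.1 p.2) -> (forall x y, 0 <= f x y) ->
  \int[gauss]_x \int[gauss]_y f (c * x + s * y)%R (c * y - s * x)%R =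
  \int[gauss]_x \int[gauss]_y f x y.
Proof.
move=> cs mf f0; have [c_0|] := eqVneq c 0%R; last by move=> ?; exact: gauss_rotation_neq0.
(* a quarter turn is the square of an eighth turn, whose cosine does not vanish *)
pose e : R := ((Num.sqrt 2)^-1)%R.
have e2 : (e ^+ 2 + e ^+ 2 = 1)%R.
  by rewrite /e exprVn sqr_sqrtr//; field.
have e0 : e != 0%R by rewrite invr_eq0 gt_eqF// sqrtr_gt0.
have s2 : (s ^+ 2 = 1)%R by rewrite -cs c_0 expr0n/= add0r.
have se2 : (e ^+ 2 + (s * e) ^+ 2 = 1)%R by rewrite exprMn s2 mul1r.
pose g (x y : R) := f (e * x + s * e * y)%R (e * y - s * e * x)%R.
have mg : measurable_fun setT (fun p : R * R => g p.1 p.2).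
  by apply: (@meas2 f _ _ mf); [apply: measurable_funD|apply: measurable_funB]; apply: measurable_funM.
transitivity (\int[gauss]_x \int[gauss]_y g x y); last exact: gauss_rotation_neq0.
apply/esym; transitivity (\int[gauss]_x \int[gauss]_y g (e * x + s * e * y)%R (e * y - s * e * x)%R).
  by apply/esym; apply: (@gauss_rotation_neq0 e (s * e)%R g) => // x y; exact: f0.
apply: eq_integral => x _; apply: eq_integral => y _; rewrite /g; congr (f _ _).
- rewrite (_ : _ + _ = (e ^+ 2 - s ^+ 2 * e ^+ 2) * x + (e ^+ 2 + e ^+ 2) * (s * y))%R; last by ring.
  by rewrite s2 e2 c_0; ring.
- rewrite (_ : _ - _ = (e ^+ 2 - s ^+ 2 * e ^+ 2) * y - (e ^+ 2 + e ^+ 2) * (s * x))%R; last by ring.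
  by rewrite s2 e2 c_0; ring.
Qed.

End rotation.

(** * Joint law of independent variables *)

Section indep_pair.
Local Open Scope ereal_scope.
Context d dS dE (T : measurableType d) (S : measurableType dS) (E : measurableType dE)
  (R : realType) (P : probability T R) (Y : T -> S) (X : T -> E) (D : set T).
Hypothesis mY : measurable_fun setT Y.
Hypothesis mX : measurable_fun setT X.
Hypothesis mD : measurable D.
Hypothesis ind : forall A B, measurable A -> measurable B ->
  P (Y @^-1` A `&` X @^-1` B `&` D) = P (Y @^-1` A) * P (X @^-1` B) * P D.

Let pairYX : T -> S * E := fun w => (Y w, X w).

Let mpair : measurable_fun setT pairYX.
Proof. exact: measurable_fun_pair. Qed.

Let m1 : {measure set (S * E) -> \bar R}.
Proof. refine (pushforward (mrestr P mD) pairYX); exact: mpair. Defined.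

Let PD : R := fine (P D).
Let PD0 : (0 <= PD)%R. Proof. by rewrite fine_ge0. Qed.

(** [D] stands for an event on variables still to come. On rectangles the joint law restricted to
    [D] factorises; [P D] is absorbed into the first factor so that uniqueness of the product
    measure applies. *)
Lemma indep_pair_restr (A : set (S * E)) : measurable A ->
  P (pairYX @^-1` A `&` D) = P D * (law P mY \x law P mX) A.
Proof.
move=> mA; pose m2 := mscale (NngNum PD0) (law P mY).
have PDE : PD%:E = P D by rewrite /PD fineK// fin_num_measure.
have PD_fin : P D \is a fin_num by exact: fin_num_measure.
have rect B C : measurable B -> measurable C -> m1 (B `*` C) = m2 B * law P mX C.
  move=> mB mC.
  transitivity (P (Y @^-1` B `&` X @^-1` C `&` D)); first by [].
  rewrite ind// -PDE.
  transitivity (PD%:E * P (Y @^-1` B) * P (X @^-1` C)); last by [].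
  by rewrite muleC muleA.
transitivity (m1 A); first by [].
transitivity ((m2 \x law P mX) A); first exact/esym/product_measure_unique.
transitivity (\int[m2]_x (law P mX) (xsection A x)); first by [].
transitivity (PD%:E * \int[law P mY]_x (law P mX) (xsection A x)); last by rewrite PDE.
rewrite ge0_integral_mscale//.
exact: measurable_fun_xsection.
Qed.
End indep_pair.

Section indep_pair_integral.
Local Open Scope ereal_scope.
Context d dS dE (T : measurableType d) (S : measurableType dS) (E : measurableType dE)
  (R : realType) (P : probability T R) (Y : T -> S) (X : T -> E).
Hypothesis mY : measurable_fun setT Y.
Hypothesis mX : measurable_fun setT X.
Hypothesis ind : forall A B, measurable A -> measurable B ->
  P (Y @^-1` A `&` X @^-1` B) = P (Y @^-1` A) * P (X @^-1` B).

Lemma integral_indep_pair (f : S -> E -> \bar R) :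
  measurable_fun setT (fun p : S * E => f p.1 p.2) -> (forall x y, 0 <= f x y) ->
  \int[P]_w f (Y w) (X w) = \int[P]_w1 \int[P]_w2 f (Y w1) (X w2).
Proof.
move=> mf f0; have mYX : measurable_fun setT (fun w => (Y w, X w)).
  exact: measurable_fun_pair.
have indT A B : measurable A -> measurable B ->
    P (Y @^-1` A `&` X @^-1` B `&` setT) = P (Y @^-1` A) * P (X @^-1` B) * P setT.
  by move=> mA mB; rewrite setIT probability_setT mule1; exact: ind.
transitivity (\int[law P mYX]_p f p.1 p.2).
  by rewrite (@ge0_integral_law _ _ _ _ _ _ _ mYX (fun p => f p.1 p.2)).
transitivity (\int[law P mY \x law P mX]_p f p.1 p.2).
  apply: eq_measure_integral => A mA _.
  have := indep_pair_restr mY mX measurableT indT mA.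
  by rewrite setIT probability_setT mul1e.
transitivity (\int[law P mY]_x \int[law P mX]_y f x y).
  exact: (@fubini_tonelli1 _ _ _ _ _ (law P mY) (law P mX) (fun p => f p.1 p.2)).
have mfx x : measurable_fun setT (f x).
  exact: (@measurableT_comp _ _ _ _ _ _ _ _ (fun y => (x, y)) mf (measurable_fun_pair _ _)).
have -> : (fun x => \int[law P mX]_y f x y) = (fun x => \int[P]_w f x (X w)).
  by apply/funext => x; exact: ge0_integral_law.
rewrite ge0_integral_law//; last by move=> x; exact: integral_ge0.
apply: (@measurable_integral_snd _ _ _ _ _ P (fun x w => f x (X w))) => //.
apply: (@measurableT_comp _ _ _ _ _ _ _ _ (fun p : S * T => (p.1, X p.2)) mf).
by apply: measurable_fun_pair => //; exact: measurableT_comp.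
Qed.

End indep_pair_integral.

(** * Recursions driven by independent variables *)

Section process.
Local Open Scope ereal_scope.
Context d dS dE (T : measurableType d) (S : measurableType dS) (E : measurableType dE)
  (R : realType) (P : probability T R) (X : nat -> T -> E)
  (phi : nat -> S -> E -> S) (s0 : S) (N : nat).
Hypothesis mX : forall i, measurable_fun setT (X i).
Hypothesis mphi : forall i, measurable_fun setT (fun p : S * E => phi i p.1 p.2).
Hypothesis ind : forall B : nat -> set E, (forall i, measurable (B i)) ->
  P (\bigcap_(i < N) (X i @^-1` B i)) = \prod_(i < N) P (X i @^-1` B i).

(** One recursion serves all functionals of independent variables below: partial sums of vectors,
    sums of squares together with a linear form, and block sums are its states for suitable
    [phi]. *)
Fixpoint process (k : nat) (w : T) : S :=
  if k is k'.+1 then phi k' (process k' w) (X k' w) else s0.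

Lemma measurable_process k : measurable_fun setT (process k).
Proof.
elim: k => [|k IH] /=; first exact: measurable_cst.
exact: (@measurableT_comp _ _ _ _ _ _ _ _ (fun w => (process k w, X k w)) (mphi k)
  (measurable_fun_pair IH (mX k))).
Qed.

Let tail (B : nat -> set E) k := \bigcap_(i in [set i | (k <= i < N)%N]) (X i @^-1` B i).

Let mtail B k : (forall i, measurable (B i)) -> measurable (tail B k).
Proof.
move=> mB; apply: fin_bigcap_measurable => [|i _].
  by apply: (@sub_finite_set _ _ `I_N); [move=> i /= /andP[]|exact: finite_II].
by rewrite -[X in measurable X]setTI; exact: mX.
Qed.

Let tailE B k : (k < N)%N -> tail B k = X k @^-1` B k `&` tail B k.+1.
Proof.
move=> kN; apply/seteqP; split => [w h|w [h1 h2] i /= /andP[ki iN]].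
  split; first by apply: h => /=; rewrite leqnn.
  by move=> i /= /andP[ki iN]; apply: h => /=; rewrite (ltnW ki).
have [<-//|ik] := eqVneq k i.
by apply: h2 => /=; rewrite iN andbT ltn_neqAle ik.
Qed.

Let tail_prod B k : (k <= N)%N -> (forall i, measurable (B i)) ->
  P (tail B k) = \prod_(k <= i < N) P (X i @^-1` B i).
Proof.
move=> kN mB; pose B' i := if (i < k)%N then setT else B i.
have mB' i : measurable (B' i) by rewrite /B'; case: ifP.
have := ind mB'.
rewrite (_ : \bigcap_(i < N) _ = tail B k); last first.
  apply/seteqP; split => [w h i /= /andP[ki iN]|w h i /= iN].
    by have := h i iN; rewrite /B' ltnNge ki.
  by rewrite /B'; case: ltnP => // ki; apply: h => /=; rewrite ki iN.
move=> ->; rewrite -(big_mkord xpredT (fun i => P (X i @^-1` B' i))).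
rewrite (big_cat_nat (leq0n k) kN)/= big1_seq ?mul1e.
  by apply: eq_big_nat => i /andP[ki _]; rewrite /B' ltnNge ki.
by move=> i; rewrite mem_index_iota => /andP[_]; rewrite /B' => /= ->; rewrite preimage_setT probability_setT.
Qed.

Let tail_indep B k : (k < N)%N -> (forall i, measurable (B i)) ->
  P (X k @^-1` B k `&` tail B k.+1) = P (X k @^-1` B k) * P (tail B k.+1).
Proof.
move=> kN mB; rewrite -tailE// tail_prod//; last exact: ltnW.
by rewrite big_ltn// tail_prod.
Qed.

(** Independence of the state from the current variable alone does not pass to the next step, so the
    induction carries events on all remaining variables up to [N]. *)
Let process_indep_tail k : (k <= N)%N -> forall A B, measurable A ->
  (forall i, measurable (B i)) ->
  P (process k @^-1` A `&` tail B k) = P (process k @^-1` A) * P (tail B k).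
Proof.
elim: k => [_|k IH kN] A B mA mB /=.
  have [sA|sA] := pselect (A s0).
    rewrite (_ : _ @^-1` A = setT) ?setTI ?probability_setT ?mul1e//.
    by apply/seteqP; split.
  rewrite (_ : _ @^-1` A = set0) ?set0I ?measure0 ?mul0e//.
  by apply/seteqP; split.
have {}IH := IH (ltnW kN).
pose C := (fun p : S * E => phi k p.1 p.2) @^-1` A.
have mC : measurable C by rewrite -[X in measurable X]setTI; exact: mphi.
have ind1 A' B' : measurable A' -> measurable B' ->
    P (process k @^-1` A' `&` X k @^-1` B' `&` tail B k.+1) =
    P (process k @^-1` A') * P (X k @^-1` B') * P (tail B k.+1).
  move=> mA' mB'; pose B1 i := if i == k then B' else B i.
  have mB1 i : measurable (B1 i) by rewrite /B1; case: ifP.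
  have e : tail B1 k.+1 = tail B k.+1.
    apply: eq_bigcapr => i /= /andP[ki _]; rewrite /B1.
    by rewrite gtn_eqF.
  have eB : B1 k = B' by rewrite /B1 eqxx.
  have := IH A' B1 mA' mB1; rewrite tailE// setIA eB e => ->.
  by rewrite -muleA -e -eB tail_indep.
(* The same with [setT] in place of the later events; it identifies the product measure of [C] with
   the probability that the next state lies in [A]. *)
have ind2 A' B' : measurable A' -> measurable B' ->
    P (process k @^-1` A' `&` X k @^-1` B' `&` setT) =
    P (process k @^-1` A') * P (X k @^-1` B') * P setT.
  move=> mA' mB'; rewrite setIT probability_setT mule1.
  pose B1 i := if i == k then B' else setT.
  have mB1 i : measurable (B1 i) by rewrite /B1; case: ifP.
  have e : tail B1 k.+1 = setT.
    apply/seteqP; split => // w _ i /= /andP[ki _]; rewrite /B1.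
    by rewrite gtn_eqF.
  have eB : B1 k = B' by rewrite /B1 eqxx.
  by have := IH A' B1 mA' mB1; rewrite tailE// eB e setIT.
have r1 := indep_pair_restr (measurable_process k) (mX k) (mtail k.+1 mB) ind1 mC.
have r2 := indep_pair_restr (measurable_process k) (mX k) measurableT ind2 mC.
move: r2; rewrite setIT probability_setT mul1e => r2.
by rewrite muleC; apply: (eq_trans r1); apply: (congr1 (mule _)); exact: esym.
Qed.

Lemma process_indep k A B : (k < N)%N -> measurable A -> measurable B ->
  P (process k @^-1` A `&` X k @^-1` B) = P (process k @^-1` A) * P (X k @^-1` B).
Proof.
move=> kN mA mB; pose B1 i := if i == k then B else setT.
have mB1 i : measurable (B1 i) by rewrite /B1; case: ifP.
have e : tail B1 k.+1 = setT.
  apply/seteqP; split => // w _ i /= /andP[ki _]; rewrite /B1.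
  by rewrite gtn_eqF.
have eB : B1 k = B by rewrite /B1 eqxx.
by have := process_indep_tail (ltnW kN) mA mB1; rewrite tailE// eB e setIT.
Qed.

Lemma integral_processS k (f : S -> \bar R) : (k < N)%N ->
  measurable_fun setT f -> (forall x, 0 <= f x) ->
  \int[P]_w f (process k.+1 w) =
  \int[P]_w1 \int[P]_w2 f (phi k (process k w1) (X k w2)).
Proof.
move=> kN mf f0.
apply: (@integral_indep_pair _ _ _ _ _ _ _ _ _ _ _ _ _ (fun s e => f (phi k s e))) => //.
- exact: measurable_process.
- by move=> A B mA mB; exact: process_indep.
- exact: (measurableT_comp mf (mphi k)).
Qed.

(** The last variable is integrated out first: an expectation becomes a backward iteration of
    averages over one variable. *)
Fixpoint iter_integral (mu : probability E R) (k : nat) (f : S -> \bar R) : S -> \bar R :=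
  if k is k'.+1 then
    iter_integral mu k' (fun s => \int[mu]_e f (phi k' s e))
  else f.

Lemma integral_process (mu : probability E R) k (f : S -> \bar R) : (k <= N)%N ->
  (forall i, (i < N)%N -> forall B, measurable B -> P (X i @^-1` B) = mu B) ->
  measurable_fun setT f -> (forall x, 0 <= f x) ->
  \int[P]_w f (process k w) = iter_integral mu k f s0.
Proof.
move=> + muP; elim: k f => [f _ mf f0|k IH f kN mf f0] /=.
  rewrite integral_cst// [X in _ * X](_ : _ = 1) ?mule1//.
  exact: (probability_setT P).
have mfphi : measurable_fun setT (fun p : S * E => f (phi k p.1 p.2)).
  exact: (measurableT_comp mf (mphi k)).
rewrite -IH; last 3 first.
- exact: ltnW.
- exact: (@measurable_integral_snd _ _ _ _ _ mu (fun s e => f (phi k s e))).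
- by move=> s; exact: integral_ge0.
rewrite (integral_processS kN)//; apply: eq_integral => w _.
transitivity (\int[law P (mX k)]_e f (phi k (process k w) e)).
  rewrite ge0_integral_law//.
  exact: (@measurableT_comp _ _ _ _ _ _ _ _ (fun e => (process k w, e)) mfphi (measurable_fun_pair _ _)).
by apply: eq_measure_integral => B mB _; exact: muP.
Qed.

End process.

(** * One-dimensional Gaussian integrals *)

Section gauss_ops.
Context (R : realType).
Local Notation mu := (@lebesgue_measure R).
Local Notation gauss := (@std_gauss R).
Local Open Scope ereal_scope.
Implicit Types (h : R -> \bar R) (a b : R).

Let sqrD_eq0 a b : (a ^+ 2 + b ^+ 2 = 0)%R -> a = 0%R /\ b = 0%R.
Proof.
move/eqP; rewrite paddr_eq0 ?sqr_ge0// !sqrf_eq0.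
by move=> /andP[/eqP -> /eqP ->].
Qed.

Lemma integral_gauss_cst (x : \bar R) : \int[gauss]_r x = x.
Proof.
rewrite integral_cst// [X in _ * X](_ : _ = 1) ?mule1//.
exact: (probability_setT gauss).
Qed.

Let mlin a b : measurable_fun setT (fun x : R => a * x + b)%R.
Proof. by apply: measurable_funD => //; apply: measurable_funM. Qed.

(** A half turn of the plane, acting on a function of the first coordinate. *)
Lemma gauss_sym h : measurable_fun setT h -> (forall x, 0 <= h x) ->
  \int[gauss]_x h (- x)%R = \int[gauss]_x h x.
Proof.
move=> mh h0.
have e : ((- 1) ^+ 2 + 0 ^+ 2 = 1 :> R)%R by rewrite sqrrN expr1n expr0n addr0.
have mh1 : measurable_fun setT (fun p : R * R => h p.1).
  exact: (measurableT_comp mh).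
have := @gauss_rotation _ _ _ (fun u _ => h u) e mh1 (fun u _ => h0 u).
under [X in _ = X -> _]eq_integral do rewrite integral_gauss_cst.
move=> <-; apply: eq_integral => x _.
by under eq_integral do rewrite mul0r addr0 mulN1r; rewrite integral_gauss_cst.
Qed.

(** The rotation that takes [(a, b)] to the first axis leaves a function of one coordinate. *)
Lemma gauss_conv h a b : measurable_fun setT h -> (forall x, 0 <= h x) ->
  \int[gauss]_x \int[gauss]_y h (a * x + b * y)%R =
  \int[gauss]_x h (Num.sqrt (a ^+ 2 + b ^+ 2) * x)%R.
Proof.
move=> mh h0; set s := Num.sqrt _.
have ab0 : (0 <= a ^+ 2 + b ^+ 2)%R by rewrite addr_ge0 ?sqr_ge0.
have s2 : (s ^+ 2 = a ^+ 2 + b ^+ 2)%R by rewrite sqr_sqrtr.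
have [s_0|s_neq0] := eqVneq s 0%R.
  have [-> ->] : a = 0%R /\ b = 0%R.
    by apply: sqrD_eq0; rewrite -s2 s_0 expr0n.
  apply: eq_integral => x _; under eq_integral do rewrite !mul0r addr0.
  by rewrite integral_gauss_cst s_0 mul0r.
have cs : ((a / s) ^+ 2 + (b / s) ^+ 2 = 1)%R.
  by rewrite !expr_div_n -mulrDl -s2 divff// expf_neq0.
have mhs : measurable_fun setT (fun p : R * R => h (s * p.1)%R).
  by apply: (measurableT_comp mh); exact: measurable_funM.
have := @gauss_rotation _ _ _ (fun u _ => h (s * u)%R) cs mhs (fun u _ => h0 _).
under [X in _ = X -> _]eq_integral do rewrite integral_gauss_cst.
move=> <-; apply: eq_integral => x _; apply: eq_integral => y _.
by congr h; field.
Qed.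

(** The rotation of [gauss_conv] also preserves [x ^+ 2 + y ^+ 2], so squared radius and linear form
    can be followed together. *)
Lemma gauss_conv_sq (f : R -> R -> \bar R) a b :
  measurable_fun setT (fun p : R * R => f p.1 p.2) -> (forall x y, 0 <= f x y) ->
  \int[gauss]_x \int[gauss]_y f (x ^+ 2 + y ^+ 2)%R (a * x + b * y)%R =
  \int[gauss]_x \int[gauss]_y f (x ^+ 2 + y ^+ 2)%R (Num.sqrt (a ^+ 2 + b ^+ 2) * x)%R.
Proof.
move=> mf f0; set s := Num.sqrt _.
have ab0 : (0 <= a ^+ 2 + b ^+ 2)%R by rewrite addr_ge0 ?sqr_ge0.
have s2 : (s ^+ 2 = a ^+ 2 + b ^+ 2)%R by rewrite sqr_sqrtr.
have [s_0|s_neq0] := eqVneq s 0%R.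
  have [-> ->] : a = 0%R /\ b = 0%R.
    by apply: sqrD_eq0; rewrite -s2 s_0 expr0n.
  by apply: eq_integral => x _; apply: eq_integral => y _; rewrite s_0 !mul0r addr0.
have cs : ((a / s) ^+ 2 + (b / s) ^+ 2 = 1)%R.
  by rewrite !expr_div_n -mulrDl -s2 divff// expf_neq0.
pose g (x y : R) := f (x ^+ 2 + y ^+ 2)%R (s * x)%R.
have mg : measurable_fun setT (fun p : R * R => g p.1 p.2).
  apply: (@measurableT_comp _ _ _ _ _ _ _ _
    (fun p : R * R => ((p.1 ^+ 2 + p.2 ^+ 2)%R, (s * p.1)%R)) mf).
  apply: measurable_fun_pair; last exact: measurable_funM.
  by apply: measurable_funD; apply: measurable_funX.
have := @gauss_rotation _ _ _ g cs mg (fun u v => f0 _ _).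
move=> <-; apply: eq_integral => x _; apply: eq_integral => y _.
rewrite /g; congr (f _ _); last by field.
rewrite -[LHS]mul1r -cs; ring.
Qed.

(** The exponential is the ratio of [gpdf (x / c)] to [gpdf x] left by the substitution. *)
Lemma gauss_scale h (c : R) : (0 < c)%R -> measurable_fun setT h -> (forall x, 0 <= h x) ->
  \int[gauss]_x h (c * x)%R =
  c^-1%:E * \int[gauss]_x (h x * (expR (x ^+ 2 * ((1 - c ^- 2) / 2)))%:E).
Proof.
move=> c0 mh h0.
have mhc : measurable_fun setT (fun x => h (c * x)%R).
  by apply: (measurableT_comp mh); exact: measurable_funM.
have mexp (k : R) : measurable_fun setT (fun x : R => expR (x ^+ 2 * k)).
  apply: (measurableT_comp (@measurable_expR R)); apply: measurable_funM => //.
have cE : `|c^-1|%:E = c^-1%:E by rewrite gtr0_norm// invr_gt0.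
transitivity (\int[mu]_x (h (c * x)%R * (gpdf x)%:E)).
  exact: ge0_integral_std_gauss.
transitivity (c^-1%:E * \int[mu]_x (h x * (gpdf (x / c))%:E)).
  transitivity (`|c^-1|%:E * \int[mu]_x (h (c * (c^-1 * x + 0))%R * (gpdf (c^-1 * x + 0))%:E)).
    apply: (@ge0_integral_affine _ _ _ (fun x => h (c * x)%R * (gpdf x)%:E)).
    - by rewrite invr_eq0 gt_eqF.
    - by apply: emeasurable_funM => //; apply/measurable_EFinP; exact: measurable_gpdf.
    - by move=> x; rewrite mule_ge0// lee_fin gpdf_ge0.
  rewrite cE; apply: (congr1 (mule c^-1%:E)).
  by apply: eq_integral => x _; rewrite addr0 mulrA divff ?gt_eqF// mul1r [(_^-1 * x)%R]mulrC.
apply: (congr1 (mule c^-1%:E)); apply/esym.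
transitivity (\int[mu]_x (h x * (expR (x ^+ 2 * ((1 - c ^- 2) / 2)))%:E * (gpdf x)%:E)).
  apply: ge0_integral_std_gauss.
  - by apply: emeasurable_funM => //; apply/measurable_EFinP; exact: mexp.
  - by move=> x; rewrite mule_ge0// lee_fin expR_ge0.
apply: eq_integral => x _; rewrite -muleA -EFinM; congr (_ * _%:E).
rewrite !gpdfE mulrCA -expRD; congr (_ * expR _)%R.
rewrite expr_div_n; field; by rewrite gt_eqF.
Qed.

(** [gauss_scale] with [h = 1] gives mean [c] to [expR (- t x ^ 2)], where [t = (c ^- 2 - 1) / 2].
    Since [1 <= expR (- t x ^ 2) + t x ^ 2], the second moment is at least
    [(1 - c) / t = 2 c ^ 2 / (1 + c)], which exceeds [c ^ 2]; then [c] tends to [1]. *)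
Lemma gauss_sqr_ge1 : 1 <= \int[gauss]_x (x ^+ 2)%:E.
Proof.
have mx2 : measurable_fun setT (fun x : R => (x ^+ 2)%:E).
  by apply/measurable_EFinP; exact: measurable_funX.
have x20 (x : R) : 0 <= (x ^+ 2)%:E by rewrite lee_fin sqr_ge0.
set M := \int[gauss]_x _.
have M0 : 0 <= M by exact: integral_ge0.
have key (c : R) : (0 < c < 1)%R -> (c ^+ 2)%:E <= M.
  move=> /andP[c0 c1].
  pose t := ((c ^- 2 - 1) / 2)%R.
  have t0 : (0 < t)%R.
    by rewrite divr_gt0// subr_gt0 invf_gt1 ?exprn_gt0// exprn_ilt1// ltW.
  have mexp : measurable_fun setT (fun x : R => (expR (- (t * x ^+ 2)))%:E).
    apply/measurable_EFinP; apply: (measurableT_comp (@measurable_expR R)).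
    by apply: measurableT_comp => //; apply: measurable_funM.
  have exp_int : \int[gauss]_x (expR (- (t * x ^+ 2)))%:E = c%:E.
    have := @gauss_scale (fun=> 1) c c0 (@measurable_cst _ _ _ _ _ _) (fun=> lee01).
    rewrite integral_gauss_cst => /(congr1 (mule c%:E)).
    rewrite mule1 muleA -EFinM divff ?gt_eqF// mul1e => ->.
    by apply: eq_integral => x _; rewrite mul1e; congr (expR _)%:E; rewrite /t; field; rewrite gt_eqF.
  have : 1 <= c%:E + t%:E * M.
    rewrite -exp_int -ge0_integralZl//; last by rewrite lee_fin ltW.
    have tx0 (x : R) : 0 <= t%:E * (x ^+ 2)%:E by rewrite mule_ge0// lee_fin ltW.
    have mtx : measurable_fun setT (fun x : R => t%:E * (x ^+ 2)%:E).
      exact: measurable_funeM.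
    rewrite -ge0_integralD//.
    rewrite -{1}(integral_gauss_cst 1); apply: ge0_le_integral => //.
    - exact: emeasurable_funD.
    - move=> x _; rewrite -EFinM -EFinD lee_fin.
      by have := expR_ge1Dx (- (t * x ^+ 2)); lra.
  case: M M0 => [r| |]// r0; last by rewrite leey.
  rewrite -EFinM -EFinD !lee_fin => h.
  have h1 : (c ^+ 2 * t *+ 2 = (1 - c) * (1 + c))%R.
    by rewrite /t; field; rewrite gt_eqF.
  have h2 : (1 - c <= t * r)%R by lra.
  rewrite -(ler_pM2l t0); apply: le_trans h2.
  rewrite mulrC -(@ler_pMn2r _ 2)// h1 mulr2n.
  nra.
rewrite leNgt; apply/negP => M1.
have [r Mr] : exists r : R, M = r%:E.
  by exists (fine M); rewrite fineK// ge0_fin_numE// (lt_trans M1)// ltry.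
move: M0 M1 key; rewrite Mr lee_fin lte_fin => r0 r1 key.
(* A second moment [r < 1] is refuted by a [c] whose square lies strictly between [r] and [1]. *)
pose c := Num.sqrt ((1 + r) / 2).
have c2 : (c ^+ 2 = (1 + r) / 2)%R by rewrite sqr_sqrtr// divr_ge0//; lra.
have : ((1 + r) / 2)%:E <= r%:E.
  rewrite -c2; apply: key; apply/andP; split; first by rewrite sqrtr_gt0; lra.
  by rewrite -[ltRHS]sqrtr1 ltr_sqrt//; lra.
by rewrite lee_fin; lra.
Qed.

End gauss_ops.

(** * Functionals of finitely many independent normal variables *)

Section gauss_family.
Context (R : realType) d (T : measurableType d) (Q : probability T R).
Local Notation gauss := (@std_gauss R).
Local Open Scope ereal_scope.

Definition gauss_family (N : nat) (g : nat -> T -> R) : Prop :=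
  [/\ forall i, measurable_fun setT (g i),
      forall B : nat -> set R, (forall i, measurable (B i)) ->
        Q (\bigcap_(i < N) (g i @^-1` B i)) = \prod_(i < N) Q (g i @^-1` B i)
    & forall i, (i < N)%N -> forall B, measurable B -> Q (g i @^-1` B) = gauss B].

Definition sq_lin_step (y : nat -> R) (i : nat) (s : R * R) (r : R) : R * R :=
  (s.1 + r ^+ 2, s.2 + y i * r)%R.

Let measurable_step y i : measurable_fun setT
  (fun p : (R * R) * R => sq_lin_step y i p.1 p.2).
Proof.
apply: measurable_fun_pair; apply: measurable_funD.
- exact: measurableT_comp.
- exact: measurable_funX.
- exact: measurableT_comp.
- exact: measurable_funM.
Qed.

Let M (c : R) (f : R * R -> \bar R) (s : R * R) : \bar R :=
  \int[gauss]_r f (s.1 + r ^+ 2, s.2 + c * r)%R.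

Let mM c f : measurable_fun setT f -> (forall x, 0 <= f x) -> measurable_fun setT (M c f).
Proof.
move=> mf f0.
apply: (@measurable_integral_snd _ _ _ _ _ gauss (fun (s : R * R) (r : R) => f (s.1 + r ^+ 2, s.2 + c * r)%R)) => //.
exact: (measurableT_comp mf (measurable_step (fun=> c) 0%N)).
Qed.

Let M0 c f : (forall x, 0 <= f x) -> forall x, 0 <= M c f x.
Proof. by move=> f0 x; exact: integral_ge0. Qed.

(** Two steps see a planar Gaussian only through its squared radius and one linear form, so all the
    weight of the form can be moved to one of the two variables. *)
Let MM a b f : measurable_fun setT f -> (forall x, 0 <= f x) ->
  M a (M b f) = M 0 (M (Num.sqrt (a ^+ 2 + b ^+ 2)) f).
Proof.
move=> mf f0; apply/funext => -[p q].
set s := Num.sqrt _.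
pose g u v := f (p + u, q + v)%R.
have mg : measurable_fun setT (fun p : R * R => g p.1 p.2).
  apply: (@measurableT_comp _ _ _ _ _ _ _ _ (fun x : R * R => (p + x.1, q + x.2)%R) mf).
  by apply: measurable_fun_pair; exact: measurable_funD.
transitivity (\int[gauss]_x \int[gauss]_y g (x ^+ 2 + y ^+ 2)%R (a * x + b * y)%R).
  by apply: eq_integral => x _; apply: eq_integral => y _; rewrite /g !addrA.
transitivity (\int[gauss]_x \int[gauss]_y g (x ^+ 2 + y ^+ 2)%R (s * x)%R).
  by apply: (@gauss_conv_sq _ g) => // u v; exact: f0.
(* The rotation leaves the weight on the outer variable, whereas the outer operator must have
   coefficient [0]; Tonelli's theorem exchanges them. *)
transitivity (\int[gauss]_y \int[gauss]_x g (x ^+ 2 + y ^+ 2)%R (s * x)%R).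
  apply: (@tonelli_swap _ _ _ _ _ gauss gauss (fun x y => g (x ^+ 2 + y ^+ 2)%R (s * x)%R)); last by move=> x y; exact: f0.
  apply: (@measurableT_comp _ _ _ _ _ _ _ _ (fun x : R * R => (x.1 ^+ 2 + x.2 ^+ 2, s * x.1)%R) mg).
  apply: measurable_fun_pair; last exact: measurable_funM.
  by apply: measurable_funD; exact: measurable_funX.
transitivity (\int[gauss]_x \int[gauss]_y f (p + x ^+ 2 + y ^+ 2, q + 0 * x + s * y)%R).
  apply: eq_integral => x _; apply: eq_integral => y _; rewrite /g.
  by congr (f (_, _)); ring.
by [].
Qed.

(** Repeated use of [MM] collects all coefficients on a single variable, so only their sum of
    squares survives; [gauss_sym] removes the sign of the first one. *)
Let iter_M y k f : measurable_fun setT f -> (forall x, 0 <= f x) ->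
  iter_integral (sq_lin_step y) gauss k.+1 f =
  iter k (M 0) (M (Num.sqrt (\sum_(i < k.+1) y i ^+ 2)) f).
Proof.
elim: k f => [|k IH] f mf f0.
  rewrite /= big_ord_recl big_ord0 addr0 sqrtr_sqr; apply/funext => s.
  rewrite /M /sq_lin_step; case: (ger0P (y 0%N)) => // y0.
  pose h (r : R) := f (s.1 + r ^+ 2, s.2 + y 0%N * r)%R.
  transitivity (\int[gauss]_r h (- r)%R); last first.
    by apply: eq_integral => r _; rewrite /h sqrrN mulrN mulNr.
  apply/esym/gauss_sym; last by move=> r; exact: f0.
  apply: (@measurableT_comp _ _ _ _ _ _ _ _ (fun r : R => (s.1 + r ^+ 2, s.2 + y 0%N * r)%R) mf).
  by apply: measurable_fun_pair; apply: measurable_funD.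
transitivity (iter_integral (sq_lin_step y) gauss k.+1 (M (y k.+1) f)); first by [].
rewrite IH; last 2 first.
- exact: mM.
- exact: M0.
rewrite MM// -iterSr sqr_sqrtr; last by apply: sumr_ge0 => i _; rewrite sqr_ge0.
by rewrite [in RHS]big_ord_recr.
Qed.

(* A rotation of two Gaussian variables turns the coefficients [a, b] of the linear
   form into [0, sqrt (a ^+ 2 + b ^+ 2)] without changing the sum of squares. *)
Lemma gauss_family_sq_lin N g (y y' : nat -> R) (f : R * R -> \bar R) :
  gauss_family N g -> (0 < N)%N ->
  measurable_fun setT f -> (forall x, 0 <= f x) ->
  (\sum_(i < N) y i ^+ 2 = \sum_(i < N) y' i ^+ 2)%R ->
  \int[Q]_w f (\sum_(i < N) g i w ^+ 2, \sum_(i < N) y i * g i w)%R =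
  \int[Q]_w f (\sum_(i < N) g i w ^+ 2, \sum_(i < N) y' i * g i w)%R.
Proof.
move=> [mg ind gE] N0 mf f0 yy'.
have key (z : nat -> R) : \int[Q]_w f (\sum_(i < N) g i w ^+ 2, \sum_(i < N) z i * g i w)%R =
    iter_integral (sq_lin_step z) gauss N f (0, 0)%R.
  have := @integral_process _ _ _ _ _ _ _ _ _ _ ((0, 0)%R : R * R) _ mg
    (measurable_step z) ind _ _ f (leqnn N) gE mf f0.
  move=> <-; apply: eq_integral => w _; congr f.
  elim: N {N0 ind gE yy'} => [|N IH]; first by rewrite !big_ord0.
  by rewrite !big_ord_recr/= -IH.
rewrite !key; case: N {ind gE key} yy' N0 => // N yy' _.
by rewrite !iter_M// yy'.
Qed.

Section blocks.
Variables (m : nat) (b : nat -> R).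
Hypothesis m0 : (0 < m)%N.
Hypothesis b1 : (\sum_(i < m) b i ^+ 2 = 1)%R.

(* The second component accumulates the current block of [m] variables; at its end
   the square of the accumulated sum is moved to the first component. *)
Definition block_step (n : nat) (s : R * R) (r : R) : R * R :=
  let q := (s.2 + b (n %% m) * r)%R in
  if (n %% m)%N == m.-1 then (s.1 + q ^+ 2, 0)%R else (s.1, q).

Let measurable_block_step n : measurable_fun setT
  (fun p : (R * R) * R => block_step n p.1 p.2).
Proof.
have mq : measurable_fun setT (fun p : (R * R) * R => p.1.2 + b (n %% m) * p.2)%R.
  apply: measurable_funD; first exact: measurableT_comp.
  exact: measurable_funM.
rewrite /block_step; case: (_ == _); apply: measurable_fun_pair => //.
- apply: measurable_funD; first exact: measurableT_comp.
  exact: measurable_funX.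
- exact: measurableT_comp.
Qed.

Let sig j : R := Num.sqrt (\sum_(j <= i < m) b i ^+ 2).

Let F_ (F : R * R -> \bar R) (c : R) (s : R * R) : \bar R :=
  \int[gauss]_r F (s.1 + (s.2 + c * r) ^+ 2, 0)%R.

Let mF_ (F : R * R -> \bar R) (p : R) : measurable_fun setT F -> measurable_fun setT (fun q : R => F (p + q ^+ 2, 0)%R).
Proof.
move=> mF; apply: (@measurableT_comp _ _ _ _ _ _ _ _ (fun q : R => ((p + q ^+ 2)%R, 0%R : R)) mF).
by apply: measurable_fun_pair => //; apply: measurable_funD.
Qed.

(** Backwards from the end of a block, the variables from position [j] on merge by [gauss_conv] into
    one normal variable of standard deviation [sig j]. *)
Let iter_block F k j : measurable_fun setT F -> (forall x, 0 <= F x) -> (j < m)%N ->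
  iter_integral block_step gauss (k * m + m) F =
  iter_integral block_step gauss (k * m + j) (F_ F (sig j)).
Proof.
move=> mF F0 jm; have [l jl] : exists l, (m = j + l.+1)%N.
  by exists (m - j.+1)%N; rewrite addnS -addSn subnKC.
elim: l j jm jl => [|l IH] j jm jl.
  have jE : j = m.-1 by rewrite jl addn1.
  have -> : (k * m + m = (k * m + j).+1)%N by rewrite -addnS -[j.+1]addn1 -jl.
  rewrite /=; congr (iter_integral _ _ _ _); apply/funext => s.
  have sigE : sig j = `|b j|%R.
    by rewrite /sig jl addn1 big_nat1 sqrtr_sqr.
  rewrite /block_step modnMDl modn_small// jE eqxx -jE /F_ sigE.
  case: (ger0P (b j)) => // bj.
  transitivity (\int[gauss]_r F (s.1 + (s.2 + b j * - r) ^+ 2, 0)%R); last first.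
    by apply: eq_integral => r _; rewrite mulrN mulNr.
  apply/esym; apply: (@gauss_sym _ (fun r => F (s.1 + (s.2 + b j * r) ^+ 2, 0)%R)) => //.
  apply: (measurableT_comp (mF_ s.1 mF)); apply: measurable_funD => //.
have jm' : (j.+1 < m)%N by rewrite jl -addn1 ltn_add2l.
rewrite (IH j.+1)//; last by rewrite jl addSnnS.
rewrite addnS/=; congr (iter_integral _ _ _ _); apply/funext => s.
have jmE : (j == m.-1) = false.
  by apply/eqP => jE; move: jm'; rewrite jE prednK// ltnn.
rewrite /block_step modnMDl modn_small// jmE /F_/=.
transitivity (\int[gauss]_x \int[gauss]_r
    (fun q => F (s.1 + (s.2 + q) ^+ 2, 0)%R) (b j * x + sig j.+1 * r)%R).
  by apply: eq_integral => x _; apply: eq_integral => r _; rewrite addrA.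
transitivity (\int[gauss]_r F (s.1 + (s.2 + Num.sqrt (b j ^+ 2 + sig j.+1 ^+ 2) * r) ^+ 2, 0)%R).
  apply: (@gauss_conv _ (fun q => F (s.1 + (s.2 + q) ^+ 2, 0)%R)) => //.
  by apply: (measurableT_comp (mF_ s.1 mF)); exact: measurable_funD.
apply: eq_integral => r _; congr (F (_ + (_ + _ * _) ^+ 2, _)%R).
rewrite /sig sqr_sqrtr; last by apply: sumr_ge0 => i _; rewrite sqr_ge0.
by rewrite [in RHS]big_ltn.
Qed.

(** Its [n]-th iterate, evaluated at [0], is the expectation of [h] under the chi-squared law with
    [n] degrees of freedom. *)
Definition add_gauss_sq (h : R -> \bar R) (p : R) : \bar R :=
  \int[gauss]_r h (p + r ^+ 2)%R.

Let iter_blocks n F p : measurable_fun setT F -> (forall x, 0 <= F x) ->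
  iter_integral block_step gauss (n * m) F (p, 0)%R =
  iter n add_gauss_sq (fun p => F (p, 0)%R) p.
Proof.
elim: n F p => [|n IH] F p mF F0; first by rewrite mul0n.
rewrite mulSnr (iter_block n mF F0 m0) addn0 IH; last 2 first.
- apply: (@measurable_integral_snd _ _ _ _ _ gauss
    (fun (s : R * R) (r : R) => F (s.1 + (s.2 + sig 0 * r) ^+ 2, 0)%R)) => //.
  apply: (@measurableT_comp _ _ _ _ _ _ _ _ (fun x : (R * R) * R =>
     ((x.1.1 + (x.1.2 + sig 0 * x.2) ^+ 2)%R, 0%R : R)) mF).
  apply: measurable_fun_pair => //; apply: measurable_funD.
    exact: measurableT_comp.
  apply: measurable_funX; apply: measurable_funD; first exact: measurableT_comp.
  exact: measurable_funM.
- by move=> s; exact: integral_ge0.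
rewrite iterSr; congr (iter n _ _ _); apply/funext => q.
rewrite /F_/= /add_gauss_sq; apply: eq_integral => r _.
by rewrite /sig big_mkord b1 sqrtr1 mul1r add0r.
Qed.

Let process_block (g : nat -> T -> R) w k j : (j < m)%N ->
  process g block_step (0, 0)%R (k * m + j) w =
  (\sum_(l < k) (\sum_(i < m) b i * g (l * m + i)%N w) ^+ 2,
   \sum_(i < j) b i * g (k * m + i)%N w)%R.
Proof.
have stepm k' : (forall j, (j < m)%N -> process g block_step (0, 0)%R (k' * m + j) w =
  (\sum_(l < k') (\sum_(i < m) b i * g (l * m + i)%N w) ^+ 2,
   \sum_(i < j) b i * g (k' * m + i)%N w)%R) ->
   process g block_step (0, 0)%R (k'.+1 * m) w =
  (\sum_(l < k'.+1) (\sum_(i < m) b i * g (l * m + i)%N w) ^+ 2, 0)%R.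
  move=> H; have jm : (m.-1 < m)%N by rewrite prednK.
  have -> : (k'.+1 * m = (k' * m + m.-1).+1)%N by rewrite mulSnr -addnS prednK.
  rewrite /= H// /block_step modnMDl modn_small// eqxx/=.
  have sumE (u : nat -> R) : (\sum_(i < m) u i = \sum_(i < m.-1) u i + u m.-1)%R.
    by move: m0; case: (m) => // m' _; rewrite big_ord_recr.
  by rewrite [in RHS]big_ord_recr/= (sumE (fun i => b i * g (k' * m + i)%N w)%R).
have inner k' : process g block_step (0, 0)%R (k' * m) w =
  (\sum_(l < k') (\sum_(i < m) b i * g (l * m + i)%N w) ^+ 2, 0)%R ->
  forall j, (j < m)%N -> process g block_step (0, 0)%R (k' * m + j) w =
  (\sum_(l < k') (\sum_(i < m) b i * g (l * m + i)%N w) ^+ 2,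
   \sum_(i < j) b i * g (k' * m + i)%N w)%R.
  move=> H; elim=> [|i IH] im; first by rewrite addn0 H big_ord0.
  have imE : (i == m.-1) = false.
    by apply/eqP => iE; move: im; rewrite iE prednK// ltnn.
  rewrite addnS/= IH ?(ltnW im)// /block_step modnMDl modn_small ?(ltnW im)// imE/=.
  by rewrite [in RHS]big_ord_recr.
apply: (inner k); elim: k => [|k IHk]; first by rewrite mul0n big_ord0.
by apply: (stepm k); exact: (inner k).
Qed.

(** Each block combination has variance [1] by [b1], so the result does not depend on the weights.
    With blocks that collect one coordinate of all the vectors, the sum is the squared norm of a
    weighted sum of Gaussian vectors. *)
Lemma gauss_family_blocks n g (h : R -> \bar R) : gauss_family (n * m) g ->
  measurable_fun setT h -> (forall x, 0 <= h x) ->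
  \int[Q]_w h (\sum_(l < n) (\sum_(i < m) b i * g (l * m + i)%N w) ^+ 2)%R =
  iter n add_gauss_sq h 0%R.
Proof.
move=> [mg ind gE] mh h0.
have mh1 : measurable_fun setT (fun s : R * R => h s.1) by exact: measurableT_comp.
have := @integral_process _ _ _ _ _ _ _ _ _ _ ((0, 0)%R : R * R) _ mg
    measurable_block_step ind _ _ (fun s => h s.1) (leqnn _) gE mh1 (fun s => h0 _).
rewrite iter_blocks// => <-; apply: eq_integral => w _.
by rewrite -[(n * m)%N]addn0 process_block.
Qed.

End blocks.

End gauss_family.

(** * Scaling relation of the chi-squared law *)

Section iter_scale.
Context (R : realType).
Local Notation gauss := (@std_gauss R).
Local Open Scope ereal_scope.

Let measurable_add_gauss_sq (h : R -> \bar R) : measurable_fun setT h ->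
  (forall x, 0 <= h x) -> measurable_fun setT (add_gauss_sq h).
Proof.
move=> mh h0.
apply: (@measurable_integral_snd _ _ _ _ _ gauss (fun p r : R => h (p + r ^+ 2)%R)) => //.
by apply: (measurableT_comp mh); apply: measurable_funD => //; exact: measurable_funX.
Qed.

Lemma iter_add_gauss_sq_ge0 n (h : R -> \bar R) :
  (forall x, 0 <= h x) -> forall p, 0 <= iter n (@add_gauss_sq R) h p.
Proof. by move=> h0; elim: n => //= n IH p; exact: integral_ge0. Qed.

Lemma measurable_iter_add_gauss_sq n (h : R -> \bar R) : measurable_fun setT h ->
  (forall x, 0 <= h x) -> measurable_fun setT (iter n (@add_gauss_sq R) h).
Proof.
move=> mh h0; elim: n => //= n IH; apply: measurable_add_gauss_sq => //.
exact: iter_add_gauss_sq_ge0.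
Qed.

(** Each step contributes a factor [c^-1] by [gauss_scale], and the exponential weights telescope.
    The induction needs an arbitrary starting point [p]; the application takes [p = 0]. *)
Lemma iter_add_gauss_sq_scale n (h : R -> \bar R) (c p : R) : (0 < c)%R ->
  measurable_fun setT h -> (forall x, 0 <= h x) ->
  let t := ((1 - c ^- 2) / 2)%R in
  iter n (@add_gauss_sq R) (fun z => h (c ^+ 2 * z)%R) p =
  (c ^- n * expR (- (c ^+ 2 * p * t)))%:E *
  iter n (@add_gauss_sq R) (fun z => h z * (expR (z * t))%:E) (c ^+ 2 * p)%R.
Proof.
move=> c0 mh h0 t; elim: n p => [|n IH] p.
  rewrite /= expr0 invr1 mul1r muleC -muleA -EFinM -expRD subrr expR0 mule1//.
set K := iter n _ (fun z => h z * _) in IH.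
have mht : measurable_fun setT (fun z => h z * (expR (z * t))%:E).
  apply: emeasurable_funM => //; apply/measurable_EFinP.
  by apply: (measurableT_comp (@measurable_expR R)); exact: measurable_funM.
have ht0 z : 0 <= h z * (expR (z * t))%:E by rewrite mule_ge0// lee_fin expR_ge0.
have mK : measurable_fun setT K by exact: measurable_iter_add_gauss_sq.
have K0 z : 0 <= K z by exact: iter_add_gauss_sq_ge0.
have msq : measurable_fun setT (fun x : R => c ^+ 2 * p + x ^+ 2)%R.
  exact: measurable_funD.
have mKsq : measurable_fun setT (fun x : R => K (c ^+ 2 * p + x ^+ 2)%R).
  exact: (measurableT_comp mK msq).
pose Psi (x : R) := (expR (- ((c ^+ 2 * p + x ^+ 2) * t)))%:E * K (c ^+ 2 * p + x ^+ 2)%R.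
have Psi0 x : 0 <= Psi x by rewrite mule_ge0// lee_fin expR_ge0.
have mPsi : measurable_fun setT Psi.
  apply: emeasurable_funM => //; apply/measurable_EFinP.
  apply: (measurableT_comp (@measurable_expR R)); apply: measurableT_comp => //.
  exact: measurable_funM.
have mPsic : measurable_fun setT (fun x => Psi (c * x)%R).
  by apply: (measurableT_comp mPsi); exact: measurable_funM.
transitivity (\int[gauss]_r ((c ^- n)%:E * Psi (c * r)%R)).
  apply: eq_integral => r _; rewrite [LHS]IH /Psi EFinM -muleA.
  by rewrite exprMn -mulrDr.
transitivity ((c ^- n)%:E * \int[gauss]_r Psi (c * r)%R).
  by rewrite ge0_integralZl// lee_fin invr_ge0 exprn_ge0// ltW.
transitivity ((c ^- n)%:E * (c^-1%:E * \int[gauss]_x (Psi x * (expR (x ^+ 2 * t))%:E))).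
  apply: (congr1 (mule (c ^- n)%:E)); exact: gauss_scale.
transitivity ((c ^- n)%:E * (c^-1%:E * \int[gauss]_x ((expR (- (c ^+ 2 * p * t)))%:E * K (c ^+ 2 * p + x ^+ 2)%R))).
  do 2 apply: congr1; apply: eq_integral => x _.
  by rewrite /Psi muleAC -EFinM -expRD; congr ((expR _)%:E * _); ring.
transitivity ((c ^- n)%:E * (c^-1%:E * ((expR (- (c ^+ 2 * p * t)))%:E * add_gauss_sq K (c ^+ 2 * p)%R))).
  by do 2 apply: congr1; rewrite ge0_integralZl// lee_fin expR_ge0.
rewrite !muleA -!EFinM; congr (_%:E * _); rewrite (exprSr c n) invfM; ring.
Qed.

End iter_scale.

(** * Integrals of real-valued functions *)

Section integral_aux.
Local Open Scope ereal_scope.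
Context d (T : measurableType d) (R : realType) (m : {measure set T -> \bar R}).

Lemma integral_cst_indic (K : R) (A : set T) : measurable A -> (0 <= K)%R ->
  \int[m]_x (K * \1_A x)%:E = K%:E * m A.
Proof.
move=> mA K0; under eq_integral do rewrite EFinM.
have mi : measurable_fun setT (fun x => (\1_A x)%:E : \bar R).
  by apply/measurable_EFinP; exact: measurable_indic.
by rewrite ge0_integralZl// integral_indic// setIT.
Qed.

Lemma le_integral_EFin (f g : T -> R) :
  measurable_fun setT f -> measurable_fun setT g -> (forall x, (0 <= f x)%R) ->
  (forall x, (f x <= g x)%R) -> \int[m]_x (f x)%:E <= \int[m]_x (g x)%:E.
Proof.
move=> mf mg f0 fg; apply: ge0_le_integral => //.
- by move=> x _; rewrite lee_fin.
- exact/measurable_EFinP.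
- exact/measurable_EFinP.
- by move=> x _; rewrite lee_fin.
Qed.

Lemma ge0_integralZ_EFin (K : R) (f : T -> R) :
  measurable_fun setT f -> (forall x, (0 <= f x)%R) -> (0 <= K)%R ->
  \int[m]_x (K * f x)%:E = K%:E * \int[m]_x (f x)%:E.
Proof.
move=> mf f0 K0; under eq_integral do rewrite EFinM.
have mi : measurable_fun setT (EFin \o f) by exact/measurable_EFinP.
by rewrite ge0_integralZl// => x _; rewrite lee_fin.
Qed.

End integral_aux.

(** * Density of the chi-squared law, from its scaling relation *)

Section chi2.
Context (R : realType) d (T : measurableType d) (Q : probability T R).
Local Notation mu := (@lebesgue_measure R).
Local Open Scope ereal_scope.
Variables (n : nat) (y : T -> R).
Hypothesis n0 : (0 < n)%N.
Hypothesis my : measurable_fun setT y.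
Hypothesis y0 : forall w, (0 <= y w)%R.
Hypothesis y_scale : forall (c : R) (h : R -> \bar R), (0 < c)%R ->
  measurable_fun setT h -> (forall x, 0 <= h x) ->
  \int[Q]_w h (c ^+ 2 * y w)%R =
  (c ^- n)%:E * \int[Q]_w (h (y w) * (expR (y w * ((1 - c ^- 2) / 2)))%:E).

Let eq_lee (u v : \bar R) : u = v -> u <= v.
Proof. by move=> ->. Qed.

Let mpre (A : set R) : measurable A -> measurable (y @^-1` A).
Proof. by move=> mA; rewrite -[X in measurable X]setTI; exact: my. Qed.

(** The event is invariant under scaling, so [y_scale] with [c = 2] gives its probability [q] the
    equation [q = 2 ^- n * q]. *)
Lemma chi2_neq0 : Q [set w | y w = 0%R] = 0.
Proof.
have m0 : measurable [set w | y w = 0%R] by exact: (mpre (measurable_set1 0%R)).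
pose h (z : R) : \bar R := (\1_[set 0%R : R] z)%:E.
have hE z : h z = (z == 0%R)%:R%:E.
  rewrite /h indicE; congr ((nat_of_bool _)%:R%:E).
  by apply/idP/idP => [/set_mem/= ->//|/eqP z0]; exact/mem_set.
have mh : measurable_fun setT h by apply/measurable_EFinP; exact: measurable_indic.
have QE : \int[Q]_w h (y w) = Q [set w | y w = 0%R].
  by rewrite -[in RHS](setIT [set w | _]) -(integral_indic Q measurableT m0).
have := @y_scale 2 h (ltr0Sn _ _) mh (fun z => _).
have -> : \int[Q]_w h (2 ^+ 2 * y w)%R = \int[Q]_w h (y w).
  apply: eq_integral => w _; rewrite !hE; congr ((nat_of_bool _)%:R%:E).
  by rewrite mulf_eq0 expf_eq0 pnatr_eq0.
have -> : \int[Q]_w (h (y w) * (expR (y w * ((1 - 2 ^- 2) / 2)))%:E) = \int[Q]_w h (y w).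
  apply: eq_integral => w _; rewrite hE.
  by case: eqP => [->|_]; rewrite ?mul0r ?expR0 ?mule1 ?mul0e.
rewrite QE => H.
have Qf : Q [set w | y w = 0%R] \is a fin_num by exact: fin_num_measure.
move: H; rewrite -(fineK Qf); set q := fine _ => H.
have {}H : q = (2 ^- n * q)%R.
  by apply: EFin_inj; rewrite EFinM; apply: H => z; rewrite lee_fin.
have : ((1 - 2 ^- n) * q = 0)%R by rewrite mulrBl mul1r -H subrr.
move/eqP; rewrite mulf_eq0 subr_eq0 gt_eqF /= => [/eqP ->//|].
by rewrite invf_lt1 ?exprn_gt0// exprn_egt1// ?ltr1n// -lt0n.
Qed.

Let a : R := (n%:R / 2)%R.

(** The chi-squared density with [n] degrees of freedom, without its normalising constant. *)
Definition chi2_weight (z : R) : R := (z `^ (a - 1) * expR (- z / 2))%R.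

Let pos (z : R) : R := \1_[set x : R | (0 < x)%R] z.

Let powR_cancel (x : R) : (0 < x)%R -> (x * x `^ a * x `^ (- a - 1) = 1)%R.
Proof.
move=> x0; rewrite -opprD powRN powRD; last by apply/implyP => _; rewrite gt_eqF.
rewrite powRr1 ?ltW// mulrC [(x * _)%R]mulrC mulVf// mulf_neq0 ?gt_eqF//.
exact: powR_gt0.
Qed.

Let posE z : (0 < z)%R -> pos z = 1%R.
Proof. by move=> z0; rewrite /pos indicE mem_set. Qed.

Let posE0 z : (z <= 0)%R -> pos z = 0%R.
Proof. by move=> z0; rewrite /pos indicE memNset//= => h; move: z0; rewrite leNgt h. Qed.

Let mpos : measurable_fun setT pos.
Proof.
apply: measurable_indic; rewrite (_ : [set x | _] = `]0%R, +oo[%classic)//.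
by apply/seteqP; split => x /=; rewrite in_itv/= andbT.
Qed.

(** The normalising constant in the form that the computation produces: after [z] is replaced by its
    inverse it is a Gamma integral. Its value is never computed; that it is positive and finite
    suffices. *)
Let C0 : \bar R := \int[mu]_z (pos z * (z `^ (- a - 1) * expR (- (z `^ (-1) / 2))))%:E.

Let swapRT (f : R -> T -> \bar R) :
  measurable_fun setT (fun p : R * T => f p.1 p.2) -> (forall x w, 0 <= f x w) ->
  \int[mu]_x \int[Q]_w f x w = \int[Q]_w \int[mu]_x f x w.
Proof. exact: (@tonelli_swap _ _ (measurableTypeR R) T R mu Q f). Qed.

Let mintRT (f : R -> T -> \bar R) :
  measurable_fun setT (fun p : R * T => f p.1 p.2) -> (forall x w, 0 <= f x w) ->
  measurable_fun setT (fun w => \int[mu]_x f x w).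
Proof. exact: (@measurable_integral_fst _ _ (measurableTypeR R) T R mu f). Qed.

Let msecRT (f : R -> T -> \bar R) w :
  measurable_fun setT (fun p : R * T => f p.1 p.2) ->
  measurable_fun setT (fun x => f x w).
Proof.
move=> mf.
exact: (@measurableT_comp _ _ _ _ _ _ _ _ (fun x => (x, w)) mf (measurable_fun_pair _ _)).
Qed.

(* Integrate the scaling relation against [dl / l], [l = c ^+ 2]: the substitution [z = l * y w]
   and Tonelli's theorem show that the law of [y] has density proportional to
   [chi2_weight], without computing an [n]-dimensional integral. *)
Lemma chi2_density (A : set R) : measurable A -> (forall z, A z -> (0 < z)%R) ->
  \int[mu]_z (\1_A z * chi2_weight z)%:E = C0 * Q (y @^-1` A).
Proof.
move=> mA Apos.
pose H (z : R) : R := (\1_A z * z `^ a)%R.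
have H0 z : (0 <= H z)%R by rewrite mulr_ge0// powR_ge0.
have mH : measurable_fun setT H.
  by apply: measurable_funM; [exact: measurable_indic|exact: measurable_powR].
have HN z : (z <= 0)%R -> H z = 0%R.
  move=> z0; rewrite /H indicE memNset ?mul0r// => /Apos.
  by rewrite ltNge z0.
pose k (l : R) (w : T) : R := (pos l * l `^ (-1) * (H (l * y w) * expR (- (l * y w) / 2)))%R.
have k0 l w : 0 <= (k l w)%:E.
  by rewrite lee_fin !mulr_ge0 ?powR_ge0 ?expR_ge0.
have mk : measurable_fun setT (fun p : R * T => (k p.1 p.2)%:E).
  apply/measurable_EFinP; apply: measurable_funM.
    apply: measurable_funM; first exact: (measurableT_comp mpos).
    exact: (measurableT_comp (measurable_powR _)).
  have mly : measurable_fun setT (fun p : R * T => p.1 * y p.2)%R.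
    by apply: measurable_funM => //; exact: (measurableT_comp my).
  apply: measurable_funM; first exact: (measurableT_comp mH).
  apply: (measurableT_comp (@measurable_expR R)); apply: measurable_funM => //.
  exact: measurableT_comp.
pose k' (l : R) (w : T) : R := (H (y w) * (pos l * (l `^ (- a - 1) * expR (- (y w * l `^ (-1) / 2)))))%R.
have k'0 l w : 0 <= (k' l w)%:E.
  by rewrite lee_fin !mulr_ge0 ?powR_ge0 ?expR_ge0.
have mk' : measurable_fun setT (fun p : R * T => (k' p.1 p.2)%:E).
  have my2 : measurable_fun setT (fun p : R * T => y p.2) by exact: (measurableT_comp my).
  have mpow (q : R) : measurable_fun setT (fun p : R * T => p.1 `^ q)%R.
    exact: (measurableT_comp (measurable_powR q)).
  apply/measurable_EFinP; apply: measurable_funM; first exact: (measurableT_comp mH).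
  apply: measurable_funM; first exact: (measurableT_comp mpos).
  apply: measurable_funM; first exact: mpow.
  apply: (measurableT_comp (@measurable_expR R)); apply: measurableT_comp => //.
  by apply: measurable_funM => //; exact: measurable_funM.
have step1 w : (0 < y w)%R ->
    \int[mu]_l (k l w)%:E = \int[mu]_z (\1_A z * chi2_weight z)%:E.
  move=> yw; have yi0 : (0 < (y w)^-1)%R by rewrite invr_gt0.
  have mkw : measurable_fun setT (fun l => (k l w)%:E) by exact: (@msecRT (fun l w => (k l w)%:E)).
  transitivity (`|(y w)^-1|%:E * \int[mu]_z (k ((y w)^-1 * z + 0)%R w)%:E).
    by apply: (@ge0_integral_affine _ _ _ (fun l => (k l w)%:E)) => //; rewrite gt_eqF.
  transitivity (\int[mu]_z (`|(y w)^-1|%:E * (k ((y w)^-1 * z + 0)%R w)%:E)).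
    apply/esym/ge0_integralZl => //.
    by apply: (measurableT_comp mkw); apply: measurable_funD => //; exact: measurable_funM.
  apply: eq_integral => z _; rewrite -EFinM; congr EFin; rewrite addr0 gtr0_norm//.
  have [z0|z0] := leP z 0%R.
    rewrite /k posE0; last by rewrite pmulr_rle0.
    rewrite !mul0r mulr0 indicE memNset ?mul0r// => /Apos.
    by rewrite ltNge z0.
  rewrite /k /H /chi2_weight posE ?mulr_gt0// mul1r powR_inv1 ?mulr_ge0 ?ltW//.
  rewrite (_ : (y w)^-1 * z * y w = z)%R; last by field; rewrite gt_eqF.
  rewrite powRB; last by apply/implyP => _; rewrite gt_eqF.
  rewrite powRr1 ?ltW//; field.
  by rewrite !gt_eqF.
(* [y_scale] with [c] the square root of [l] removes [l] from the argument of [H]; the exponential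
   it creates turns [expR (- y w / 2)] into [expR (- y w / (2 l))]. *)
have step2 l : \int[Q]_w (k l w)%:E = \int[Q]_w (k' l w)%:E.
  have [l0|l0] := leP l 0%R.
    by apply: eq_integral => w _; rewrite /k /k' !posE0// !(mul0r, mulr0).
  pose h (z : R) : \bar R := (H z * expR (- z / 2))%:E.
  have h0 z : 0 <= h z by rewrite lee_fin mulr_ge0// expR_ge0.
  have mh : measurable_fun setT h.
    apply/measurable_EFinP; apply: measurable_funM => //.
    by apply: (measurableT_comp (@measurable_expR R)); apply: measurable_funM.
  pose c := Num.sqrt l; have c0 : (0 < c)%R by rewrite sqrtr_gt0.
  have c2 : (c ^+ 2 = l)%R by rewrite sqr_sqrtr// ltW.
  have mhy : measurable_fun setT (fun w => h (l * y w)%R).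
    by apply: (measurableT_comp mh); exact: measurable_funM.
  transitivity (\int[Q]_w ((l `^ (-1))%:E * h (l * y w)%R)).
    by apply: eq_integral => w _; rewrite -EFinM /k posE// mul1r.
  transitivity ((l `^ (-1))%:E * \int[Q]_w h (c ^+ 2 * y w)%R).
    by rewrite c2 ge0_integralZl// lee_fin powR_ge0.
  rewrite y_scale// muleA -EFinM -ge0_integralZl//; last 3 first.
  - apply: emeasurable_funM; first exact: (measurableT_comp mh).
    apply/measurable_EFinP; apply: (measurableT_comp (@measurable_expR R)).
    exact: measurable_funM.
  - by move=> w _; rewrite mule_ge0// lee_fin expR_ge0.
  - by rewrite lee_fin mulr_ge0 ?powR_ge0// invr_ge0 exprn_ge0// ltW.
  apply: eq_integral => w _; rewrite -!EFinM; congr EFin.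
  rewrite /k' posE// mul1r -(mulrA (H _)) -expRD [LHS]mulrCA; congr (_ * (_ * expR _))%R.
  - rewrite powRD; last by apply/implyP => _; rewrite gt_eqF.
    rewrite mulrC; congr (_ * _)%R.
    rewrite -powR_invn ?ltW// /c -powR12_sqrt ?ltW// -powRrM; congr powR.
    by rewrite /a; field.
  - by rewrite c2 powR_inv1 ?ltW//; field; rewrite gt_eqF.
(* The substitution [l = y w * z] leaves a constant that no longer depends on [w]. *)
have step3 w : \int[mu]_l (k' l w)%:E = (\1_(y @^-1` A) w)%:E * C0.
  rewrite indicE; case: (boolP (w \in _)) => [/set_mem/= Aw|/negP nAw]; last first.
    rewrite mul0e; apply: integral0_eq => l _; rewrite /k'.
    rewrite [H _](_ : _ = 0%R) ?mul0r// /H indicE memNset ?mul0r// => Aw.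
    by apply: nAw; exact/mem_set.
  rewrite mul1e; have yw := Apos _ Aw.
  have mkw : measurable_fun setT (fun l => (k' l w)%:E) by exact: (@msecRT (fun l w => (k' l w)%:E)).
  transitivity (`|y w|%:E * \int[mu]_z (k' (y w * z + 0)%R w)%:E).
    by apply: (@ge0_integral_affine _ _ _ (fun l => (k' l w)%:E)) => //; rewrite gt_eqF.
  transitivity (\int[mu]_z (`|y w|%:E * (k' (y w * z + 0)%R w)%:E)).
    apply/esym/ge0_integralZl; first exact: measurableT.
    - by apply: (measurableT_comp mkw); apply: measurable_funD => //; exact: measurable_funM.
    - by move=> z _; exact: k'0.
    - by rewrite lee_fin.
  apply: eq_integral => z _; rewrite -EFinM; congr EFin; rewrite addr0 gtr0_norm//.
  have [z0|z0] := leP z 0%R.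
    by rewrite /k' !posE0 ?pmulr_rle0// !(mul0r, mulr0).
  have zy0 : (0 <= y w * z)%R by rewrite mulr_ge0// ltW.
  rewrite /k' /H !posE ?mulr_gt0// !mul1r indicE mem_set// mul1r.
  rewrite powRM ?ltW// (powR_inv1 zy0) (powR_inv1 (ltW z0)).
  rewrite (_ : y w * (y w * z)^-1 = z^-1)%R; last by field; rewrite !gt_eqF.
  rewrite !mulrA; congr (_ * _)%R.
  by rewrite powR_cancel// mul1r.
transitivity (\int[Q]_w \int[mu]_l (k l w)%:E).
  set J := \int[mu]_z _; transitivity (\int[Q]_w J).
    by rewrite integral_cst// [X in _ * X](_ : _ = 1) ?mule1//; exact: (probability_setT Q).
  (* [step1] needs [y w] positive, which holds almost everywhere by [chi2_neq0]. *)
  apply: ge0_ae_eq_integral => //.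
  - exact: mintRT.
  - by move=> w _; apply: integral_ge0 => z _; rewrite lee_fin !mulr_ge0 ?powR_ge0 ?expR_ge0.
  - by move=> w _; exact: integral_ge0.
  exists [set w | y w = 0%R]; split.
  - exact: (mpre (measurable_set1 0%R)).
  - exact: chi2_neq0.
  move=> w /= nw; apply/eqP; rewrite eq_le y0 andbT leNgt; apply/negP => yw.
  by apply: nw => _; exact/esym/step1.
transitivity (\int[mu]_l \int[Q]_w (k l w)%:E).
  by apply/esym; exact: swapRT.
transitivity (\int[mu]_l \int[Q]_w (k' l w)%:E).
  by apply: eq_integral => l _; exact: step2.
transitivity (\int[Q]_w \int[mu]_l (k' l w)%:E).
  exact: swapRT.
transitivity (\int[Q]_w ((\1_(y @^-1` A) w)%:E * C0)).
  by apply: eq_integral => w _; exact: step3.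
have C00 : 0 <= C0.
  by apply: integral_ge0 => z _; rewrite lee_fin !mulr_ge0 ?powR_ge0 ?expR_ge0.
have mi : measurable_fun setT (fun w => (\1_(y @^-1` A) w)%:E : \bar R).
  by apply/measurable_EFinP; exact: (measurable_indic (mpre mA)).
under eq_integral do rewrite muleC.
rewrite ge0_integralZl//; apply: (congr1 (mule C0)).
by rewrite integral_indic ?setIT//; exact: mpre.
Qed.

Let weight_ge0 z : (0 <= chi2_weight z)%R.
Proof. by rewrite mulr_ge0 ?powR_ge0 ?expR_ge0. Qed.

Let mweight : measurable_fun setT chi2_weight.
Proof.
apply: measurable_funM; first exact: measurable_powR.
by apply: (measurableT_comp (@measurable_expR R)); apply: measurable_funM.
Qed.

Let a_ge0 : (0 <= a)%R. Proof. by rewrite divr_ge0. Qed.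

Let C0_ge0 : 0 <= C0.
Proof. by apply: integral_ge0 => z _; rewrite lee_fin !mulr_ge0 ?powR_ge0 ?expR_ge0. Qed.

(** If [C0] vanished, so would the integral of the weight over []1, 2]]. *)
Let C0_gt0 : 0 < C0.
Proof.
rewrite lt0e C0_ge0 andbT; apply/eqP => C0E.
pose A : set R := `]1%R, 2%R]%classic.
have mA : measurable A by exact: measurable_itv.
have Apos z : A z -> (0 < z)%R by rewrite /A/= in_itv/= => /andP[]; lra.
have := chi2_density mA Apos; rewrite C0E mul0e.
apply/eqP; rewrite gt_eqF; first by [].
(* A lower bound of the weight on []1, 2]], from [z ^ (a - 1) >= 1 / z >= 1 / 2] and
   [- z / 2 >= - 1]. *)
pose e : R := (2^-1 * expR (- 1))%R.
have e0 : (0 < e)%R by rewrite mulr_gt0// expR_gt0.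
apply: (@lt_le_trans _ _ (\int[mu]_z (e * \1_A z)%:E)).
  apply: (@lt_le_trans _ _ (e%:E * mu A)); last first.
    by apply/eq_lee/esym; apply: integral_cst_indic => //; exact: ltW.
  rewrite lebesgue_measure_itv/= lte_fin ltr1n/=.
  by rewrite -EFinD -EFinM lte_fin mulr_gt0//; lra.
apply: le_integral_EFin.
- by apply: measurable_funM => //; exact: measurable_indic.
- by apply: measurable_funM => //; exact: measurable_indic.
- by move=> z; rewrite mulr_ge0// ltW.
move=> z; rewrite indicE; case: (boolP (z \in A)) => [/set_mem|_]; last first.
  by rewrite mulr0 mul0r.
rewrite /A/= in_itv/= => /andP[z1 z2]; rewrite mulr1 mul1r.
apply: ler_pM.
- by rewrite invr_ge0.
- exact: expR_ge0.
- apply: (@le_trans _ _ (z `^ (-1))%R); last by apply: ler_powR; [exact: ltW|have := a_ge0; lra].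
  by rewrite powR_inv1; [rewrite lef_pV2 ?posrE//; lra|lra].
- by rewrite ler_expR; lra.
Qed.

Let C0_fin : C0 \is a fin_num.
Proof.
rewrite ge0_fin_numE// ltNge leye_eq; apply/negP => /eqP C0E.
pose M (N : nat) : R := N.+1%:R.
pose A (N : nat) : set R := `](M N)^-1%R, M N]%classic.
have mA N : measurable (A N) by exact: measurable_itv.
have M1 N : (1 <= M N)%R by rewrite ler1n.
have Apos N z : A N z -> (0 < z)%R.
  by rewrite /A/= in_itv/= => /andP[+ _]; apply: lt_trans; rewrite invr_gt0 ltr0n.
have QA N : Q (y @^-1` A N) = 0.
  apply/eqP; apply: contrapT => /negP QN.
  have := chi2_density (mA N) (@Apos N); rewrite C0E gt0_mulye; last first.
    by rewrite lt0e QN measure_ge0.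
  apply/eqP; rewrite lt_eqF//.
  (* A bound of the weight on [A N]: the first term serves for [z >= 1], the second for [z < 1],
     where [z ^ (a - 1) <= 1 / z]. *)
  pose K : R := (M N `^ a + M N)%R.
  have K0 : (0 <= K)%R by rewrite addr_ge0 ?powR_ge0// /M.
  apply: (@le_lt_trans _ _ (\int[mu]_z (K * \1_(A N) z)%:E)); last first.
    apply: (@le_lt_trans _ _ (K%:E * mu (A N))).
      by apply/eq_lee; apply: integral_cst_indic => //; exact: mA.
    rewrite lebesgue_measure_itv/=.
    by case: ifP => _; rewrite ?mule0 ?ltry// -EFinD -EFinM ltry.
  apply: le_integral_EFin.
  - by apply: measurable_funM => //; exact: (measurable_indic (mA N)).
  - by apply: measurable_funM => //; exact: (measurable_indic (mA N)).
  - by move=> z; rewrite mulr_ge0.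
  move=> z; rewrite indicE.
  case: (boolP (z \in A N)) => [/set_mem Az|_]; last by rewrite mulr0 mul0r.
  have z0 := Apos _ _ Az; move: Az; rewrite /A/= in_itv/= => /andP[z1 z2].
  rewrite mulr1 mul1r; apply: (@le_trans _ _ (z `^ (a - 1))%R).
    by rewrite ler_piMr ?powR_ge0// -[leRHS]expR0 ler_expR; lra.
  have [z11|z11] := leP 1%R z.
    apply: (@le_trans _ _ (z `^ a)%R); first by apply: ler_powR => //; lra.
    apply: (@le_trans _ _ (M N `^ a)%R); last by rewrite lerDl.
    by apply: ge0_ler_powR => //; rewrite nnegrE ?ltW// /M.
  apply: (@le_trans _ _ (z `^ (-1))%R); first by apply: ger_powR; [rewrite z0 ltW|have := a_ge0; lra].
  rewrite (powR_inv1 (ltW z0)); apply: (@le_trans _ _ (M N)); last by rewrite lerDr powR_ge0.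
  by rewrite -[leRHS]invrK lef_pV2 ?posrE ?invr_gt0 ?ltr0n// ltW.
have Qneg : Q.-negligible (\bigcup_N (y @^-1` A N)).
  apply: negligible_bigcup => N; exists (y @^-1` A N); split => //.
  - exact: mpre.
  - exact: QA.
have Q0neg : Q.-negligible [set w | y w = 0%R].
  exists [set w | y w = 0%R]; split => //; last exact: chi2_neq0.
  exact: (mpre (measurable_set1 0%R)).
have : Q.-negligible [set: T].
  apply: negligibleS (negligibleU Qneg Q0neg) => w _.
  have [yw|yw] := eqVneq (y w) 0%R; first by right.
  have yw0 : (0 < y w)%R by rewrite lt0r yw y0.
  left; exists (Num.truncn (y w + (y w)^-1)) => //=; rewrite /A /= in_itv/= /M.
  have h : (y w + (y w)^-1 < (Num.truncn (y w + (y w)^-1)).+1%:R)%R by exact: Num.Theory.truncnS_gt.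
  have yi : (0 < (y w)^-1)%R by rewrite invr_gt0.
  apply/andP; split; last lra.
  by rewrite -[ltRHS]invrK ltf_pV2 ?posrE ?ltr0n//; lra.
move=> /(measure_negligible measurableT) Q0.
by have /eqP := etrans (esym (probability_setT Q)) Q0; rewrite onee_eq0.
Qed.

Let chi2_shift_weight (v : R) (A : set R) : (0 <= v)%R -> measurable A ->
  (forall z, A z -> (0 < z)%R) ->
  C0 * Q [set w | A (y w - v)%R] = \int[mu]_z (\1_A z * chi2_weight (z + v))%:E.
Proof.
move=> v0 mA Apos.
pose Av : set R := [set z | A (z - v)%R].
have mAv : measurable Av.
  have : measurable_fun setT (fun z : R => z - v)%R by exact: measurable_funB.
  by move=> /(_ measurableT A mA); rewrite setTI.
have Avpos z : Av z -> (0 < z)%R by move/Apos; lra.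
transitivity (\int[mu]_z (\1_Av z * chi2_weight z)%:E).
  by rewrite (chi2_density mAv Avpos).
transitivity (`|1%R|%:E * \int[mu]_z (\1_Av (1 * z + v) * chi2_weight (1 * z + v))%:E).
  apply: (@ge0_integral_affine _ _ _ (fun z => (\1_Av z * chi2_weight z)%:E)).
  - by rewrite oner_eq0.
  - by apply/measurable_EFinP; apply: measurable_funM => //; exact: measurable_indic.
  - by move=> z; rewrite lee_fin mulr_ge0.
rewrite normr1 mul1e; apply: eq_integral => z _; rewrite mul1r.
congr (_ * _)%:E; rewrite !indicE; congr ((nat_of_bool _)%:R).
by apply/idP/idP => /set_mem h; apply/mem_set; move: h; rewrite /Av/= addrK.
Qed.

Let mAw (A : set R) : measurable A ->
  measurable_fun setT (fun z => \1_A z * chi2_weight z)%R.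
Proof. by move=> mA; apply: measurable_funM => //; exact: measurable_indic. Qed.

Let mAwv (A : set R) v : measurable A ->
  measurable_fun setT (fun z => \1_A z * chi2_weight (z + v))%R.
Proof.
move=> mA; apply: measurable_funM; first exact: measurable_indic.
by apply: (measurableT_comp mweight); exact: measurable_funD.
Qed.

(** Multiplied by [C0], both sides become integrals of weights over [A]; the constant then cancels,
    and a pointwise ratio of weights compares probabilities. *)
Lemma chi2_shift_le (v c : R) (A : set R) : (0 <= v)%R -> (0 <= c)%R -> measurable A ->
  (forall z, A z -> (0 < z)%R) ->
  (forall z, A z -> chi2_weight (z + v) <= c * chi2_weight z)%R ->
  Q [set w | A (y w - v)%R] <= c%:E * Q (y @^-1` A).
Proof.
move=> v0 c0 mA Apos Ac; rewrite -(@lee_pmul2l _ C0)//.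
apply: (@le_trans _ _ (\int[mu]_z (\1_A z * chi2_weight (z + v))%:E)).
  by apply/eq_lee; exact: chi2_shift_weight.
apply: (@le_trans _ _ (\int[mu]_z (c * (\1_A z * chi2_weight z))%:E)); last first.
  rewrite muleCA -(chi2_density mA Apos).
  apply/eq_lee; apply: ge0_integralZ_EFin => //.
  - exact: mAw.
  - by move=> z; rewrite mulr_ge0.
apply: le_integral_EFin.
- exact: mAwv.
- by apply: measurable_funM => //; exact: mAw.
- by move=> z; rewrite mulr_ge0.
move=> z; rewrite indicE; case: (boolP (z \in A)) => [/set_mem Az|_].
  by rewrite !mul1r; exact: Ac.
by rewrite !mul0r mulr0.
Qed.

Lemma chi2_shift_ge (v c : R) (A : set R) : (0 <= v)%R -> (0 <= c)%R -> measurable A ->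
  (forall z, A z -> (0 < z)%R) ->
  (forall z, A z -> c * chi2_weight z <= chi2_weight (z + v))%R ->
  c%:E * Q (y @^-1` A) <= Q [set w | A (y w - v)%R].
Proof.
move=> v0 c0 mA Apos Ac; rewrite -(@lee_pmul2l _ C0)//.
apply: (@le_trans _ _ (\int[mu]_z (\1_A z * chi2_weight (z + v))%:E)); last first.
  by apply/eq_lee/esym; exact: chi2_shift_weight.
apply: (@le_trans _ _ (\int[mu]_z (c * (\1_A z * chi2_weight z))%:E)).
  rewrite muleCA -(chi2_density mA Apos).
  apply/eq_lee/esym; apply: ge0_integralZ_EFin => //.
  - exact: mAw.
  - by move=> z; rewrite mulr_ge0.
apply: le_integral_EFin.
- by apply: measurable_funM => //; exact: mAw.
- exact: mAwv.
- by move=> z; rewrite mulr_ge0// mulr_ge0.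
move=> z; rewrite indicE; case: (boolP (z \in A)) => [/set_mem Az|_].
  by rewrite !mul1r; exact: Ac.
by rewrite !mul0r mulr0.
Qed.

End chi2.

(** * Expectations bounded by sums of tails *)

Section layers.
Context (R : realType) d (T : measurableType d) (Q : probability T R).
Variables (y : T -> R).
Hypothesis my : measurable_fun setT y.

Definition upper_tail (u : R) : R := fine (Q [set w | u < y w]).
Local Notation tail := upper_tail.

Lemma measurable_upper_tail u : measurable [set w | u < y w].
Proof.
have := my measurableT (measurable_itv (`]u, +oo[)).
by rewrite setTI; congr measurable; apply/seteqP; split => w /=; rewrite in_itv/= andbT.
Qed.

Lemma upper_tailE u : (upper_tail u)%:E = Q [set w | u < y w].
Proof. by rewrite fineK// fin_num_measure//; exact: measurable_upper_tail. Qed.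

Lemma upper_tail_ge0 u : 0 <= tail u.
Proof. by rewrite -lee_fin upper_tailE. Qed.

Lemma le_upper_tail u v : u <= v -> tail v <= tail u.
Proof.
move=> uv; rewrite -lee_fin !upper_tailE le_measure ?inE//;
  try exact: measurable_upper_tail.
by move=> w /=; exact: le_lt_trans.
Qed.

Variables (D : nat -> R) (v delta B : R).
Hypothesis D0 : forall j, 0 <= D j.
Hypothesis delta0 : 0 < delta.
Hypothesis DB : forall N, \sum_(j < N) D j * tail (v + j%:R * delta) <= B.

Let layer j w : \bar R := (D j * \1_[set w | v + j%:R * delta < y w] w)%:E.

Let layer_ge0 j w : (0 <= layer j w)%E.
Proof. by rewrite lee_fin mulr_ge0. Qed.

Let mlayer j : measurable_fun setT (layer j).
Proof.
apply/measurable_EFinP; apply: measurable_funM => //.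
by apply: measurable_indic; exact: measurable_upper_tail.
Qed.

(** [D j] is the increment granted when [y] passes the level [v + j * delta]; the expectation of the
    resulting step function is the sum of the [D j] weighted by tails. *)
Lemma integral_le_layers (f : T -> R) : measurable_fun setT f -> (forall w, 0 <= f w) ->
  (forall w N, (forall j, (j < N)%N -> v + j%:R * delta < y w) ->
     y w <= v + N%:R * delta -> f w <= \sum_(j < N) D j) ->
  (\int[Q]_w (f w)%:E <= B%:E)%E.
Proof.
move=> mf f0 fD.
apply: (@le_trans _ _ (\int[Q]_w \sum_(j <oo) layer j w)%E); last first.
  rewrite integral_nneseries//; apply: lime_le.
    by apply: is_cvg_nneseries => j _ _; exact: integral_ge0.
  apply: nearW => N; rewrite big_mkord.
  rewrite (eq_bigr (fun j : 'I_N => (D j * tail (v + j%:R * delta))%:E)).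
    by rewrite sumEFin lee_fin; exact: DB.
  move=> j _; rewrite integral_cst_indic//; last exact: measurable_upper_tail.
  by rewrite EFinM upper_tailE.
apply: ge0_le_integral => //.
- by move=> w _; rewrite lee_fin.
- exact/measurable_EFinP.
- by apply: ge0_emeasurable_sum => // j.
move=> w _.
have exN : exists N : nat, y w <= v + N%:R * delta.
  exists (Num.truncn ((y w - v) / delta)).+1.
  rewrite -lerBlDl -ler_pdivrMr//.
  by apply: ltW; exact: Num.Theory.truncnS_gt.
(* By minimality of [N], every level of index below [N] is passed, so the first [N] layers are all
   active. *)
pose N := ex_minn exN.
have [yN jN] : y w <= v + N%:R * delta /\ forall j, (j < N)%N -> v + j%:R * delta < y w.
  rewrite /N; case: ex_minnP => k yk kmin; split => // j jk.
  by rewrite ltNge; apply/negP => /kmin; rewrite leqNgt jk.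
apply: (@le_trans _ _ (\sum_(0 <= j < N) layer j w)%E); last first.
  by apply: nneseries_lim_ge.
rewrite big_mkord (eq_bigr (fun j : 'I_N => (D j)%:E)).
  by rewrite sumEFin lee_fin; exact: fD.
by move=> j _; rewrite /layer indicE mem_set ?mulr1//=; exact: jN.
Qed.

End layers.

Section tail.
Context (R : realType) d (T : measurableType d) (Q : probability T R).
Variables (y : T -> R).
Hypothesis my : measurable_fun setT y.
Local Notation tail := (upper_tail Q y).

(* [50] is the sum over [j >= 1] of [((j + 1) ^+ 3 - j ^+ 3) * 2 ^- (j - 1)]. *)
Lemma integral_pos3_tail (tau delta K : R) : 0 < delta ->
  tail (tau - delta) <= K * tail tau ->
  (forall j : nat, tail (tau + j%:R * delta) <= 2 ^- j * tail tau) ->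
  (\int[Q]_w (pos3 (y w - (tau - delta)))%:E <=
    (delta ^+ 3 * ((K + 50) * tail tau))%:E)%E.
Proof.
move=> d0 HK Hj.
pose v := tau - delta.
pose D (j : nat) : R := j%:R ^+ 2 *+ 3 + j%:R *+ 3 + 1.
have D0 j : 0 <= D j by rewrite /D !addr_ge0// mulrn_wge0// exprn_ge0.
have sumD N : \sum_(j < N) D j = N%:R ^+ 3.
  elim: N => [|N IH]; first by rewrite big_ord0 expr0n.
  by rewrite big_ord_recr/= IH /D -natr1; ring.
have t0 := upper_tail_ge0 Q my tau.
have bound N : \sum_(j < N) D j * tail (v + j%:R * delta) <= (K + 50) * tail tau.
  case: N => [|N].
    rewrite big_ord0 mulrDl; apply: addr_ge0; last exact: mulr_ge0.
    exact: (le_trans (upper_tail_ge0 Q my _) HK).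
  (* Layer [0] lies at [tau - delta], has [D 0 = 1] and accounts for [K]; layer [j + 1] lies at
     [tau + j * delta]. *)
  rewrite big_ord_recl /= mul0r addr0 /D/= expr0n/= !mul0rn !add0r mul1r mulrDl lerD//.
  rewrite -/D.
  (* Closed form of the partial sums of the series adding up to [50]; the subtracted remainder is
     [50] at [N = 0]. *)
  have : \sum_(i < N) D (bump 0 i) * tail (v + (bump 0 i)%:R * delta) <=
      (50 - ((N%:R + 1) ^+ 2 *+ 6 + (N%:R + 1) *+ 18 + 26) * 2 ^- N) * tail tau.
    elim: N => [|N IH]; first by rewrite big_ord0 add0r expr0 invr1 !expr1n mulr1; lra.
    rewrite big_ord_recr /=; apply: le_trans (lerD IH (ler_wpM2l (D0 _) (_ : _ <= 2 ^- N * tail tau))) _.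
      rewrite (_ : v + _ = tau + N%:R * delta); first exact: Hj.
      by rewrite /v /bump/= add1n -natr1; ring.
    rewrite /D /bump/= add1n -natr1 (exprSr 2 N) invfM.
    rewrite mulrA -mulrDl ler_wpM2r//.
    rewrite le_eqVlt; apply/orP; left; apply/eqP; by set e := 2 ^- N; field.
  move=> h; apply: (le_trans h).
  rewrite ler_wpM2r// gerBl; apply: mulr_ge0; last by rewrite invr_ge0 exprn_ge0.
  have N0 : 0 <= N%:R :> R by [].
  by have := sqr_ge0 (N%:R + 1 : R); lra.
have mpos3 : measurable_fun setT (fun w => pos3 ((y w - v) / delta)).
  apply: measurable_funX; apply: measurable_maxr => //.
  by apply: measurable_funM => //; exact: measurable_funB.
have pos30 w : 0 <= pos3 ((y w - v) / delta) by exact: pos3_ge0.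
rewrite (_ : (fun w => _) = (fun w => (delta ^+ 3 * pos3 ((y w - v) / delta))%:E)); last first.
  apply/funext => w; rewrite -pos3M ?ltW// mulrCA divff ?gt_eqF// mulr1//.
have d3 : 0 <= delta ^+ 3 by rewrite exprn_ge0// ltW.
rewrite ge0_integralZ_EFin// [leRHS]EFinM; apply: lee_wpmul2l; first by rewrite lee_fin.
apply: (@integral_le_layers _ _ _ Q _ my D v delta) => // w N jN yN.
rewrite sumD -(@pos3E _ N%:R)//; apply: le_pos3.
by rewrite ler_pdivrMr// lerBlDl.
Qed.

End tail.

(** * Tails of the chi-squared law *)

Section chi2_tail.
Context (R : realType) d (T : measurableType d) (Q : probability T R).
Variables (n : nat) (y : T -> R).
Hypothesis n0 : (0 < n)%N.
Hypothesis my : measurable_fun setT y.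
Hypothesis y0 : forall w, 0 <= y w.
Hypothesis y_scale : forall (c : R) (h : R -> \bar R), 0 < c ->
  measurable_fun setT h -> (forall x, (0 <= h x)%E) ->
  (\int[Q]_w h (c ^+ 2 * y w)%R =
  (c ^- n)%:E * \int[Q]_w (h (y w) * (expR (y w * ((1 - c ^- 2) / 2)))%:E))%E.
Local Notation tail := (upper_tail Q y).
Local Notation weight := (@chi2_weight R n).
Let a : R := n%:R / 2 - 1.

Let tail0 : tail 0 = 1.
Proof.
apply: EFin_inj; rewrite upper_tailE//.
rewrite (_ : [set w | 0 < y w] = ~` [set w | y w = 0]); last first.
  apply/seteqP; split => w /=; first by move=> + y_0; rewrite y_0 ltxx.
  by move/eqP => yw; rewrite lt0r yw y0.
rewrite probability_setC; last first.
  have := my measurableT (measurable_set1 0); rewrite setTI; exact.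
by rewrite (chi2_neq0 n0 my y_scale) sube0.
Qed.

(** The factor [((z + v) / z) ^ a] is nonincreasing in [z] for [a >= 0] and nondecreasing for
    [a <= 0]; this separates dimension one from the others. *)
Let weightD z v : 0 < z -> 0 <= v ->
  weight (z + v) = ((z + v) / z) `^ a * expR (- v / 2) * weight z.
Proof.
move=> z0 v0; have zv0 : 0 < z + v by rewrite ltr_wpDr.
rewrite /chi2_weight -/a (_ : - (z + v) / 2 = - v / 2 + - z / 2); last by field.
rewrite expRD powRM ?ltW ?invr_gt0// -[X in _ * X `^ a * _ * _]powR_inv1 ?ltW//.
rewrite powRAC powR_inv1 ?powR_ge0//.
have : z `^ a != 0 by rewrite gt_eqF// powR_gt0.
by move=> ?; field.
Qed.

Let ratio_le (z z' v : R) : 0 < z -> z <= z' -> 0 <= v -> (z' + v) / z' <= (z + v) / z.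
Proof.
move=> z0 zz' v0; have z'0 : 0 < z' by exact: lt_le_trans zz'.
rewrite ler_pdivrMr// mulrAC ler_pdivlMr// -subr_ge0.
rewrite (_ : _ - _ = v * (z' - z)); last by ring.
by rewrite mulr_ge0// subr_ge0.
Qed.

Let weight_gt0 z : 0 < z -> 0 < weight z.
Proof. by move=> z0; rewrite mulr_gt0 ?powR_gt0 ?expR_gt0. Qed.

Let ray (u : R) : set R := [set z | u < z].

Let mray u : measurable (ray u).
Proof.
rewrite (_ : ray u = `]u, +oo[%classic)//.
by apply/seteqP; split => x /=; rewrite in_itv/= andbT.
Qed.

Let tail_shift u v : (tail (u + v))%:E = Q [set w | ray u (y w - v)].
Proof.
rewrite upper_tailE//; congr (Q _); apply/seteqP; split => w /=; rewrite /ray/=; lra.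
Qed.

Let tail_shift_le u v c : 0 <= u -> 0 <= v -> 0 <= c ->
  (forall z, u < z -> weight (z + v) <= c * weight z) -> tail (u + v) <= c * tail u.
Proof.
move=> u0 v0 c0 H; rewrite -lee_fin tail_shift EFinM upper_tailE//.
exact: (chi2_shift_le n0 my y0 y_scale v0 c0 (mray u) (fun z uz => le_lt_trans u0 uz) H).
Qed.

Let tail_shift_ge u v c : 0 <= u -> 0 <= v -> 0 <= c ->
  (forall z, u < z -> c * weight z <= weight (z + v)) -> c * tail u <= tail (u + v).
Proof.
move=> u0 v0 c0 H; rewrite -lee_fin tail_shift EFinM upper_tailE//.
exact: (chi2_shift_ge n0 my y0 y_scale v0 c0 (mray u) (fun z uz => le_lt_trans u0 uz) H).
Qed.

Let tail_diff u u' : u <= u' -> (tail u - tail u')%:E = Q [set w | u < y w <= u'].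
Proof.
move=> uu'; rewrite EFinB !upper_tailE//.
have m1 : measurable [set w | u < y w <= u'].
  have := my measurableT (measurable_itv (`]u, u'])).
  by rewrite setTI; congr measurable; apply/seteqP; split => w /=; rewrite in_itv/=.
rewrite (_ : [set w | u < y w] = [set w | u < y w <= u'] `|` [set w | u' < y w]); last first.
  apply/seteqP; split => w /=.
    by move=> uy; case: (leP (y w) u') => yu'; [left; rewrite uy|right].
  by case=> [/andP[]//|]; exact: le_lt_trans.
rewrite measureU//; last 2 first.
- exact: measurable_upper_tail.
- by apply/seteqP; split => w //= [/andP[_]]; rewrite leNgt => /negP.
rewrite addeK//; apply: fin_num_measure; exact: measurable_upper_tail.
Qed.

Let tail_diff_ge u u' v c : 0 <= u -> u <= u' -> 0 <= v -> 0 <= c ->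
  (forall z, u < z -> z <= u' -> c * weight z <= weight (z + v)) ->
  c * (tail u - tail u') <= tail (u + v) - tail (u' + v).
Proof.
move=> u0 uu' v0 c0 H; rewrite -lee_fin EFinM !tail_diff//; last by rewrite lerD2r.
pose A : set R := [set z | u < z <= u'].
have mA : measurable A.
  have -> : A = `]u, u']%classic by apply/seteqP; split => x /=; rewrite in_itv/=.
  exact: measurable_itv.
have Apos z : A z -> 0 < z by move=> /andP[uz _]; exact: le_lt_trans uz.
apply: le_trans (chi2_shift_ge n0 my y0 y_scale v0 c0 mA Apos _) _.
  by move=> z /andP[]; exact: H.
rewrite le_eqVlt; apply/orP; left; apply/eqP; congr (Q _).
by apply/seteqP; split => w; rewrite /A/= => /andP[h1 h2]; apply/andP; split; lra.
Qed.

(** * Two dimensions or more: log-concave density *)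

Section dim_ge2.
Hypothesis a0 : 0 <= a.

Let powR_a (z z' : R) : 0 < z -> z <= z' -> z `^ a <= z' `^ a.
Proof.
move=> z0 zz'; apply: ge0_ler_powR => //; rewrite nnegrE ltW//.
exact: lt_le_trans zz'.
Qed.

Let tail_exp u v : 0 <= u -> 0 <= v -> expR (- v / 2) * tail u <= tail (u + v).
Proof.
move=> u0 v0; apply: tail_shift_ge => //.
move=> z uz; have z0 : 0 < z by exact: le_lt_trans uz.
rewrite weightD// (ler_wpM2r (ltW (weight_gt0 z0)))// ler_peMl ?expR_ge0//.
rewrite -[leLHS](_ : 1 `^ a = 1); last by rewrite powR1.
by apply: powR_a => //; rewrite ler_pdivlMr// mul1r lerDl.
Qed.

(** Increasing failure rate. With [c] the ratio of the densities at [u' + v] and [u'], the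
    corresponding ratio is at most [c] beyond [u'] ([h1]) and at least [c] between [u] and [u']
    ([h2]); multiplying the two bounds gives the claim. *)
Let tail_ifr u u' v : 0 <= u -> u <= u' -> 0 <= v ->
  tail (u' + v) * tail u <= tail u' * tail (u + v).
Proof.
move=> u0; rewrite le_eqVlt => /orP[/eqP <-|uu'] v0; first by rewrite mulrC.
have u'0 : 0 < u' by exact: le_lt_trans uu'.
pose c := ((u' + v) / u') `^ a * expR (- v / 2).
have c0 : 0 <= c by rewrite mulr_ge0 ?powR_ge0 ?expR_ge0.
have h1 : tail (u' + v) <= c * tail u'.
  apply: tail_shift_le => //; first exact: ltW.
  move=> z uz; have z0 : 0 < z by exact: lt_trans uz.
  rewrite weightD// (ler_wpM2r (ltW (weight_gt0 z0)))// ler_wpM2r ?expR_ge0//.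
  apply: powR_a; first by rewrite divr_gt0// ltr_wpDr.
  by apply: ratio_le => //; exact: ltW.
have h2 : c * (tail u - tail u') <= tail (u + v) - tail (u' + v).
  apply: tail_diff_ge => //; first exact: ltW.
  move=> z uz zu'; have z0 : 0 < z by exact: le_lt_trans uz.
  rewrite weightD// (ler_wpM2r (ltW (weight_gt0 z0)))// ler_wpM2r ?expR_ge0//.
  apply: powR_a; first by rewrite divr_gt0// ltr_wpDr// ltW.
  exact: ratio_le.
have t0 := upper_tail_ge0 Q my u'.
have tt : 0 <= tail u - tail u' by rewrite subr_ge0; apply: le_upper_tail => //; exact: ltW.
have h3 := ler_wpM2r tt h1.
have h4 := ler_wpM2l t0 h2.
by nra.
Qed.

(* Take [v = tau - tau / 2 ^+ N] for the least [N] such that the tail grows by a factor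
   at most [347] from [tau] to [v]; by minimality and log-concavity, the tail at least
   halves over each step of length [tau / 2 ^+ N] beyond [tau]. *)
Lemma chi2_tail_ge2 tau : 0 < tau -> 1 <= 397 * tail tau \/
  exists2 v, v < tau & (\int[Q]_w (pos3 (y w - v))%:E <=
    ((tau - v) ^+ 3 * (397 * tail tau))%:E)%E.
Proof.
move=> tau0; have [|small] := leP 1 (397 * tail tau); [by left|right].
have t0 : 0 < tail tau.
  have := @tail_exp 0 tau (lexx _) (ltW tau0); rewrite add0r tail0 mulr1.
  by apply: lt_le_trans; exact: expR_gt0.
pose delta (k : nat) : R := tau / 2 ^+ k.
have delta0 k : 0 < delta k by rewrite divr_gt0// exprn_gt0.
have deltaS k : delta k = delta k.+1 + delta k.+1.
  by rewrite /delta exprSr; field; rewrite expf_neq0.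
have delta_le k : delta k <= tau.
  rewrite ler_pdivrMr ?exprn_gt0//; apply: ler_peMr; first exact: ltW.
  by rewrite exprn_ege1// ler1n.
(* A step of length at most [1] multiplies the tail by at most [2], by [tail_exp] and
   [expR (- 1 / 2) >= 1 / 2]. *)
have exk : exists k, tail (tau - delta k) <= 347 * tail tau.
  exists (Num.truncn tau).+1; set k := (Num.truncn tau).+1.
  have d1 : delta k <= 1.
    rewrite ler_pdivrMr ?exprn_gt0// mul1r.
    apply: (@le_trans _ _ k%:R); first by apply: ltW; exact: Num.Theory.truncnS_gt.
    by rewrite -natrX ler_nat ltnW// ltn_expl.
  have := @tail_exp (tau - delta k) (delta k).
  rewrite subr_ge0 subrK => /(_ (delta_le k) (ltW (delta0 k))).
  have : 1 / 2 <= expR (- delta k / 2).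
    by apply: le_trans (expR_ge1Dx _); lra.
  have := upper_tail_ge0 Q my (tau - delta k).
  move: (tail (tau - _)) (expR _) => s e s0 e0 h.
  have : 1 / 2 * s <= e * s by rewrite ler_wpM2r.
  lra.
(* The index [0] leads down to level [0], where the tail is [1] and exceeds [347 * tail tau] by
   [small]. *)
case: (ex_minnP exk) => -[|k] Hk kmin.
  by move: Hk; rewrite /delta expr0 divr1 subrr tail0; lra.
have Hk' : 347 * tail tau < tail (tau - delta k).
  by rewrite ltNge; apply/negP => /kmin; rewrite ltnn.
set e := delta k.+1 in Hk; have e0 : 0 < e by exact: delta0.
have e2 : e + e <= tau by rewrite -deltaS.
(* [tail_ifr] gives [tail tau * tail (tau - 2 e) <= tail (tau - e) ^ 2], and the second factor
   exceeds [347 * tail tau]; a factor of [4] would already give the doubling. *)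
have K2 : 2 * tail tau <= tail (tau - e).
  have := @tail_ifr (tau - (e + e)) (tau - e) e.
  rewrite subr_ge0 => /(_ e2); rewrite subrK.
  rewrite (_ : tau - (e + e) + e = tau - e); last by ring.
  rewrite -deltaS => H; have {}H := H _ (ltW e0).
  rewrite leNgt; apply/negP => lt2.
  have {}H := H (_ : tau - delta k <= tau - e).
  have : tail tau * tail (tau - delta k) <= tail (tau - e) * tail (tau - e).
    by apply: H; rewrite deltaS -/e; lra.
  have tge := upper_tail_ge0 Q my (tau - e).
  nra.
have decay (j : nat) : tail (tau + j%:R * e) <= 2 ^- j * tail tau.
  elim: j => [|j IH]; first by rewrite mul0r addr0 expr0 invr1 mul1r.
  have := @tail_ifr (tau - e) (tau + j%:R * e) e.
  rewrite subr_ge0 subrK (_ : tau + j%:R * e + e = tau + j.+1%:R * e); last by rewrite -natr1; ring.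
  have je : 0 <= j%:R * e by rewrite mulr_ge0// ltW.
  move=> /(_ _ _ (ltW e0)) H.
  have {}H : tail (tau + j.+1%:R * e) * tail (tau - e) <= tail (tau + j%:R * e) * tail tau.
    by apply: H; lra.
  rewrite (exprSr 2 j) invfM.
  have h0 := upper_tail_ge0 Q my (tau + j.+1%:R * e).
  rewrite -(ler_pM2r t0).
  have : tail (tau + j.+1%:R * e) * (2 * tail tau) <= tail (tau + j%:R * e) * tail tau.
    by apply: le_trans H; rewrite ler_wpM2l.
  have : tail (tau + j%:R * e) * tail tau <= 2 ^- j * tail tau * tail tau.
    by rewrite ler_wpM2r// ltW.
  lra.
exists (tau - e); first lra.
apply: le_trans (integral_pos3_tail my e0 Hk decay) _.
rewrite lee_fin (_ : tau - (tau - e) = e); last by ring.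
have e3 : 0 <= e ^+ 3 by rewrite exprn_ge0// ltW.
by rewrite ler_wpM2l//; lra.
Qed.

End dim_ge2.

(** * One dimension: direct estimates *)

Section dim1.
Hypothesis n1 : n = 1%N.
Hypothesis mean1 : (1 <= \int[Q]_w (y w)%:E)%E.

Let aE : a = - 2^-1.
Proof. by rewrite /a n1; field. Qed.

Let powR_a (z : R) : 0 < z -> z `^ a = (Num.sqrt z)^-1.
Proof. by move=> z0; rewrite aE powRN powR12_sqrt// ltW. Qed.

(** The negative exponent makes the power factor at most [1], so decay is at least exponential from
    every level. *)
Let tail_upper u v : 0 <= u -> 0 <= v -> tail (u + v) <= expR (- v / 2) * tail u.
Proof.
move=> u0 v0; apply: tail_shift_le => //.
move=> z uz; have z0 : 0 < z by exact: le_lt_trans uz.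
rewrite weightD// (ler_wpM2r (ltW (weight_gt0 z0)))// ler_piMl ?expR_ge0//.
have zv : 1 <= (z + v) / z by rewrite ler_pdivlMr// mul1r lerDl.
rewrite powR_a; last by exact: lt_le_trans zv.
rewrite invf_le1 ?sqrtr_gt0; last by exact: lt_le_trans zv.
by rewrite -[leLHS]sqrtr1 ler_wsqrtr.
Qed.

(** The density ratio at distance [v] is nondecreasing in [z], so beyond [u] its value at [u] is a
    lower bound. *)
Let tail_lower u v : 0 < u -> 0 <= v ->
  (Num.sqrt ((u + v) / u))^-1 * expR (- v / 2) * tail u <= tail (u + v).
Proof.
move=> u0 v0.
have c0 : 0 <= (Num.sqrt ((u + v) / u))^-1 * expR (- v / 2).
  by rewrite mulr_ge0 ?expR_ge0// invr_ge0 sqrtr_ge0.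
apply: (tail_shift_ge (ltW u0) v0 c0) => z uz.
have z0 : 0 < z by exact: lt_trans uz.
have zv : 0 < (z + v) / z by rewrite divr_gt0// ltr_wpDr.
have uv : 0 < (u + v) / u by rewrite divr_gt0// ltr_wpDr.
rewrite weightD// (ler_wpM2r (ltW (weight_gt0 z0)))// ler_wpM2r ?expR_ge0// powR_a//.
rewrite lef_pV2 ?posrE ?sqrtr_gt0// ler_wsqrtr//.
by apply: ratio_le => //; exact: ltW.
Qed.

Let expRN1 : 1 / 4 <= expR (- 1) :> R.
Proof.
rewrite (_ : - 1 = - (1 / 2) + - (1 / 2)); last by field.
rewrite expRD (_ : 1 / 4 = 1 / 2 * (1 / 2)); last by field.
have h : 1 / 2 <= expR (- (1 / 2)) :> R by apply: le_trans (expR_ge1Dx _); lra.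
by apply: ler_pM.
Qed.

Let expRN1_le : expR (- 1) <= 1 / 2 :> R.
Proof.
rewrite expRN div1r lef_pV2 ?posrE ?expR_gt0//.
by apply: le_trans (expR_ge1Dx _).
Qed.

Let tail_decay u (j : nat) : 0 <= u -> tail (u + j%:R * 2) <= 2 ^- j * tail u.
Proof.
move=> u0; elim: j => [|j IH]; first by rewrite mul0r addr0 expr0 invr1 mul1r.
have j0 : 0 <= u + j%:R * 2 by rewrite addr_ge0// mulr_ge0.
have := tail_upper j0 (ler0n R 2).
rewrite (_ : u + j%:R * 2 + 2 = u + j.+1%:R * 2); last by rewrite -natr1; ring.
rewrite (_ : - 2 / 2 = - 1 :> R); last by field.
move=> h; apply: (le_trans h); rewrite (exprSr 2 j) invfM.
have h0 := upper_tail_ge0 Q my (u + j%:R * 2).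
have : expR (- 1) * tail (u + j%:R * 2) <= 1 / 2 * tail (u + j%:R * 2) by rewrite ler_wpM2r.
lra.
Qed.

(** The mean is at least [1] and at most [1 / 2] plus the mean excess over [1 / 2]. By [tail_decay]
    the excess is at most [2 * (1 + 1 / 2 + 1 / 4 + ...) = 4] times the tail. *)
Let tail_half : 1 / 8 <= tail (1 / 2).
Proof.
have half0 : 0 <= 1 / 2 :> R by rewrite divr_ge0.
have t0 := upper_tail_ge0 Q my (1 / 2).
suff : (\int[Q]_w (Num.max (y w - 1 / 2) 0)%:E <= (4 * tail (1 / 2))%:E)%E.
  move=> h.
  have : (1 <= (1 / 2)%:E + (4 * tail (1 / 2))%:E)%E.
    apply: (le_trans mean1).
    apply: (@le_trans _ _ (\int[Q]_w (1 / 2 + Num.max (y w - 1 / 2) 0)%:E)%E).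
      apply: le_integral_EFin => //.
      - apply: measurable_funD => //; apply: measurable_maxr => //.
        exact: measurable_funB.
      - by move=> w; rewrite -lerBlDl le_max lexx.
    under eq_integral do rewrite EFinD.
    have mmax : measurable_fun setT (fun w => (Num.max (y w - 1 / 2) 0)%:E).
      by apply/measurable_EFinP; apply: measurable_maxr => //; exact: measurable_funB.
    have max0 w : (0 <= (Num.max (y w - 1 / 2) 0)%:E)%E.
      by rewrite lee_fin le_max lexx orbT.
    rewrite ge0_integralD//.
    rewrite integral_cst// [X in (_ * X + _)%E](_ : _ = 1%E).
      by rewrite mule1 leeD2l.
    exact: (probability_setT Q).
  by rewrite -EFinD lee_fin; lra.
apply: (@integral_le_layers _ _ _ Q _ my (fun=> 2) (1 / 2) 2) => //.
- move=> N.
  have : \sum_(j < N) 2 * tail (1 / 2 + j%:R * 2) <= (4 - 4 * 2 ^- N) * tail (1 / 2).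
    elim: N => [|N IH]; first by rewrite big_ord0 expr0 invr1 mulr1 subrr mul0r.
    rewrite big_ord_recr/= (exprSr 2 N) invfM.
    have := tail_decay N half0; lra.
  move=> h; apply: (le_trans h); rewrite ler_wpM2r// gerBl mulr_ge0// invr_ge0 exprn_ge0//.
- by apply: measurable_maxr => //; exact: measurable_funB.
- by move=> w; rewrite le_max lexx orbT.
move=> w N _ yN; rewrite sumr_const card_ord -(mulr_natr 2 N).
have N0 : 0 <= N%:R :> R by [].
by rewrite ge_max; apply/andP; split; lra.
Qed.

(** [tail_lower] from [1 / 2] to [4] loses the square root of [8], at most [3], and
    [expR (- 7 / 4)], at least [1 / 16]; with [tail_half] this yields [1 / 384]. *)
Let tail4 : 1 <= 397 * tail 4.
Proof.
have u0 : 0 < 1 / 2 :> R by [].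
have := @tail_lower (1 / 2) (7 / 2) u0 _; rewrite (_ : 1 / 2 + 7 / 2 = 4); last by field.
rewrite (_ : 4 / (1 / 2) = 8); last by field.
have -> : 0 <= 7 / 2 :> R by rewrite divr_ge0.
move=> /(_ isT) h.
have s3 : 1 / 3 <= (Num.sqrt 8)^-1 :> R.
  rewrite div1r lef_pV2 ?posrE ?sqrtr_gt0// -(ler_pXn2r (n := 2)) ?nnegrE ?sqrtr_ge0//.
  by rewrite sqr_sqrtr//; lra.
have e2 : 1 / 16 <= expR (- (7 / 2) / 2) :> R.
  apply: (@le_trans _ _ (expR (- 1) * expR (- 1))).
    rewrite (_ : 1 / 16 = 1 / 4 * (1 / 4)); last by field.
    by apply: ler_pM.
  by rewrite -expRD ler_expR; lra.
have : 1 / 3 * (1 / 16) * (1 / 8) <= (Num.sqrt 8)^-1 * expR (- (7 / 2) / 2) * tail (1 / 2).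
  by apply: ler_pM => //; apply: ler_pM.
lra.
Qed.

Lemma chi2_tail_1 tau : 0 < tau -> 1 <= 397 * tail tau \/
  exists2 v, v < tau & (\int[Q]_w (pos3 (y w - v))%:E <=
    ((tau - v) ^+ 3 * (397 * tail tau))%:E)%E.
Proof.
move=> tau0; have [tau4|tau4] := leP tau 4.
  by left; have := le_upper_tail Q my tau4; have := tail4; lra.
right; exists (tau - 2); first lra.
have t0 := upper_tail_ge0 Q my tau.
(* [tau > 4] keeps [tau / (tau - 2)] below [4], so the square root costs at most [2] and the
   exponential at most [4]. The total [8 + 50] is well below [397]. *)
have K : tail (tau - 2) <= 8 * tail tau.
  have u0 : 0 < tau - 2 by lra.
  have := tail_lower u0 (ler0n R 2); rewrite subrK.
  rewrite (_ : - 2 / 2 = - 1 :> R); last by field.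
  have s2 : 1 / 2 <= (Num.sqrt (tau / (tau - 2)))^-1.
    have tt : 0 < tau / (tau - 2) by rewrite divr_gt0.
    rewrite div1r lef_pV2 ?posrE ?sqrtr_gt0// -(ler_pXn2r (n := 2)) ?nnegrE ?sqrtr_ge0//.
    by rewrite (sqr_sqrtr (ltW tt)) ler_pdivrMr//; lra.
  have h0 := upper_tail_ge0 Q my (tau - 2).
  have : 1 / 2 * (1 / 4) * tail (tau - 2) <=
      (Num.sqrt (tau / (tau - 2)))^-1 * expR (- 1) * tail (tau - 2).
    by rewrite ler_wpM2r// ler_pM.
  lra.
apply: le_trans (integral_pos3_tail my (ltr0n R 2) K _) _.
  by move=> j; apply: tail_decay; exact: ltW.
rewrite lee_fin (_ : tau - (tau - 2) = 2); last by ring.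
rewrite ler_wpM2l ?exprn_ge0//; lra.
Qed.

End dim1.

Lemma chi2_tail : (n = 1%N -> (1 <= \int[Q]_w (y w)%:E)%E) ->
  forall tau, 0 < tau -> 1 <= 397 * tail tau \/
  exists2 v, v < tau & (\int[Q]_w (pos3 (y w - v))%:E <=
    ((tau - v) ^+ 3 * (397 * tail tau))%:E)%E.
Proof.
move=> mean; have [n1|n1] := eqVneq n 1%N.
  by apply: chi2_tail_1 => //; exact: mean.
apply: chi2_tail_ge2; rewrite subr_ge0 ler_pdivlMr// mul1r ler_nat.
by rewrite ltn_neqAle eq_sym n1.
Qed.

End chi2_tail.

(** * Borel vectors and reflections *)

Section vectors.
Context (R : realType) (d : nat).
Implicit Types x y v : 'cV[R]_d.

Definition sqnorm x : R := \sum_i x i 0 ^+ 2.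
Definition dotp x y : R := \sum_i x i 0 * y i 0.

Definition borel_cV : measurableType _ :=
  g_sigma_algebraType [set A : set 'cV[R]_d | open A].

Lemma measurable_coord i : measurable_fun setT (fun v : borel_cV => v i 0 : R).
Proof.
apply: (measurability _ (RGenOpens.measurableE R)).
move=> _ [_ [a [b ->] <-]]; rewrite setTI; apply: sub_sigma_algebra => /=.
have /continuousP := @coord_continuous R d 1 i 0.
by apply; exact: interval_open.
Qed.

(** Tuples carry the product sigma-algebra, in which functions of the coordinates are measurable
    coordinate by coordinate. *)
Definition tuple_of_cV (v : 'cV[R]_d) : d.-tuple R := [tuple v i 0 | i < d].

Lemma measurable_tuple_of_cV : measurable_fun setT (tuple_of_cV : borel_cV -> d.-tuple R).
Proof.
apply/measurable_fun_tnthP => i.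
rewrite (_ : _ \o _ = (fun v : borel_cV => v i 0)); first exact: measurable_coord.
by apply/funext => v /=; rewrite tnth_mktuple.
Qed.

Lemma random_vecP dT (T : measurableType dT) (X : T -> 'cV[R]_d) :
  random_vec X <-> measurable_fun setT (X : T -> borel_cV).
Proof.
split=> [rX _ B mB|mX B mB]; first by rewrite setTI; exact: rX.
by rewrite -[X in measurable X]setTI; exact: mX.
Qed.

Lemma measurable_random_coord dT (T : measurableType dT) (X : T -> 'cV[R]_d) i :
  random_vec X -> measurable_fun setT (fun w => X w i 0 : R).
Proof.
by move/random_vecP => mX; exact: (measurableT_comp (measurable_coord i) mX).
Qed.

(** The Householder reflection in the hyperplane orthogonal to [v]; for [v = 0] the inverse of [0]
    is [0] and it is the identity. *)
Definition reflection (v : 'cV[R]_d) : 'M[R]_d :=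
  1%:M - (2 / sqnorm v) *: (v *m v^T).

Lemma dotp_mx x y : x^T *m y = (dotp x y)%:M.
Proof.
apply/matrixP => i j; rewrite !ord1 !mxE eqxx mulr1n /dotp.
by apply: eq_bigr => k _; rewrite mxE.
Qed.

Lemma sqnorm_ge0 x : 0 <= sqnorm x.
Proof. by apply: sumr_ge0 => i _; rewrite sqr_ge0. Qed.

Lemma sqnorm_eq0 x : sqnorm x = 0 -> x = 0.
Proof.
move=> x0; apply/matrixP => i j; rewrite ord1 mxE; apply/eqP; rewrite -sqrf_eq0.
move/eqP: x0; rewrite psumr_eq0; last by move=> k _; rewrite sqr_ge0.
by move=> /allP/(_ i); rewrite mem_index_enum => /(_ isT).
Qed.

Lemma dotpC x y : dotp x y = dotp y x.
Proof. by apply: eq_bigr => i _; rewrite mulrC. Qed.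

Lemma dotpDl x y v : dotp (x + y) v = dotp x v + dotp y v.
Proof. by rewrite /dotp -big_split; apply: eq_bigr => i _; rewrite mxE mulrDl. Qed.

Lemma dotpZl a x y : dotp (a *: x) y = a * dotp x y.
Proof. by rewrite /dotp mulr_sumr; apply: eq_bigr => i _; rewrite mxE mulrA. Qed.

Lemma sqnormE x : sqnorm x = dotp x x.
Proof. by apply: eq_bigr => i _; rewrite expr2. Qed.

Lemma sqnormD x y : sqnorm (x + y) = sqnorm x + sqnorm y + 2 * dotp x y.
Proof.
rewrite !sqnormE dotpDl ![dotp _ (x + y)]dotpC !dotpDl (dotpC y x); ring.
Qed.

Lemma sqnormZ a x : sqnorm (a *: x) = a ^+ 2 * sqnorm x.
Proof. by rewrite !sqnormE dotpZl dotpC dotpZl expr2 mulrA. Qed.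

Lemma reflectionE v x : reflection v *m x = x - (2 * dotp v x / sqnorm v) *: v.
Proof.
rewrite /reflection mulmxBl mul1mx -scalemxAl -mulmxA dotp_mx mul_mx_scalar scalerA.
by congr (_ - _ *: _); rewrite mulrAC.
Qed.

Lemma reflection_orthogonal v : orthogonal_mx (reflection v).
Proof.
rewrite /orthogonal_mx.
have -> : (reflection v)^T = reflection v.
  by rewrite /reflection linearB/= trmx1 linearZ/= trmx_mul trmxK.
rewrite {2}/reflection mulmxBr mulmx1 -scalemxAr mulmxA reflectionE.
have [v0|v0] := eqVneq (sqnorm v) 0.
  by rewrite /reflection v0 invr0 mulr0 !scale0r !subr0.
rewrite -sqnormE mulfK// scaler_nat mulr2n opprD addNKr.
by rewrite /reflection mulNmx scalerN opprK subrK.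
Qed.

(** For equal norms [|x - y| ^ 2 = 2 <x - y, x>], so the component removed by the reflection is
    exactly [x - y]. Reflections thus move any vector to any other of the same norm. *)
Lemma reflection_swap x y : sqnorm x = sqnorm y -> reflection (x - y) *m x = y.
Proof.
move=> xy; rewrite reflectionE.
have sE : sqnorm (x - y) = 2 * dotp (x - y) x.
  rewrite -scaleN1r sqnormD sqnormZ dotpDl dotpZl -sqnormE (dotpC x) dotpZl (dotpC y x) -xy; ring.
have [v0|v0] := eqVneq (sqnorm (x - y)) 0.
  rewrite v0 invr0 mulr0 scale0r subr0.
  by apply/eqP; rewrite -subr_eq0; apply/eqP/sqnorm_eq0.
by rewrite -sE divff// scale1r subKr.
Qed.

Lemma dotp_orthogonal U x y : orthogonal_mx U -> dotp (U *m x) (U *m y) = dotp x y.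
Proof.
move=> UU; have UU' : U^T *m U = 1%:M by exact: mulmx1C.
have : (U *m x)^T *m (U *m y) = x^T *m y.
  by rewrite trmx_mul -mulmxA (mulmxA U^T) UU' mul1mx.
rewrite !dotp_mx => /matrixP /(_ 0 0); by rewrite !mxE eqxx !mulr1n.
Qed.

Lemma eucl_normE x : eucl_norm x = Num.sqrt (sqnorm x).
Proof. by []. Qed.

End vectors.

(** * Spherical symmetry through norm and one linear form *)

Section spherical.
Context (R : realType) (d : nat).

Definition measurable_coords dT (T : measurableType dT) (X : T -> 'cV[R]_d) : Prop :=
  forall i, measurable_fun setT (fun w => X w i 0 : R).

(** The part of rotation invariance that the comparison uses. Rotationally invariant vectors have it
    through reflections, Gaussian ones through [gauss_family_sq_lin]. *)
Definition spherical dT (T : measurableType dT) (P : probability T R)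
    (X : T -> 'cV[R]_d) : Prop :=
  forall x x' : 'cV[R]_d, sqnorm x = sqnorm x' ->
  forall f : R * R -> \bar R, measurable_fun setT f -> (forall s, (0 <= f s)%E) ->
  (\int[P]_w f (sqnorm (X w), dotp x (X w)) =
   \int[P]_w f (sqnorm (X w), dotp x' (X w)))%E.

Section measurability.
Context dT (T : measurableType dT) (X : T -> 'cV[R]_d).
Hypothesis mX : measurable_coords X.

Lemma measurable_sqnorm : measurable_fun setT (fun w => sqnorm (X w)).
Proof. by apply: measurable_sum => i; exact: measurable_funX. Qed.

Lemma measurable_dotp x : measurable_fun setT (fun w => dotp x (X w)).
Proof. by apply: measurable_sum => i; exact: measurable_funM. Qed.

End measurability.

Lemma rot_invariant_spherical dT (T : measurableType dT) (P : probability T R)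
  (X : T -> 'cV[R]_d) : random_vec X -> rot_invariant P X -> spherical P X.
Proof.
move=> rX rotX x x' xx' f mf f0.
pose U := reflection (x - x'); have oU : orthogonal_mx U by exact: reflection_orthogonal.
have Ux : U *m x = x' by exact: reflection_swap.
pose F (s : d.-tuple R) : \bar R :=
  f (\sum_i tnth s i ^+ 2, \sum_i x' i 0 * tnth s i).
have mF : measurable_fun setT F.
  apply: (@measurableT_comp _ _ _ _ _ _ _ _ (fun s : d.-tuple R =>
    (\sum_i tnth s i ^+ 2, \sum_i x' i 0 * tnth s i)) mf).
  apply: measurable_fun_pair; apply: measurable_sum => i.
    by apply: measurable_funX; exact: measurable_tnth.
  by apply: measurable_funM => //; exact: measurable_tnth.
have FE v : F (tuple_of_cV v) = f (sqnorm v, dotp x' v).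
  by rewrite /F; congr (f (_, _)); apply: eq_bigr => i _; rewrite tnth_mktuple.
have mX1 : measurable_fun setT (fun w => tuple_of_cV (X w)).
  apply/measurable_fun_tnthP => i; rewrite (_ : _ \o _ = (fun w => X w i 0)).
    exact: measurable_random_coord.
  by apply/funext => w /=; rewrite tnth_mktuple.
have mX2 : measurable_fun setT (fun w => tuple_of_cV (U *m X w)).
  apply/measurable_fun_tnthP => i.
  rewrite (_ : _ \o _ = (fun w => \sum_j U i j * X w j 0)); last first.
    by apply/funext => w /=; rewrite tnth_mktuple mxE.
  by apply: measurable_sum => j; apply: measurable_funM => //; exact: measurable_random_coord.
transitivity (\int[P]_w F (tuple_of_cV (U *m X w)))%E.
  apply: eq_integral => w _; rewrite FE; congr (f (_, _)).
    by rewrite !sqnormE dotp_orthogonal.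
  by rewrite -Ux dotp_orthogonal.
transitivity (\int[P]_w F (tuple_of_cV (X w)))%E; last first.
  by apply: eq_integral => w _; rewrite FE.
transitivity (\int[law P mX2]_s F s)%E; first by rewrite ge0_integral_law// => s; exact: f0.
transitivity (\int[law P mX1]_s F s)%E; last by rewrite ge0_integral_law// => s; exact: f0.
apply: eq_measure_integral => B mB _.
apply: (rotX U oU (@tuple_of_cV R d @^-1` B)).
have := @measurable_tuple_of_cV R d measurableT B mB; rewrite setTI; exact.
Qed.

End spherical.

Lemma measurable_pos3 (R : realType) : measurable_fun setT (@pos3 R).
Proof. by apply: measurable_funX; exact: measurable_maxr. Qed.

(** * Comparison of a single summand *)

Section comparison.
Context (R : realType) (d : nat).
Context dQ (T' : measurableType dQ) (Q : probability T' R) (Y : T' -> 'cV[R]_d).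
Hypothesis mY : measurable_coords Y.
Hypothesis sY : spherical Q Y.
Hypothesis Y0 : Q [set w | sqnorm (Y w) = 0] = 0%E.
Variable e : 'cV[R]_d.
Hypothesis e1 : sqnorm e = 1.
Local Open Scope ereal_scope.

(* The exponent [- 1 / 2] makes [cosY w] the cosine of the angle between [e] and
   [Y w]; it is [0] when [Y w = 0]. *)
Let cosY w : R := (sqnorm (Y w) `^ (- 2^-1) * dotp e (Y w))%R.

Let mcosY : measurable_fun setT cosY.
Proof.
apply: measurable_funM; last exact: measurable_dotp.
by apply: (measurableT_comp (measurable_powR _)); exact: measurable_sqnorm.
Qed.

Let measurable_sqrt : measurable_fun setT (@Num.sqrt R).
Proof. by apply: continuous_measurable_fun; exact: sqrt_continuous. Qed.

Let msym3 dP (T : measurableType dP) (p z : T -> R) : measurable_fun setT p ->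
  measurable_fun setT z -> measurable_fun setT (fun w => sym3 (p w) (z w)).
Proof.
move=> mp mz; apply: measurable_funD; apply: (measurableT_comp (@measurable_pos3 R)).
- exact: measurable_funD.
- exact: measurable_funB.
Qed.

Let integral_cstQ (c : \bar R) : \int[Q]_w c = c.
Proof.
rewrite integral_cst// [X in _ * X](_ : _ = 1) ?mule1//.
exact: (probability_setT Q).
Qed.

(** Symmetry is used twice. Symmetry of [X] replaces [x] by a vector of the same norm along [Y w'];
    then, for fixed [X w], symmetry of [Y] replaces [X w] by a multiple of [e]. Adding the two signs
    of this multiple gives [sym3] and the factor [2], and [X] is left only through its norm. *)
Lemma spherical_polar dP (T : measurableType dP) (P : probability T R)
    (X : T -> 'cV[R]_d) (x : 'cV[R]_d) (a u : R) :
  measurable_coords X -> spherical P X ->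
  2%:E * \int[P]_w (pos3 (sqnorm (x + a *: X w) - u))%:E =
  \int[P]_w \int[Q]_w' (sym3 (sqnorm x - u + (`|a| * Num.sqrt (sqnorm (X w))) ^+ 2)
     (2 * Num.sqrt (sqnorm x) * cosY w' * (`|a| * Num.sqrt (sqnorm (X w)))))%:E.
Proof.
move=> mX sX.
pose A := Num.sqrt (sqnorm x).
have A2 : (A ^+ 2 = sqnorm x)%R by rewrite sqr_sqrtr// sqnorm_ge0.
pose Psi (s : R * R) : \bar R := (pos3 (sqnorm x - u + a ^+ 2 * s.1 + 2 * a * s.2))%:E.
have Psi0 s : 0 <= Psi s by rewrite lee_fin pos3_ge0.
have mPsi : measurable_fun setT Psi.
  apply/measurable_EFinP; apply: (measurableT_comp (@measurable_pos3 R)); apply: measurable_funD.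
    by apply: measurable_funD => //; exact: measurable_funM.
  exact: measurable_funM.
pose iY w := (sqnorm (Y w) `^ (- 2^-1))%R.
have miY : measurable_fun setT iY.
  by apply: (measurableT_comp (measurable_powR _)); exact: measurable_sqnorm.
have iYE w : sqnorm (Y w) != 0%R -> (iY w ^+ 2 * sqnorm (Y w) = 1)%R.
  move=> n0; have n_ge0 := sqnorm_ge0 (Y w).
  by rewrite /iY powRN exprVn powR12_sqrt// sqr_sqrtr// mulVf.
pose k w w' := Psi (sqnorm (X w), A * iY w' * dotp (Y w') (X w))%R.
have k0 w w' : 0 <= k w w' by exact: Psi0.
have mk : measurable_fun setT (fun p : T * T' => k p.1 p.2).
  apply: (@measurableT_comp _ _ _ _ _ _ _ _ (fun p : T * T' =>
    (sqnorm (X p.1), A * iY p.2 * dotp (Y p.2) (X p.1))%R) mPsi).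
  apply: measurable_fun_pair; first exact: (measurableT_comp (measurable_sqnorm mX)).
  apply: measurable_funM.
    by apply: measurable_funM => //; exact: (measurableT_comp miY).
  apply: measurable_sum => i; apply: measurable_funM.
    exact: (measurableT_comp (mY i)).
  exact: (measurableT_comp (mX i)).
pose I := \int[P]_w Psi (sqnorm (X w), dotp x (X w)).
have LHSE : \int[P]_w (pos3 (sqnorm (x + a *: X w) - u))%:E = I.
  apply: eq_integral => w _; rewrite /Psi/= sqnormD sqnormZ [dotp x (_ *: _)]dotpC dotpZl dotpC.
  by congr (pos3 _)%:E; ring.
have I0 : 0 <= I by exact: integral_ge0.
(* [A * iY w'] scales [Y w'] to the norm of [x], which is possible only for [Y w' != 0]. *)
have step1 w' : sqnorm (Y w') != 0%R -> \int[P]_w k w w' = I.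
  move=> n0; transitivity (\int[P]_w Psi (sqnorm (X w), dotp ((A * iY w') *: Y w') (X w))).
    by apply: eq_integral => w _; rewrite dotpZl.
  by apply: sX => //; rewrite sqnormZ exprMn -mulrA iYE// mulr1.
have step2 : I = \int[P]_w \int[Q]_w' k w w'.
  transitivity (\int[Q]_w' \int[P]_w k w w'); last first.
    by apply: (@tonelli_swap _ _ _ _ _ Q P (fun w' w => k w w')) => //;
      exact: (measurableT_comp mk (@measurable_swap _ _ _ _)).
  transitivity (\int[Q]_w' I); first by rewrite integral_cstQ.
  apply: ge0_ae_eq_integral => //.
  - exact: (@measurable_integral_fst _ _ _ _ _ P k mk).
  - by move=> w' _; exact: integral_ge0.
  exists [set w' | sqnorm (Y w') = 0%R]; split => //.
  - have := @measurable_sqnorm _ _ _ _ _ mY measurableT _ (measurable_set1 0%R).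
    by rewrite setTI; exact.
  - move=> w' /= h; apply: contrapT => n0; apply: h => _; apply/esym/step1.
    exact/eqP.
have half w (s : R) : (s ^+ 2 = 1)%R -> \int[Q]_w' k w w' =
    \int[Q]_w' Psi (sqnorm (X w), s * (A * Num.sqrt (sqnorm (X w)) * cosY w'))%R.
  move=> s2; set n := sqnorm (X w).
  have n0 : (0 <= n)%R by exact: sqnorm_ge0.
  pose f (z : R * R) := Psi (n, A * z.1 `^ (- 2^-1) * z.2)%R.
  have mf : measurable_fun setT f.
    apply: (@measurableT_comp _ _ _ _ _ _ _ _ (fun z : R * R =>
      (n, A * z.1 `^ (- 2^-1) * z.2)%R) mPsi).
    apply: measurable_fun_pair => //; apply: measurable_funM => //.
    by apply: measurable_funM => //; exact: (measurableT_comp (measurable_powR _)).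
  transitivity (\int[Q]_w' f (sqnorm (Y w'), dotp (X w) (Y w'))).
    by apply: eq_integral => w' _; rewrite /k /f/= (dotpC (Y w')).
  transitivity (\int[Q]_w' f (sqnorm (Y w'), dotp ((s * Num.sqrt n) *: e) (Y w'))).
    apply: sY => //; last by move=> z; exact: Psi0.
    by rewrite sqnormZ e1 mulr1 exprMn s2 mul1r sqr_sqrtr.
  by apply: eq_integral => w' _; rewrite /f/= dotpZl /cosY; congr (Psi (_, _)); ring.
rewrite LHSE step2 -ge0_integralZl//; last 2 first.
- exact: (@measurable_integral_snd _ _ _ _ _ Q k mk).
- by move=> w _; exact: integral_ge0.
apply: eq_integral => w _; set n := sqnorm (X w).
have n0 : (0 <= n)%R by exact: sqnorm_ge0.
have mPsic (s : R) : measurable_fun setT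
    (fun w' => Psi (n, s * (A * Num.sqrt n * cosY w'))%R).
  apply: (@measurableT_comp _ _ _ _ _ _ _ _ (fun w' =>
    (n, s * (A * Num.sqrt n * cosY w'))%R) mPsi).
  apply: measurable_fun_pair => //; apply: measurable_funM => //.
  exact: measurable_funM.
rewrite -[2%:E]/(1%:E + 1%:E) ge0_muleDl ?lee_fin// !mul1e.
rewrite {1}(half w 1%R) ?expr1n// (half w (-1)%R) ?sqrrN ?expr1n//.
rewrite -ge0_integralD//.
apply: eq_integral => w' _; rewrite /Psi -EFinD /=; congr EFin.
have -> : ((`|a| * Num.sqrt n) ^+ 2 = a ^+ 2 * n)%R.
  by rewrite exprMn sqr_sqrtr// real_normK ?num_real.
rewrite -/A -/n; case: (ger0P a) => a0.
  rewrite /sym3; congr (pos3 _ + pos3 _)%R; ring.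
rewrite -sym3N /sym3; congr (pos3 _ + pos3 _)%R; ring.
Qed.

Hypothesis Y1 : 1 <= \int[Q]_w (sqnorm (Y w))%:E.

(* [sym3] is nondecreasing in the radius, which bounds the contribution of [X] by
   that of the unit sphere, and lies above its tangent in the squared radius, so
   that Jensen's inequality bounds the contribution of [Y] from below. *)
Lemma spherical_le dP (T : measurableType dP) (P : probability T R)
    (X : T -> 'cV[R]_d) (x : 'cV[R]_d) (a u : R) :
  measurable_coords X -> spherical P X ->
  {ae P, forall w, (sqnorm (X w) <= 1)%R} ->
  \int[P]_w (pos3 (sqnorm (x + a *: X w) - u))%:E <=
  \int[Q]_w (pos3 (sqnorm (x + a *: Y w) - u))%:E.
Proof.
move=> mX sX X1.
(* The supporting line is taken at radius [|a|], which must be positive. *)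
have [->|a_neq0] := eqVneq a 0%R.
  under eq_integral do rewrite scale0r addr0.
  under [leRHS]eq_integral do rewrite scale0r addr0.
  rewrite integral_cstQ integral_cst// [Z in _ * Z](_ : _ = 1) ?mule1//.
  exact: (probability_setT P).
have a0 : (0 < `|a|)%R by rewrite normr_gt0.
rewrite -(@lee_pmul2l _ 2%:E)//.
rewrite !spherical_polar//.
set B := (sqnorm x - u)%R.
pose h (n : R) w' : R := sym3 (B + (`|a| * n) ^+ 2)
  (2 * Num.sqrt (sqnorm x) * cosY w' * (`|a| * n)).
have h0 n w' : 0 <= (h n w')%:E by rewrite lee_fin sym3_ge0.
have mh dP' (T1 : measurableType dP') (X1' : T1 -> 'cV[R]_d) : measurable_coords X1' ->
    measurable_fun setT (fun p : T1 * T' => (h (Num.sqrt (sqnorm (X1' p.1))) p.2)%:E).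
  move=> mX1; apply/measurable_EFinP.
  have mn : measurable_fun setT (fun p : T1 * T' => Num.sqrt (sqnorm (X1' p.1))).
    apply: (measurableT_comp measurable_sqrt).
    exact: (measurableT_comp (measurable_sqnorm mX1)).
  have man : measurable_fun setT (fun p : T1 * T' => (`|a| * Num.sqrt (sqnorm (X1' p.1)))%R).
    exact: measurable_funM.
  apply: msym3; first by apply: measurable_funD => //; exact: measurable_funX.
  apply: measurable_funM => //; apply: measurable_funM => //.
  exact: (measurableT_comp mcosY).
have mh1 n : measurable_fun setT (fun w' => (h n w')%:E).
  apply/measurable_EFinP; apply: msym3 => //.
  by apply: measurable_funM => //; exact: measurable_funM.
pose S := \int[Q]_w' (h 1 w')%:E.
apply: (@le_trans _ _ S).
  have -> : S = \int[P]_w S.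
    rewrite [RHS]integral_cst// [Z in _ * Z](_ : _ = 1) ?mule1//.
    exact: (probability_setT P).
  apply: ae_ge0_le_integral => //.
  - by move=> w _; apply: integral_ge0 => w' _; exact: h0.
  - exact: (@measurable_integral_snd _ _ _ _ _ Q
      (fun w w' => (h (Num.sqrt (sqnorm (X w))) w')%:E) (mh _ _ _ mX)).
  - by move=> w _; apply: integral_ge0 => w' _; exact: h0.
  apply: filterS X1 => w X1 _.
  rewrite /S -/(h (Num.sqrt (sqnorm (X w))) _).
  apply: ge0_le_integral => //; [by move=> w' _; exact: h0|exact: mh1|move=> w' _].
  rewrite lee_fin /h -[leRHS]sym3_norm; apply: le_sym3.
    rewrite lerD2l ler_sqr ?nnegrE ?mulr_ge0 ?sqrtr_ge0// mulr1.
    by rewrite ler_piMr// -sqrtr1 ler_wsqrtr.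
  rewrite normrM [leRHS]normrM; apply: ler_wpM2l => //.
  rewrite !normrM normr_id normr1 mulr1 ler_piMr//.
  by rewrite ger0_norm ?sqrtr_ge0// -sqrtr1 ler_wsqrtr.
(* Tonelli's theorem puts the radius inside: for a fixed angle [w'] one supporting line serves all
   radii. *)
apply: (@le_trans _ _ (\int[Q]_w' \int[Q]_w (h (Num.sqrt (sqnorm (Y w))) w')%:E)); last first.
  rewrite le_eqVlt; apply/orP; left; apply/eqP; apply/esym.
  exact: (@tonelli_swap _ _ _ _ _ Q Q
    (fun w w' => (h (Num.sqrt (sqnorm (Y w))) w')%:E) (mh _ _ _ mY)).
rewrite /S; apply: ge0_le_integral => //.
- exact: (@measurable_integral_fst _ _ _ _ _ Q
    (fun w w' => (h (Num.sqrt (sqnorm (Y w))) w')%:E) (mh _ _ _ mY)).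
move=> w' _.
have [m m0 tan] := @sym3_tangent _ B (2 * Num.sqrt (sqnorm x) * cosY w')%R _ a0.
have mhY : measurable_fun setT (fun w => (h (Num.sqrt (sqnorm (Y w))) w')%:E).
  exact: (@measurableT_comp _ _ _ _ _ _ _ _ (fun w => (w, w')) (mh _ _ _ mY)
    (measurable_fun_pair _ _)).
have ma0 : (0 <= m * `|a| ^+ 2)%R by rewrite mulr_ge0.
have mn : measurable_fun setT (fun w => (sqnorm (Y w))%:E).
  by apply/measurable_EFinP; exact: measurable_sqnorm.
have n0 w : 0 <= (sqnorm (Y w))%:E by rewrite lee_fin sqnorm_ge0.
have mmn : measurable_fun setT (fun w => (m * `|a| ^+ 2)%:E * (sqnorm (Y w))%:E).
  exact: measurable_funeM.
have mn0 w : 0 <= (m * `|a| ^+ 2)%:E * (sqnorm (Y w))%:E by rewrite mule_ge0.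
(* The tangent inequality written without subtraction, since the integrals may be infinite. The
   finite [m * |a| ^ 2] is cancelled at the end, using that the mean of the squared norm of [Y] is
   at least [1]. *)
have key : \int[Q]_w ((h 1 w')%:E + (m * `|a| ^+ 2)%:E * (sqnorm (Y w))%:E) <=
    \int[Q]_w ((h (Num.sqrt (sqnorm (Y w))) w')%:E + (m * `|a| ^+ 2)%:E).
  apply: ge0_le_integral => //.
  - by move=> w _; rewrite adde_ge0.
  - by apply: emeasurable_funD.
  - by apply: emeasurable_funD.
  move=> w _; rewrite -EFinM -!EFinD lee_fin.
  have := tan (`|a| * Num.sqrt (sqnorm (Y w)))%R (mulr_ge0 (ltW a0) (sqrtr_ge0 _)).
  rewrite -/(h (Num.sqrt (sqnorm (Y w))) w') /h mulr1 exprMn sqr_sqrtr ?sqnorm_ge0// => ?.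
  lra.
rewrite -(@leeD2rE _ (m * `|a| ^+ 2)%:E)//.
move: key; rewrite ge0_integralD// ge0_integralZl// ge0_integralD// !integral_cstQ.
apply: le_trans; apply: leeD2l.
rewrite -[leLHS]mule1; exact: lee_wpmul2l.
Qed.

End comparison.

(** * Gaussian vectors as families of normal variables *)

Section gaussian_vectors.
Context (R : realType) (d : nat).
Context dQ (T : measurableType dQ) (Q : probability T R).
Local Open Scope ereal_scope.

(* Coordinates indexed by [nat]; [0] outside the range. *)
Definition coordn (v : 'cV[R]_d) (k : nat) : R :=
  if insub k is Some i then v i 0%R else 0%R.

Lemma coordnE v (k : 'I_d) : coordn v k = v k 0%R.
Proof. by rewrite /coordn valK. Qed.

Let prod_mul (f : nat -> \bar R) m :
  \prod_(n < d * m) f n = \prod_(i < m) \prod_(k < d) f (k * m + i)%N.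
Proof.
rewrite exchange_big/=; elim: d => [|d' IH]; first by rewrite mul0n !big_ord0.
rewrite big_ord_recr/= -IH -(big_mkord xpredT) (@big_cat_nat _ _ _ (d' * m))//=; last first.
  by rewrite mulSnr leq_addr.
rewrite big_mkord; congr (_ * _).
rewrite -{1}[(d' * m)%N]add0n big_addn mulSnr addKn big_mkord.
by apply: eq_bigr => i _; rewrite addnC.
Qed.

(** The variable of index [k * m + i] is coordinate [k] of vector [i], so consecutive blocks of
    length [m] collect one coordinate of all the vectors, as [gauss_family_blocks] requires. *)
Lemma gauss_family_coords m (G : nat -> T -> 'cV[R]_d) : (0 < m)%N ->
  (forall i, std_gaussian_vec Q (G i)) ->
  (forall B : nat -> set 'cV[R]_d, (forall i, borel_vec (B i)) ->
    Q (\bigcap_(i < m) (G i @^-1` B i)) = \prod_(i < m) Q (G i @^-1` B i)) ->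
  gauss_family Q (d * m) (fun n w => coordn (G (n %% m)%N w) (n %/ m)).
Proof.
move=> m0 hG ind; split.
- move=> n; have [k _ kn|nd] := insubP 'I_d (n %/ m)%N; last first.
    rewrite (_ : (fun _ => _) = cst 0%R)//; apply/funext => w.
    by rewrite /coordn insubN.
  rewrite (_ : (fun _ => _) = (fun w => G (n %% m)%N w k 0%R)).
    by apply: measurable_random_coord; have [] := hG (n %% m)%N.
  by apply/funext => w; rewrite -kn coordnE.
- move=> B mB.
  (* All constraints on the vector [i] in one Borel set: independence of the vectors splits over
     [i], that of the coordinates then splits each [C i]. *)
  pose C i := [set v : 'cV[R]_d | forall k : 'I_d, B (k * m + i)%N (v k 0%R)].
  have mC i : borel_vec (C i).
    have -> : C i = \bigcap_(k in [set: 'I_d]) ((fun v : borel_cV R d => v k 0%R : R) @^-1` B (k * m + i)%N).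
      by apply/seteqP; split => v h k; [move=> _; exact: h|exact: (h k I)].
    apply: (@fin_bigcap_measurable _ (borel_cV R d)) => // k _.
    by rewrite -[X in measurable X]setTI; exact: measurable_coord.
  rewrite (_ : \bigcap_(i < d * m) _ = \bigcap_(i < m) (G i @^-1` C i)); last first.
    apply/seteqP; split => w h.
      move=> i /= im k; have := h (k * m + i)%N.
      rewrite /= modnMDl modn_small// divnMDl// divn_small// addn0 coordnE; apply.
      apply: (@leq_trans (k.+1 * m)); first by rewrite mulSnr ltn_add2l.
      by rewrite leq_mul2r ltn_ord orbT.
    move=> n /= nm; have nd : (n %/ m < d)%N by rewrite ltn_divLR.
    have := h (n %% m)%N (ltn_pmod _ m0) (Ordinal nd).
    by rewrite /= -coordnE/= -divn_eq.
  rewrite ind// (prod_mul (fun n => Q ((fun w => coordn (G (n %% m)%N w) (n %/ m)) @^-1` B n))).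
  apply: eq_bigr => i _.
  have [_ [indG _]] := hG i.
  have := indG (enum 'I_d) (enum_uniq _) (fun k => B (k * m + i)%N) (fun k => mB _).
  rewrite big_enum/=.
  rewrite (_ : \bigcap_(_ in _) _ = G i @^-1` C i); last first.
    apply/seteqP; split => w h k; last by move=> _; exact: h.
    by apply: h => /=; rewrite mem_enum.
  move=> ->; apply: eq_bigr => k _; congr (Q _); apply/seteqP.
  by rewrite modnMDl modn_small// divnMDl// divn_small// addn0; split => w /=; rewrite coordnE.
- move=> n nm B mB; have nd : (n %/ m < d)%N by rewrite ltn_divLR.
  have [_ [_ hn]] := hG (n %% m)%N.
  rewrite std_gaussE -(hn (Ordinal nd) B mB); congr (Q _).
  by apply/seteqP; split => w /=; rewrite -coordnE.
Qed.

Section single.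
Variable G : T -> 'cV[R]_d.
Hypothesis hG : std_gaussian_vec Q G.
Hypothesis d0 : (0 < d)%N.

Let mG : measurable_coords G.
Proof. by move=> i; apply: measurable_random_coord; case: hG. Qed.

Let gauss_family1 : gauss_family Q d (fun n w => coordn (G w) n).
Proof.
have := @gauss_family_coords 1%N (fun=> G) isT (fun=> hG).
have -> : (fun n (w : T) => coordn (G w) (n %/ 1)) = (fun n w => coordn (G w) n).
  by apply/funext => n; apply/funext => w; rewrite divn1.
rewrite muln1; apply => B mB; rewrite big_ord1; congr (Q _).
apply/seteqP; split => w h; first exact: h.
by move=> [|i].
Qed.

Lemma std_gaussian_spherical : spherical Q G.
Proof.
move=> x x' xx' f mf f0.
have sqE (v : 'cV[R]_d) : (\sum_(i < d) coordn v i ^+ 2 = sqnorm v)%R.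
  by apply: eq_bigr => i _; rewrite coordnE.
have dotE (v v' : 'cV[R]_d) : (\sum_(i < d) coordn v i * coordn v' i = dotp v v')%R.
  by apply: eq_bigr => i _; rewrite !coordnE.
have := @gauss_family_sq_lin R _ T Q d _ (coordn x) (coordn x') f gauss_family1 d0 mf f0.
rewrite !sqE => /(_ xx').
under eq_integral do rewrite sqE dotE.
by under [X in _ = X -> _]eq_integral do rewrite sqE dotE.
Qed.

Let coord_law i (B : set R) : measurable B -> law Q (mG i) B = std_gauss B.
Proof. by move=> mB; rewrite std_gaussE; have [_ [_]] := hG; exact. Qed.

Lemma std_gaussian_sqnorm_ge : d%:R%:E <= \int[Q]_w (sqnorm (G w))%:E.
Proof.
under eq_integral do rewrite /sqnorm -sumEFin.
rewrite ge0_integral_sum//; last 2 first.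
- by move=> i; apply/measurable_EFinP; apply: measurable_funX; exact: mG.
- by move=> i w _; rewrite lee_fin sqr_ge0.
apply: (@le_trans _ _ (\sum_(i < d) 1)).
  by rewrite sumEFin sumr_const card_ord.
apply: lee_sum => i _; apply: (le_trans (gauss_sqr_ge1 R)).
rewrite le_eqVlt; apply/orP; left; apply/eqP; apply/esym.
have mx2 : measurable_fun setT (fun x : R => (x ^+ 2)%:E).
  by apply/measurable_EFinP; exact: measurable_funX.
transitivity (\int[law Q (mG i)]_x (x ^+ 2)%:E).
  by rewrite ge0_integral_law// => x; rewrite lee_fin sqr_ge0.
by apply: eq_measure_integral => B mB _; exact: coord_law.
Qed.

Lemma std_gaussian_neq0 : Q [set w | sqnorm (G w) = 0%R] = 0.
Proof.
pose i := Ordinal d0.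
have m0 : measurable [set w | G w i 0%R = 0%R].
  have := mG i measurableT (measurable_set1 0%R); rewrite setTI; exact.
apply: (@subset_measure0 _ _ _ Q _ [set w | G w i 0%R = 0%R]) => //.
- have := @measurable_sqnorm _ _ _ _ _ mG measurableT _ (measurable_set1 0%R).
  by rewrite setTI; exact.
- by move=> w /= /sqnorm_eq0 ->; rewrite mxE.
transitivity (law Q (mG i) [set 0%R]); first by [].
rewrite coord_law// std_gaussE.
have /null_content_dominatesP := @normal_prob_dominates R 0%R 1%R; apply => //.
exact: lebesgue_measure_set1.
Qed.

End single.

Lemma measurable_coordsZ c (X : T -> 'cV[R]_d) :
  measurable_coords X -> measurable_coords (fun w => c *: X w).
Proof.
move=> mX i; rewrite (_ : (fun _ => _) = (fun w => c * X w i 0%R)%R).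
  exact: measurable_funM.
by apply/funext => w; rewrite mxE.
Qed.

Lemma sphericalZ c (X : T -> 'cV[R]_d) : spherical Q X -> spherical Q (fun w => c *: X w).
Proof.
move=> sX x x' xx' f mf f0.
pose f' (s : R * R) := f (c ^+ 2 * s.1, c * s.2)%R.
have mf' : measurable_fun setT f'.
  apply: (@measurableT_comp _ _ _ _ _ _ _ _ (fun s : R * R => (c ^+ 2 * s.1, c * s.2)%R) mf).
  by apply: measurable_fun_pair; exact: measurable_funM.
have E v w : f (sqnorm (c *: X w), dotp v (c *: X w)) = f' (sqnorm (X w), dotp v (X w)).
  by rewrite /f' sqnormZ (dotpC v) dotpZl (dotpC v).
under eq_integral do rewrite E.
under [RHS]eq_integral do rewrite E.
by apply: sX => // s; exact: f0.
Qed.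

End gaussian_vectors.

(** * Exchange of summands one at a time *)

Section independent_sums.
Context (R : realType) (d : nat).
Local Open Scope ereal_scope.

Definition indep_upto dT (T : measurableType dT) (P : probability T R) (N : nat)
    (X : nat -> T -> 'cV[R]_d) : Prop :=
  forall B : nat -> set 'cV[R]_d, (forall i, borel_vec (B i)) ->
    P (\bigcap_(i < N) (X i @^-1` B i)) = \prod_(i < N) P (X i @^-1` B i).

Lemma mutually_independent_upto dT (T : measurableType dT) (P : probability T R)
    (X : nat -> T -> 'cV[R]_d) N :
  mutually_independent P borel_vec X -> indep_upto P N X.
Proof.
move=> ind B mB; have := ind (index_iota 0 N) (iota_uniq _ _) B mB.
rewrite big_mkord (_ : [set` index_iota 0 N] = `I_N)//.
by apply/seteqP; split => i /=; rewrite mem_index_iota.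
Qed.

Definition psum dT (T : measurableType dT) (X : nat -> T -> 'cV[R]_d) (c : nat -> R)
  k w : 'cV[R]_d := (\sum_(i < k) c i *: X i w)%R.

Lemma measurable_coords_psum dT (T : measurableType dT) (X : nat -> T -> 'cV[R]_d)
    (c : nat -> R) k : (forall i, measurable_coords (X i)) ->
  measurable_coords (psum X c k).
Proof.
move=> mX i; rewrite (_ : (fun _ => _) = (fun w => \sum_(j < k) c j * X j w i 0)%R).
  by apply: measurable_sum => j; apply: measurable_funM => //; exact: mX.
by apply/funext => w; rewrite summxE; apply: eq_bigr => j _; rewrite mxE.
Qed.

Lemma measurable_pos3_sqnorm dT (T : measurableType dT) (X : T -> 'cV[R]_d) u :
  measurable_coords X -> measurable_fun setT (fun w => (pos3 (sqnorm (X w) - u))%:E).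
Proof.
move=> mX; apply/measurable_EFinP; apply: (measurableT_comp (@measurable_pos3 R)).
by apply: measurable_funB => //; exact: measurable_sqnorm.
Qed.

(** The partial sum is the state of a [process] started at [x], stored as a tuple so that its
    coordinates are measurable. *)
Lemma integral_psumS dT (T : measurableType dT) (P : probability T R)
    (X : nat -> T -> 'cV[R]_d) N (c : nat -> R) k (x : 'cV[R]_d) u :
  (forall i, random_vec (X i)) -> indep_upto P N X -> (k < N)%N ->
  \int[P]_w (pos3 (sqnorm (x + psum X c k.+1 w) - u))%:E =
  \int[P]_w1 \int[P]_w2 (pos3 (sqnorm (x + psum X c k w1 + c k *: X k w2) - u))%:E.
Proof.
move=> rX ind kN.
pose phi i (s : d.-tuple R) (v : borel_cV R d) : d.-tuple R :=
  [tuple (tnth s j + c i * v j 0)%R | j < d].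
have mphi i : measurable_fun setT (fun p : d.-tuple R * borel_cV R d => phi i p.1 p.2).
  apply/measurable_fun_tnthP => j.
  rewrite (_ : _ \o _ = (fun p : d.-tuple R * borel_cV R d => tnth p.1 j + c i * p.2 j 0)%R); last first.
    by apply/funext => p; rewrite /= tnth_mktuple.
  apply: measurable_funD; first exact: (measurableT_comp (measurable_tnth j)).
  by apply: measurable_funM => //; exact: (measurableT_comp (measurable_coord j)).
have phiE i v v' : phi i (tuple_of_cV v) v' = tuple_of_cV (v + c i *: v')%R.
  by apply: eq_from_tnth => j; rewrite !tnth_mktuple !mxE.
pose X' : nat -> T -> borel_cV R d := X.
have processE j w : process X' phi (tuple_of_cV x) j w = tuple_of_cV (x + psum X c j w)%R.
  elim: j => [|j IH] /=; first by rewrite /psum big_ord0 addr0.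
  by rewrite IH phiE /psum [in RHS]big_ord_recr/= addrA.
pose f (s : d.-tuple R) : \bar R := (pos3 (\sum_j tnth s j ^+ 2 - u))%:E.
have fE v : f (tuple_of_cV v) = (pos3 (sqnorm v - u))%:E.
  by rewrite /f; congr (pos3 (_ - _))%:E; apply: eq_bigr => j _; rewrite tnth_mktuple.
have mf : measurable_fun setT f.
  apply/measurable_EFinP; apply: (measurableT_comp (@measurable_pos3 R)).
  apply: measurable_funB => //; apply: measurable_sum => j.
  by apply: measurable_funX; exact: measurable_tnth.
have mX i : measurable_fun setT (X i : T -> borel_cV R d) by exact/random_vecP.
have := @integral_processS _ _ _ T _ (borel_cV R d) R P X' phi (tuple_of_cV x) N mX mphi ind k f kN mf.
have f0 s : 0 <= f s by rewrite lee_fin pos3_ge0.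
move=> /(_ f0) E.
transitivity (\int[P]_w f (process X' phi (tuple_of_cV x) k.+1 w)).
  by apply: eq_integral => w _; rewrite processE fE.
rewrite E; apply: eq_integral => w1 _; apply: eq_integral => w2 _.
by rewrite processE phiE fE.
Qed.

(** At a frozen partial sum of the [X i] the last summand is exchanged by [spherical_le]; then the
    new Gaussian summand is frozen and the induction hypothesis treats the remaining ones. Hence the
    induction is over all starting points, and the mixed expression is an iterated integral over
    both probability spaces. *)
Lemma psum_le dT (T : measurableType dT) (P : probability T R)
    (X : nat -> T -> 'cV[R]_d)
    dQ (T' : measurableType dQ) (Q : probability T' R) (G : nat -> T' -> 'cV[R]_d)
    N (a : nat -> R) (x : 'cV[R]_d) u :
  (0 < d)%N ->
  (forall i, random_vec (X i)) -> indep_upto P N X ->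
  (forall i, rot_invariant P (X i)) ->
  (forall i, {ae P, forall w, (eucl_norm (X i w) <= 1)%R}) ->
  (forall i, std_gaussian_vec Q (G i)) -> indep_upto Q N G ->
  \int[P]_w (pos3 (sqnorm (x + psum X a N w) - u))%:E <=
  \int[Q]_w (pos3 (sqnorm (x + psum G (fun i => a i / Num.sqrt d%:R)%R N w) - u))%:E.
Proof.
move=> d0 rX indX rotX ballX gG indG.
have rG i : random_vec (G i) by have [] := gG i.
pose r := Num.sqrt (d%:R : R).
have r0 : (0 < r)%R by rewrite sqrtr_gt0 ltr0n.
pose c i := (a i / r)%R.
have mX i : measurable_coords (X i) by move=> j; exact: measurable_random_coord.
have mG i : measurable_coords (G i) by move=> j; exact: measurable_random_coord.
pose e : 'cV[R]_d := delta_mx (Ordinal d0) 0%R.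
have e1 : (sqnorm e = 1)%R.
  rewrite /sqnorm (bigD1 (Ordinal d0))//= big1 => [|j /negPf jd].
    by rewrite mxE !eqxx expr1n addr0.
  by rewrite mxE jd expr0n.
have step k y : \int[P]_w (pos3 (sqnorm (y + a k *: X k w) - u))%:E <=
    \int[Q]_w (pos3 (sqnorm (y + c k *: G k w) - u))%:E.
  pose Y w := (r^-1 *: G k w)%R.
  have -> : \int[Q]_w (pos3 (sqnorm (y + c k *: G k w) - u))%:E =
      \int[Q]_w (pos3 (sqnorm (y + a k *: Y w) - u))%:E.
    by apply: eq_integral => w _; rewrite scalerA.
  have sE w : (sqnorm (Y w) = r^-1 ^+ 2 * sqnorm (G k w))%R by rewrite sqnormZ.
  have msG : measurable_fun setT (fun w => (sqnorm (G k w))%:E).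
    by apply/measurable_EFinP; exact: measurable_sqnorm.
  apply: (@spherical_le R d _ T' Q Y _ _ _ e e1).
  - exact: measurable_coordsZ.
  - by apply: sphericalZ; exact: std_gaussian_spherical.
  - rewrite (_ : [set _ | _] = [set w | sqnorm (G k w) = 0%R]); first exact: std_gaussian_neq0.
    apply/seteqP; split => w /=; rewrite sE; last by move=> ->; rewrite mulr0.
    by move=> /eqP; rewrite mulf_eq0 sqrf_eq0 invr_eq0 gt_eqF//= => /eqP.
  - under eq_integral do rewrite sE EFinM.
    rewrite ge0_integralZl//; last 2 first.
    + by move=> w _; rewrite lee_fin sqnorm_ge0.
    + by rewrite lee_fin sqr_ge0.
    apply: (@le_trans _ _ ((r^-1 ^+ 2)%:E * d%:R%:E)).
      by rewrite -EFinM lee_fin exprVn sqr_sqrtr ?ler0n// mulVf// pnatr_eq0 -lt0n.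
    by apply: lee_wpmul2l; [rewrite lee_fin sqr_ge0|exact: std_gaussian_sqnorm_ge].
  - exact: mX.
  - exact: rot_invariant_spherical.
  - apply: filterS (ballX k) => w; rewrite eucl_normE => h.
    rewrite -(@ler_sqrt _ _ 1%R)// sqrtr1; exact: h.
rewrite -/r -/c.
suff: forall k, (k <= N)%N -> forall y, \int[P]_w (pos3 (sqnorm (y + psum X a k w) - u))%:E <=
  \int[Q]_w (pos3 (sqnorm (y + psum G c k w) - u))%:E by apply.
have mXp k : measurable_coords (psum X a k) by exact: measurable_coords_psum.
have mGp k : measurable_coords (psum G c k) by exact: measurable_coords_psum.
have msum dA (A : measurableType dA) dB (B : measurableType dB) (U : A -> 'cV[R]_d)
    (V : B -> 'cV[R]_d) y b : measurable_coords U -> measurable_coords V ->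
    measurable_fun setT (fun p : A * B => (pos3 (sqnorm (y + U p.1 + b *: V p.2) - u))%:E).
  move=> mU mV; apply: (@measurable_pos3_sqnorm _ _ (fun p : A * B => y + U p.1 + b *: V p.2)%R) => j.
  rewrite (_ : (fun _ => _) = (fun p : A * B => y j 0 + U p.1 j 0 + b * V p.2 j 0)%R); last first.
    by apply/funext => p; rewrite !mxE.
  apply: measurable_funD.
    by apply: measurable_funD => //; exact: (measurableT_comp (mU j)).
  by apply: measurable_funM => //; exact: (measurableT_comp (mV j)).
have p0 v : 0 <= (pos3 (sqnorm v - u))%:E by rewrite lee_fin pos3_ge0.
elim=> [_ y|k IH kN y].
  under eq_integral do rewrite /psum big_ord0.
  under [leRHS]eq_integral do rewrite /psum big_ord0.
  rewrite !integral_cst// [Z in _ * Z <= _](_ : _ = 1); last exact: (probability_setT P).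
  by rewrite [Z in _ <= _ * Z](_ : _ = 1)//; exact: (probability_setT Q).
rewrite (integral_psumS a y u rX indX kN) (integral_psumS c y u rG indG kN).
pose F w1 w2 : \bar R := (pos3 (sqnorm (y + psum X a k w1 + c k *: G k w2) - u))%:E.
pose H w1 w2 : \bar R := (pos3 (sqnorm (y + psum G c k w1 + c k *: G k w2) - u))%:E.
have F0 w1 w2 : 0 <= F w1 w2 by exact: p0.
have H0 w1 w2 : 0 <= H w1 w2 by exact: p0.
have mF : measurable_fun setT (fun p : T * T' => F p.1 p.2) by exact: msum.
have mH : measurable_fun setT (fun p : T' * T' => H p.1 p.2) by exact: msum.
(* The mixed expression: partial sum from [X], last summand from [G]. *)
apply: (@le_trans _ _ (\int[P]_w1 \int[Q]_w2 F w1 w2)).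
  apply: ge0_le_integral => //.
  - by move=> w _; apply: integral_ge0.
  - apply: (@measurable_integral_snd _ _ _ _ _ P (fun w1 w2 =>
      (pos3 (sqnorm (y + psum X a k w1 + a k *: X k w2) - u))%:E)) => //.
    exact: msum.
  - exact: (@measurable_integral_snd _ _ _ _ _ Q F).
rewrite (@tonelli_swap _ _ _ _ _ P Q F)// (@tonelli_swap _ _ _ _ _ Q Q H)//.
apply: ge0_le_integral => //.
- by move=> w _; exact: integral_ge0.
- exact: (@measurable_integral_fst _ _ _ _ _ P F).
- exact: (@measurable_integral_fst _ _ _ _ _ Q H).
move=> w2 _; rewrite /F /H.
under eq_integral do rewrite addrAC.
under [leRHS]eq_integral do rewrite addrAC.
exact: (IH (ltnW kN)).
Qed.

End independent_sums.

(** * Tail of a normalised Gaussian sum *)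

Section gaussian_sums.
Context (R : realType) (d : nat) dQ (T : measurableType dQ) (Q : probability T R).
Variables (G : nat -> T -> 'cV[R]_d) (m : nat) (b : nat -> R).
Hypothesis d0 : (0 < d)%N.
Hypothesis m0 : (0 < m)%N.
Hypothesis gG : forall i, std_gaussian_vec Q (G i).
Hypothesis indG : indep_upto Q m G.
Hypothesis b1 : \sum_(i < m) b i ^+ 2 = 1.

Local Notation y := (fun w => sqnorm (psum G b m w)).

Let y_blocks (h : R -> \bar R) : measurable_fun setT h -> (forall x, (0 <= h x)%E) ->
  (\int[Q]_w h (y w) = iter d (@add_gauss_sq R) h 0%R)%E.
Proof.
move=> mh h0.
rewrite -(gauss_family_blocks m0 b1 (gauss_family_coords m0 gG indG) mh h0).
apply: eq_integral => w _; congr h; apply: eq_bigr => l _; congr (_ ^+ 2).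
rewrite summxE; apply: eq_bigr => i _.
by rewrite mxE modnMDl modn_small// divnMDl// divn_small// addn0 coordnE.
Qed.

Lemma measurable_gauss_sum_sq : measurable_fun setT y.
Proof.
apply: measurable_sqnorm; apply: measurable_coords_psum => i j.
by apply: measurable_random_coord; have [] := gG i.
Qed.

Lemma gauss_sum_sq_tail tau : 0 < tau -> 1 <= 397 * upper_tail Q y tau \/
  exists2 v, v < tau & (\int[Q]_w (pos3 (y w - v))%:E <=
    ((tau - v) ^+ 3 * (397 * upper_tail Q y tau))%:E)%E.
Proof.
apply: (chi2_tail (n := d)) => //.
- exact: measurable_gauss_sum_sq.
- by move=> w; exact: sqnorm_ge0.
- move=> c h c0 mh h0.
  have mhc : measurable_fun setT (fun z : R => h (c ^+ 2 * z)).
    by apply: (measurableT_comp mh); exact: measurable_funM.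
  set s := (1 - c ^- 2) / 2.
  have mhs : measurable_fun setT (fun z => h z * (expR (z * s))%:E)%E.
    apply: emeasurable_funM => //; apply/measurable_EFinP.
    by apply: (measurableT_comp (@measurable_expR R)); exact: measurable_funM.
  rewrite (y_blocks mhc); last by move=> z; exact: h0.
  rewrite (y_blocks mhs); last by move=> z; rewrite mule_ge0// lee_fin expR_ge0.
  by rewrite (iter_add_gauss_sq_scale d 0 c0 mh h0) !mulr0 mul0r oppr0 expR0 mulr1.
(* The absolute value makes [h] nonnegative on the whole line; on the squared norms it is the
   identity. *)
move=> d1; pose h (z : R) : \bar R := (`|z|)%:E.
have mh : measurable_fun setT h by apply/measurable_EFinP; exact: normr_measurable.
have h0 z : (0 <= h z)%E by rewrite lee_fin.
have -> : (\int[Q]_w (y w)%:E = \int[Q]_w h (y w))%E.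
  by apply: eq_integral => w _; rewrite /h ger0_norm// sqnorm_ge0.
rewrite y_blocks// d1; apply: (le_trans (gauss_sqr_ge1 R)).
rewrite le_eqVlt; apply/orP; left; apply/eqP.
by apply: eq_integral => x _; rewrite add0r /h ger0_norm// sqr_ge0.
Qed.

End gaussian_sums.

(** * From cubic moments to tails *)

Lemma ge0_markov_pos3 (R : realType) dT (T : measurableType dT) (P : probability T R)
    (f : T -> R) (s u : R) : measurable_fun setT f -> u < s ->
  (((s - u) ^+ 3)%:E * P [set w | (s < f w)%R] <= \int[P]_w (pos3 (f w - u))%:E)%E.
Proof.
move=> mf us; have mA : measurable [set w | s < f w] by exact: measurable_upper_tail.
have su0 : 0 <= (s - u) ^+ 3 by rewrite exprn_ge0// subr_ge0 ltW.
rewrite -integral_cst_indic//; apply: le_integral_EFin.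
- by apply: measurable_funM => //; exact: measurable_indic.
- apply: (measurableT_comp (@measurable_pos3 R)); exact: measurable_funB.
- by move=> w; rewrite mulr_ge0.
move=> w; rewrite indicE; case: (boolP (w \in _)) => [/set_mem/= sf|_]; last first.
  by rewrite mulr0 pos3_ge0.
by rewrite mulr1 pos3E ?lerXn2r ?nnegrE ?subr_ge0 ?lerD2r// ltW// (lt_trans us).
Qed.

(** Dividing the coefficients by [sigma] gives them unit length, so that the squared norm of the
    Gaussian sum is [K] times a chi-squared variable; [K ^+ 3] cancels because [pos3] is
    homogeneous. *)
Lemma psum_tail_le (R : realType) (d : nat) dT (T : measurableType dT) (P : probability T R)
    (X : nat -> T -> 'cV[R]_d) dQ (T' : measurableType dQ) (Q : probability T' R)
    (G : nat -> T' -> 'cV[R]_d) m (a : nat -> R) (s : R) :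
  (0 < d)%N -> (0 < m)%N -> 0 < s ->
  (forall i, random_vec (X i)) -> indep_upto P m X ->
  (forall i, rot_invariant P (X i)) ->
  (forall i, {ae P, forall w, eucl_norm (X i w) <= 1}) ->
  (forall i, std_gaussian_vec Q (G i)) -> indep_upto Q m G ->
  (P [set w | (s < sqnorm (psum X a m w))%R] <=
   397%:E * Q [set w | (s < sqnorm (psum G (fun i => a i / Num.sqrt d%:R) m w))%R])%E.
Proof.
move=> d0 m0 s0 rX indX rotX ballX gG indG.
set r := Num.sqrt d%:R; pose c i := a i / r.
have r0 : 0 < r by rewrite sqrtr_gt0 ltr0n.
have mX i : measurable_coords (X i) by move=> j; exact: measurable_random_coord.
have mSX : measurable_fun setT (fun w => sqnorm (psum X a m w)).
  by apply: measurable_sqnorm; exact: measurable_coords_psum.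
pose sigma := Num.sqrt (\sum_(i < m) a i ^+ 2).
(* Coefficients that all vanish cannot be normalised; the left event is then empty as [s > 0]. *)
have [a0|a0] := eqVneq (\sum_(i < m) a i ^+ 2) 0.
  have -> : [set w | s < sqnorm (psum X a m w)] = set0; last first.
    by rewrite measure0; apply: mule_ge0; [exact: (ler0n _ 397)|exact: measure_ge0].
  apply/seteqP; split => // w /=; rewrite /psum big1 => [|i _].
    by rewrite /sqnorm big1 ?ltNge ?(ltW s0)// => i _; rewrite mxE expr0n.
  move/eqP: a0; rewrite psumr_eq0; last by move=> j _; rewrite sqr_ge0.
  by move=> /allP/(_ i); rewrite mem_index_enum sqrf_eq0 => /(_ isT)/eqP ->; rewrite scale0r.
have sig2 : sigma ^+ 2 = \sum_(i < m) a i ^+ 2.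
  by rewrite sqr_sqrtr// sumr_ge0// => i _; rewrite sqr_ge0.
have sig0 : 0 < sigma.
  by rewrite sqrtr_gt0 lt_def a0 sumr_ge0// => i _; rewrite sqr_ge0.
pose b i := a i / sigma.
have b1 : \sum_(i < m) b i ^+ 2 = 1.
  under eq_bigr do rewrite exprMn.
  by rewrite -mulr_suml -sig2 exprVn mulfV// sqrf_eq0 gt_eqF.
pose y w := sqnorm (psum G b m w).
pose K := (sigma / r) ^+ 2.
have K0 : 0 < K by rewrite exprn_gt0// divr_gt0.
have yE w : sqnorm (psum G c m w) = K * y w.
  rewrite -sqnormZ /psum scaler_sumr; congr sqnorm; apply: eq_bigr => i _.
  rewrite scalerA; congr (_ *: _); rewrite /c /b; field.
  by rewrite !gt_eqF.
have my : measurable_fun setT y by exact: measurable_gauss_sum_sq.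
pose tau := s / K.
have tau0 : 0 < tau by rewrite divr_gt0.
have -> : [set w | s < sqnorm (psum G c m w)] = [set w | tau < y w].
  by apply/seteqP; split => w /=; rewrite yE ltr_pdivrMr// mulrC.
rewrite -(upper_tailE Q my) -EFinM.
have [h|[v vtau h]] := gauss_sum_sq_tail d0 m0 gG indG b1 tau0.
  by apply: le_trans (probability_le1 P _) _ => //; exact: measurable_upper_tail.
have sE : s = K * tau by rewrite mulrC divfK// gt_eqF.
(* The level [v] was chosen on the chi-squared scale; [K * v] is the same level for the squared
   norms of the sums. *)
have us : K * v < s by rewrite sE ltr_pM2l.
have := ge0_markov_pos3 P mSX us.
have := @psum_le R d _ T P X _ T' Q G m a 0 (K * v) d0 rX indX rotX ballX gG indG.
under eq_integral do rewrite add0r.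
under [X in (_ <= X)%E -> _]eq_integral do rewrite add0r.
move=> h1 h2; have {h1 h2} := le_trans h2 h1.
have -> : (\int[Q]_w (pos3 (sqnorm (psum G (fun i => a i / Num.sqrt d%:R) m w) - K * v))%:E =
    (K ^+ 3)%:E * \int[Q]_w (pos3 (y w - v))%:E)%E.
  rewrite -ge0_integralZ_EFin.
  - by apply: eq_integral => w _; rewrite yE -mulrBr pos3M// ltW.
  - by apply: (measurableT_comp (@measurable_pos3 R)); exact: measurable_funB.
  - by move=> w; exact: pos3_ge0.
  - by rewrite exprn_ge0// ltW.
move=> h3; have K30 : (0 <= (K ^+ 3)%:E)%E by rewrite lee_fin exprn_ge0// ltW.
have {h3} := le_trans h3 (lee_wpmul2l K30 h).
rewrite -(upper_tailE P mSX) -!EFinM !lee_fin.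
have -> : s - K * v = K * (tau - v) by rewrite mulrBr -sE.
rewrite exprMn -(mulrA (K ^+ 3)) ler_pM2l; last exact: exprn_gt0.
by rewrite ler_pM2l// exprn_gt0// subr_gt0.
Qed.

Theorem theorem2 (R : realType) (d : nat) (hd : (1 <= d)%N)
  (dT : measure_display) (T : measurableType dT) (P : probability T R)
  (X : nat -> T -> 'cV[R]_d)
  (hXrv : forall i, random_vec (X i))
  (hXind : mutually_independent P borel_vec X)
  (hXrot : forall i, rot_invariant P (X i))
  (hXball : forall i, {ae P, forall w, eucl_norm (X i w) <= 1})
  (dT' : measure_display) (T' : measurableType dT') (Q : probability T' R)
  (G : nat -> T' -> 'cV[R]_d)
  (hGgauss : forall i, std_gaussian_vec Q (G i))
  (hGind : mutually_independent Q borel_vec G)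
  (m : nat) (hm : (1 <= m)%N) (a : nat -> R) (t : R) (ht : 0 < t) :
  (P [set w | (t < eucl_norm (\sum_(i < m) a i *: X i w))%R]
   <= 397%:E * Q [set w | (t < eucl_norm (\sum_(i < m) (a i / Num.sqrt d%:R) *: G i w))%R])%E.
Proof.
have normE (v : 'cV[R]_d) : (t < eucl_norm v) = (t ^+ 2 < sqnorm v).
  rewrite eucl_normE -(@ltr_pXn2r _ 2) ?nnegrE ?sqrtr_ge0 ?(ltW ht)//.
  by rewrite sqr_sqrtr// sqnorm_ge0.
rewrite (_ : [set w | _] = [set w | t ^+ 2 < sqnorm (psum X a m w)]); last first.
  by apply/seteqP; split => w /=; rewrite normE.
rewrite (_ : [set w | t < _] = [set w | t ^+ 2 <
    sqnorm (psum G (fun i => a i / Num.sqrt d%:R) m w)]); last first.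
  by apply/seteqP; split => w /=; rewrite normE.
apply: psum_tail_le => //; first exact: exprn_gt0.
- exact: mutually_independent_upto.
- exact: mutually_independent_upto.
Qed.
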